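(* For each twinic group $X$ there is a cardinal $m$ such that: (1) each minimal left ideal of $\lambda(X)$ is algebraically isomorphic to the semigroup $$2^m\times\prod_{1\le k\le\infty}C_{2^k}^{\,q(X,C_{2^k})}\times\prod_{3\le k\le\infty}Q_{2^k}^{\,q(X,Q_{2^k})},$$ where the Cantor discontinuum $2^m=\{0,1\}^m$ is endowed with the left zero multiplication $xy=x$; (2) if $q(X,C_{2^\infty})=q(X,Q_{2^\infty})=0$ and $\mathbb I\cap\widehat{\mathcal K}=\emptyset$, where $\mathbb I$ is the twinic ideal of $X$ and $\widehat{\mathcal K}$ is the family of maximal 2-cogroups of $X$, then some minimal left ideal of $\lambda(X)$ is topologically isomorphic to the compact topological semigroup $$2^m\times\prod_{1\le k<\infty}C_{2^k}^{\,q(X,C_{2^k})}\times\prod_{3\le k<\infty}Q_{2^k}^{\,q(X,Q_{2^k})};$$ (3) each maximal subgroup of the minimal ideal of $\lambda(X)$ is algebraically isomorphic to the group $$\prod_{1\le k\le\infty}C_{2^k}^{\,q(X,C_{2^k})}\times\prod_{3\le k\le\infty}Q_{2^k}^{\,q(X,Q_{2^k})};$$ (4) if $q(X,C_{2^\infty})=q(X,Q_{2^\infty})=0$, then each maximal subgroup of the minimal ideal of $\lambda(X)$ is topologically isomorphic to the compact topological group $$\prod_{1\le k<\infty}C_{2^k}^{\,q(X,C_{2^k})}\times\prod_{3\le k<\infty}Q_{2^k}^{\,q(X,Q_{2^k})}.$$ (Finite groups are discrete, $2^m$ carries the product topology, and products carry product topologies.)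
   Context: Superextension. $\mathsf P(X)$ is the power-set of a group $X$. A family $\mathcal L\subset\mathsf P(X)$ is linked if $A\cap B\ne\emptyset$ for all $A,B\in\mathcal L$, and maximal linked if it is linked and coincides with every linked family containing it. $\lambda(X)\subset\mathsf P(\mathsf P(X))$ is the set of maximal linked systems on $X$, with the subspace topology of $\mathsf P(\mathsf P(X))\cong\{0,1\}^{\mathsf P(X)}$ and the operation $\mathcal A\circ\mathcal B=\{A\subset X:\{x\in X:x^{-1}A\in\mathcal B\}\in\mathcal A\}$; it is a compact Hausdorff right-topological semigroup (right shifts $x\mapsto x\circ a$ are continuous). The minimal ideal is the smallest two-sided ideal, equal to the union of all minimal left ideals. A maximal subgroup of the minimal ideal is the largest subgroup containing some idempotent of it. ''Algebraically isomorphic'' means semigroup-isomorphic; ''topologically isomorphic'' means there is a semigroup isomorphism that is a homeomorphism. Twinic groups. An ideal on $X$ is a nonempty family $\mathcal I\subset\mathsf P(X)$ closed under finite unions and subsets, with $X\notin\mathcal I$; left-invariant means $xA\in\mathcal I$ for $A\in\mathcal I$, $x\in X$. $A\subset_{\mathcal I}B$ means $A\setminus B\in\mathcal I$; $A=_{\mathcal I}B$ means $A\subset_{\mathcal I}B$ and $B\subset_{\mathcal I}A$. A left-invariant ideal $\mathcal I$ is twinic if for all $A\subset X$, $x,y\in X$ with $xA\subset_{\mathcal I}X\setminus A\subset_{\mathcal I}yA$ one has $xA=_{\mathcal I}yA$. $X$ is twinic if it admits a twinic ideal; the twinic ideal $\mathbb I$ of a twinic group $X$ is the intersection of all twinic ideals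 on $X$ (it is the smallest twinic ideal). 2-cogroups. A nonempty subset $K\subset X$ is a 2-cogroup if for every $x\in K$ the shift $xK=Kx$ is a subgroup of $X$ disjoint from $K$. Then $KK=\{ab:a,b\in K\}$ is a subgroup of index 2 in the subgroup $K^\pm=K\cup KK$. $\widehat{\mathcal K}$ is the set of 2-cogroups of $X$ that are maximal with respect to inclusion. $X$ acts on 2-cogroups by conjugation, $[K]=\{xKx^{-1}:x\in X\}$ is the orbit, $\mathrm{Stab}(K)=\{x\in X:xKx^{-1}=K\}$, and the characteristic group of $K$ is $\mathsf H(K)=\mathrm{Stab}(K)/KK$. Groups and numbers. $C_{2^k}=\{z\in\mathbb C:z^{2^k}=1\}$ for finite $k$; $Q_8=\{\pm1,\pm i,\pm j,\pm k\}\subset\mathbb H$; for finite $k$, $Q_{2^k}$ is the multiplicative subgroup of the quaternions $\mathbb H\supset\mathbb C$ generated by $C_{2^{k-1}}\cup Q_8$; $C_{2^\infty}=\bigcup_{k\ge1}C_{2^k}$, $Q_{2^\infty}=\bigcup_{k\ge3}Q_{2^k}$. For $G\in\{C_{2^k},Q_{2^k}:k\in\mathbb N\cup\{\infty\}\}$, $q(X,G)$ is the number (cardinal) of orbits $[K]$, $K\in\widehat{\mathcal K}$, with $\mathsf H(K)\cong G$. *)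

(* Defs.v *)
From HB Require Import structures.
From mathcomp Require Import all_boot all_order all_algebra.
From mathcomp Require Import complex ring.
From mathcomp Require Import all_classical all_reals all_analysis.

Set Implicit Arguments.
Unset Strict Implicit.
Unset Printing Implicit Defensive.

Import GRing.Theory.
Local Open Scope classical_set_scope.
Local Open Scope group_scope.

(* Every semigroup below is given as a subset [S], closed under products, of an
   ambient [semigroupType]. *)

(* No compatibility between product and topology is required: the superextension
   is only right-topological. *)
#[short(type="preTopologicalSemigroupType")]
HB.structure Definition PreTopologicalSemigroup :=
  {T of Topological T & Semigroup T}.

Section Semigroups.
Context {T : semigroupType}.
Implicit Types S L I G : set T.

Definition left_ideal S L :=
  [/\ L !=set0, L `<=` S & forall s x, S s -> L x -> L (s * x)].

Definition minimal_left_ideal S L :=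
  left_ideal S L /\ forall L', left_ideal S L' -> L' `<=` L -> L' = L.

Definition two_sided_ideal S I :=
  [/\ I !=set0, I `<=` S &
      forall s x, S s -> I x -> I (s * x) /\ I (x * s)].

Definition minimal_ideal S : set T := smallest (two_sided_ideal S) set0.

Definition subgroup G :=
  (forall x y, G x -> G y -> G (x * y)) /\
  exists2 e, G e & forall x, G x ->
    [/\ e * x = x, x * e = x & exists2 y, G y & x * y = e /\ y * x = e].

Definition maximal_subgroup S G :=
  exists e, [/\ minimal_ideal S e, e * e = e &
    [/\ subgroup G, G `<=` S & G e] /\
    forall G', subgroup G' -> G' `<=` S -> G' e -> G' `<=` G].

End Semigroups.

Definition isomorphism {T U : semigroupType} (S : set T) (S' : set U)
    (f : T -> U) :=
  set_bij S S' f /\ {in S &, {morph f : x y / x * y}}.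

Definition alg_isomorphic {T U : semigroupType} (S : set T) (S' : set U) :=
  exists f : T -> U, isomorphism S S' f.

Definition top_isomorphic {T U : preTopologicalSemigroupType}
    (S : set T) (S' : set U) :=
  exists (f : T -> U) (g : U -> T),
    [/\ isomorphism S S' f, {in S, cancel f g},
        {within S, continuous f} & {within S', continuous g}].

Section ProductSemigroup.
Context {I : Type} (T : I -> preTopologicalSemigroupType).

Definition prod_mul (f g : prod_topology T) : prod_topology T :=
  fun i => f i * g i.

Fact prod_mulA : associative prod_mul.
Proof. by move=> f g h; apply: functional_extensionality_dep => i; exact: mulgA. Qed.

HB.instance Definition _ := hasMul.Build (prod_topology T) prod_mul.
HB.instance Definition _ := Magma_isSemigroup.Build (prod_topology T) prod_mulA.
End ProductSemigroup.

HB.instance Definition _ (T : semigroupType) :=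
  Semigroup.copy (discrete_topology T) T.

HB.instance Definition _ (T U : preTopologicalSemigroupType) :=
  Semigroup.on (T * U)%type.

Section LeftZeroCube.
Variable M : Type.

Definition left_zero_cube : Type := prod_topology (fun _ : M => bool).
HB.instance Definition _ :=
  Topological.copy left_zero_cube (prod_topology (fun _ : M => bool)).

Definition left_zero_mul (x y : left_zero_cube) : left_zero_cube := x.

Fact left_zero_mulA : associative left_zero_mul.
Proof. by []. Qed.

HB.instance Definition _ := hasMul.Build left_zero_cube left_zero_mul.
HB.instance Definition _ := Magma_isSemigroup.Build left_zero_cube left_zero_mulA.
End LeftZeroCube.

Variant exponent := Fin of nat | Infty.

(* [Quat a b] is [a + b j] with [a], [b] complex. *)
Section Quaternions.
Variable R : realType.

Record quat : Type := Quat { qfst : R[i]; qsnd : R[i] }.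

HB.instance Definition _ := gen_eqMixin quat.
HB.instance Definition _ := gen_choiceMixin quat.

Definition quat_mul (p q : quat) : quat :=
  (Quat (qfst p * qfst q - qsnd p * conjc (qsnd q))
        (qfst p * qsnd q + qsnd p * conjc (qfst q)))%R.

Fact quat_mulA : associative quat_mul.
Proof.
move=> [a b] [c d] [e f]; rewrite /quat_mul /=.
by rewrite !(rmorphD, rmorphN, rmorphM) /= !conjcK; congr Quat; ring.
Qed.

HB.instance Definition _ := hasMul.Build quat quat_mul.
HB.instance Definition _ := Magma_isSemigroup.Build quat quat_mulA.

Definition Q8 : set quat :=
  [set Quat z 0 | z in [set 1; -1; 'i; -'i]%C]%R `|`
  [set Quat 0 z | z in [set 1; -1; 'i; -'i]%C]%R.

Definition C2n (k : nat) : set quat :=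
  [set Quat z 0 | z in [set z : R[i] | z ^+ (2 ^ k) = 1]]%R.

Definition C2 (k : exponent) : set quat :=
  if k is Fin n then C2n n else \bigcup_(n in [set n | 1 <= n]%N) C2n n.

Definition Q2n (k : nat) : set quat :=
  smallest (@subgroup quat) (C2n k.-1 `|` Q8).

Definition Q2 (k : exponent) : set quat :=
  if k is Fin n then Q2n n else \bigcup_(n in [set n | 3 <= n]%N) Q2n n.

End Quaternions.

Arguments C2 R k : clear implicits.
Arguments Q2 R k : clear implicits.

Definition range_inf (a : nat) : set exponent :=
  [set k | if k is Fin n then (a <= n)%N else True].

Definition range_fin (a : nat) : set exponent :=
  [set k | if k is Fin n then (a <= n)%N else False].

Definition left_shift {X : groupType} (x : X) (A : set X) : set X :=
  [set x * a | a in A].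

Definition right_shift {X : groupType} (A : set X) (x : X) : set X :=
  [set a * x | a in A].

Section PowerSemigroup.
Variable X : groupType.

Definition power : Type := set X.
HB.instance Definition _ := Choice.copy power (set X).

Definition power_mul (A B : power) : power :=
  [set a * b | a in (A : set X) & b in (B : set X)].

Fact power_mulA : associative power_mul.
Proof.
move=> A B C; apply/seteqP; split=> x /=.
  move=> [a Aa [_ [b Bb [c Cc <-]] <-]]; exists (a * b); first by exists a => //; exists b.
  by exists c; rewrite // mulgA.
move=> [_ [a Aa [b Bb <-]] [c Cc <-]]; exists a => //.
by exists (b * c); [exists b => //; exists c|rewrite mulgA].
Qed.

HB.instance Definition _ := hasMul.Build power power_mul.
HB.instance Definition _ := Magma_isSemigroup.Build power power_mulA.
End PowerSemigroup.

Section Superextension.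
Variable X : groupType.

Definition double_power : Type := set (set X).
HB.instance Definition _ := Topological.copy double_power
  (prod_topology (fun _ : set X => discrete_topology Prop)).

Definition double_power_mul (A B : double_power) : double_power :=
  [set S : set X | A [set x | B (left_shift x^-1 S)]].

Fact double_power_mulA : associative double_power_mul.
Proof.
move=> A B C; apply/funext => S; rewrite /double_power_mul /=; congr (A _).
apply/funext => x /=; congr (B _); apply/seteqP; split=> y /=.
  move=> H; exists (x * y); last by rewrite mulKg.
  by congr (C _): H; apply/seteqP; split=> z /=;
    [move=> [_ [s Ss <-] <-]|move=> [s Ss <-]];
    [exists s|exists (x^-1 * s); first by exists s]; rewrite // invgM mulgA.
move=> [z H <-].
by congr (C _): H; apply/seteqP; split=> t /=;
  [move=> [s Ss <-]|move=> [_ [s Ss <-] <-]];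
  [exists (x^-1 * s); first by exists s|exists s]; rewrite // invgM invgK -mulgA // mulVKg.
Qed.

HB.instance Definition _ := hasMul.Build double_power double_power_mul.
HB.instance Definition _ := Magma_isSemigroup.Build double_power double_power_mulA.

Definition linked (L : set (set X)) :=
  forall A B, L A -> L B -> A `&` B !=set0.

Definition superextension : set double_power :=
  [set L | linked L /\ forall M, linked M -> L `<=` M -> L = M].

End Superextension.

Arguments superextension X : clear implicits.

Section Twinic.
Variable X : groupType.
Implicit Types (I : set (set X)) (A B : set X).

Definition is_ideal I :=
  [/\ I !=set0, forall A B, I A -> I B -> I (A `|` B),
      forall A B, I A -> B `<=` A -> I B & ~ I setT].

Definition left_invariant I := forall A x, I A -> I (left_shift x A).

Definition subset_mod I A B := I (A `\` B).
Definition eq_mod I A B := subset_mod I A B /\ subset_mod I B A.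

Definition is_twinic_ideal I :=
  [/\ is_ideal I, left_invariant I &
      forall A x y, subset_mod I (left_shift x A) (~` A) ->
        subset_mod I (~` A) (left_shift y A) ->
        eq_mod I (left_shift x A) (left_shift y A)].

Definition is_twinic := exists I, is_twinic_ideal I.

Definition twinic_ideal : set (set X) := \bigcap_(I in is_twinic_ideal) I.

End Twinic.

Arguments twinic_ideal X : clear implicits.

Section Cogroups.
Variable X : groupType.
Implicit Types K : set X.

Definition is_2cogroup K :=
  K !=set0 /\ forall x, K x ->
    [/\ left_shift x K = right_shift K x, subgroup (left_shift x K) &
        left_shift x K `&` K = set0].

Definition maximal_2cogroups : set (set X) :=
  [set K | is_2cogroup K /\ forall K', is_2cogroup K' -> K `<=` K' -> K' = K].

Definition conjugate (x : X) K : set X := [set x * a * x^-1 | a in K].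

Definition cogroup_orbit K : set (set X) := [set conjugate x K | x in setT].

Definition stab K : set X := [set x | conjugate x K = K].

(* The quotient [Stab(K)/KK], as a set of cosets of [KK] in [power X]. *)
Definition characteristic_group K : set (power X) :=
  [set left_shift x ((K : power X) * (K : power X)) | x in stab K].

(* The orbits counted by the cardinal [q(X,G)]; this set itself serves as the
   exponent of the power [G^q(X,G)]. *)
Definition q_orbits {T : semigroupType} (G : set T) : set (set (set X)) :=
  [set cogroup_orbit K | K in
    [set K | maximal_2cogroups K /\ alg_isomorphic (characteristic_group K) G]].

End Cogroups.

Arguments maximal_2cogroups X : clear implicits.
Arguments q_orbits X {T} G.

(* [\prod_(k in I) (G k)^q(X, G k)], as a subset of a power of the discrete
   space of quaternions; each [G k] thus carries the discrete topology. *)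
Section PowerProduct.
Variables (R : realType) (X : groupType) (I : set exponent).
Variable G : exponent -> set (quat R).

Definition power_product_ambient : Type :=
  prod_topology (fun k : I =>
    prod_topology (fun _ : q_orbits X (G (\val k)) => discrete_topology (quat R))).

HB.instance Definition _ := PreTopologicalSemigroup.on power_product_ambient.

Definition power_product : set power_product_ambient :=
  [set f | forall k o, G (\val k) (f k o)].

End PowerProduct.

Arguments power_product {R} X I G.

(* Main.v *)
(* Call a set A a twin set if xA = X \ A modulo the twinic ideal I for some x;
   these x form a 2-cogroup.  Let a maximal left-invariant linked family F modulo
   I decide all sets which are not twin sets.  A maximal linked system of some
   minimal left ideal is then given by its values on twin sets, that is, by one
   element of T_K = {D : kD = X \ D for all k in K} for a representative K of
   each orbit of maximal 2-cogroups, and multiplying such systems shifts the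
   element of T_K by an element of Stab(K), its code, read off the other factor.
   As the characteristic group H(K) acts freely on T_K, the ideal is the product
   over all K of H(K) and of the orbit space of T_K; the latter carries the left
   zero multiplication and has the cardinality of a power of 2.  If H(K) is
   finite, T_K is even homeomorphic to the product of H(K) and a Cantor cube.  In
   H(K) all orders are powers of 2 and there is exactly one involution z.  The
   whole group, or else the centralizer of an element of order 4 generating a
   normal subgroup, has square roots unique up to z and thus embeds into the
   roots of unity of 2-power order; the centralizer having index at most 2, H(K)
   is some C_{2^k} or Q_{2^k}. *)
Require Import Defs.
From HB Require Import structures.
From mathcomp Require Import all_boot all_order all_algebra.
From mathcomp Require Import complex ring.
From mathcomp Require Import all_classical all_reals all_analysis unstable.

Set Implicit Arguments.
Unset Strict Implicit.
Unset Printing Implicit Defensive.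

Import GRing.Theory.
Local Open Scope classical_set_scope.
Local Open Scope group_scope.

(** * Primitive idempotents of a semigroup *)

(** A maximal linked system acts as an equivariant map on subsets of X, and the product of systems
    becomes composition of maps. Twinicity enters twice: a set that F leaves undecided satisfies xA
    in X \ A in yA modulo I, so it is a twin set; and nested twin sets are equal modulo I, which
    makes the prescribed systems monotone. The obstacle is that a system sees twin sets only modulo
    I, while the elements of T_K are genuine sets. Codes mediate between the two: any consistent
    choice of them gives the algebraic statements, but a code need not depend continuously on the
    element of T_K. If I contains no maximal 2-cogroup, elements of T_K equal modulo I coincide, and
    the codes can be aligned with a continuous equivariant map h from T_K to H(K); this gives (2).
    Inside a maximal subgroup the orbits are fixed, and there the position in the orbit is
    continuous for every choice of codes; this gives (4). For infinite H(K) the orbit space is a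
    power of 2 as a bare set, by cardinality. The coordinates on orbit spaces are chosen before the
    codes, so one m serves in (1) and (2). *)

Section Rees.
Context {T : semigroupType} (S : set T).
Hypothesis SM : forall x y, S x -> S y -> S (x * y).

Definition left_orbit (e : T) : set T := [set s * e | s in S].

Definition corner (e : T) : set T := [set x | [/\ S x, e * x = x & x * e = x]].

(** Primitivity is expressed by [e S e] being a group; this yields the minimality of [S e] and is
    what gets verified for the reference system. *)
Definition primitive_idempotent (e : T) :=
  [/\ S e, e * e = e &
      forall x, corner e x -> exists2 y, corner e y & x * y = e /\ y * x = e].

Lemma corner_id e : S e -> e * e = e -> corner e e.
Proof. by []. Qed.

Lemma left_orbitP e x : S e -> e * e = e ->
  left_orbit e x <-> S x /\ x * e = x.
Proof.
move=> Se ee; split=> [[s Ss <-]|[Sx xe]]; last by exists x.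
by split; [exact: SM|rewrite -mulgA ee].
Qed.

Lemma corner_eq_inv e x y y' : corner e x -> corner e y -> corner e y' ->
  y * x = e -> x * y' = e -> y = y'.
Proof.
move=> [_ _ _] [_ _ ye] [_ ey' _] yx xy'.
by rewrite -ye -xy' mulgA yx ey'.
Qed.

Lemma corner_subgroup e : primitive_idempotent e -> subgroup (corner e).
Proof.
move=> [Se ee inv]; split=> [x y [Sx ex xe] [Sy ey ye]|].
  by split; [exact: SM|rewrite mulgA ex|rewrite -mulgA ye].
exists e; first exact: corner_id.
by move=> x Cx; have [? ? ?] := Cx; split=> //; exact: inv.
Qed.

Lemma left_orbit_ideal e : S e -> left_ideal S (left_orbit e).
Proof.
move=> Se; split; first by exists (e * e), e.
  by move=> _ [s Ss <-]; exact: SM.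
by move=> s _ Ss [t St <-]; exists (s * t); [exact: SM|rewrite mulgA].
Qed.

(** An element [x] of a left ideal inside [S e] gives [e x] in the group [e S e]; multiplying by its
    inverse puts [e] into that ideal. *)
Lemma primitive_minimal_left e : primitive_idempotent e ->
  minimal_left_ideal S (left_orbit e).
Proof.
move=> [Se ee inv]; split; first exact: left_orbit_ideal.
move=> L [[x Lx] LS Lid] Le; apply/seteqP; split=> //.
have /(left_orbitP x Se ee) [Sx xe] := Le x Lx.
have Cex : corner e (e * x).
  by split; [exact: SM|rewrite mulgA ee|rewrite -mulgA xe].
have [y [Sy _ _] [_ yx]] := inv _ Cex.
move=> _ [s Ss <-]; rewrite -yx !mulgA; apply: Lid Lx.
by apply: (SM _ Se); exact: SM.
Qed.

Section FromPrimitive.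
Variable e : T.
Hypothesis Pe : primitive_idempotent e.

Let Se : S e. Proof. by have [] := Pe. Qed.
Let ee : e * e = e. Proof. by have [] := Pe. Qed.

Let inv (x : T) : T :=
  xget e [set y | corner e y /\ x * y = e /\ y * x = e].

Let invP x : corner e x -> [/\ corner e (inv x), x * inv x = e & inv x * x = e].
Proof.
move=> Cx; have [_ _ /(_ x Cx) [y Cy [xy yx]]] := Pe.
by have [] := @xgetPex _ e [set y | corner e y /\ x * y = e /\ y * x = e]
  (ex_intro _ y (conj Cy (conj xy yx))) => ? [].
Qed.

Lemma corner_sandwich x : S x -> corner e (e * x * e).
Proof.
move=> Sx; split; last by rewrite -!mulgA ee.
  by apply: (SM _ Se); exact: SM.
by rewrite !mulgA ee.
Qed.

(** A left ideal inside [S e t] pulls back along right multiplication by [t] to a left ideal inside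
    the minimal [S e]. *)
Lemma minimal_left_translate t : S t ->
  minimal_left_ideal S [set u * t | u in left_orbit e].
Proof.
move=> St; split.
  split; first by exists (e * t), e => //; exists e.
    by move=> _ [_ [s Ss <-] <-]; exact: (SM (SM Ss Se) St).
  move=> s _ Ss [_ [u Su <-] <-]; exists (s * (u * e)); last by rewrite !mulgA.
  by exists (s * u); [exact: SM|rewrite mulgA].
move=> L [[x Lx] LS Lid] Let_; apply/seteqP; split=> //.
have [_ /(_ [set u | left_orbit e u /\ L (u * t)]) min] := primitive_minimal_left Pe.
have <- : [set u | left_orbit e u /\ L (u * t)] = left_orbit e.
  apply: min; last by move=> u [].
  split; first by have [u eu ux] := Let_ x Lx; exists u; split=> //=; rewrite ux.
    by move=> _ [[s Ss <-] _]; exact: SM.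
  move=> s u Ss [[r Sr <-] Lu]; split; last by rewrite -mulgA; exact: Lid.
  by exists (s * r); [exact: SM|rewrite mulgA].
by move=> _ [u [_ Lu] <-].
Qed.

(** If [a] lies in [L] and [h] is the inverse of [e a e] in the group [e S e], then [h a] is an
    idempotent of [L] generating the same right ideal as [e]. So every minimal left ideal can be
    compared with [S e]. *)
Lemma minimal_left_ideal_idempotent L : minimal_left_ideal S L ->
  exists e', [/\ primitive_idempotent e', L = left_orbit e', e * e' = e' &
    e' * e = e].
Proof.
move=> [[[a La] LS Lid] minL]; have Sa := LS a La.
have Ceae := corner_sandwich Sa.
have [Ch aeh hea] := invP Ceae; set h := inv _ in Ch aeh hea.
have [Sh eh he] := Ch.
have e'e : h * a * e = e by move: hea; rewrite !mulgA he.
have ee' : e * (h * a) = h * a by rewrite mulgA eh.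
have e'e' : h * a * (h * a) = h * a by rewrite -{2}ee' mulgA e'e ee'.
have Se' : S (h * a) by exact: SM.
exists (h * a); split=> //.
  split=> // x [Sx e'x xe'].
  have ex : e * x = x by rewrite -e'x mulgA ee'.
  have Cxe : corner e (x * e).
    by split; [exact: SM|rewrite mulgA ex|rewrite -mulgA ee].
  have [[Sy ey ye] xy yx] := invP Cxe; set y := inv _ in Sy ey ye xy yx.
  have xy1 : x * y = e by rewrite -xy -mulgA ey.
  exists (y * (h * a)).
    split; [exact: SM|by rewrite mulgA -[_ * y]mulgA -ey !mulgA e'e ey|].
    by rewrite -mulgA e'e'.
  split; first by rewrite mulgA xy1.
  by rewrite -mulgA e'x -[RHS]ee' -yx -!mulgA ee' xe'.
by rewrite (minL _ (left_orbit_ideal Se')) // => _ [s Ss <-]; rewrite mulgA; exact: Lid (SM Ss Sh) La.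
Qed.

(* With [e R e'] related as below, [x = i (e x)] for the idempotent
   [i = x (e x)^-1]; the isomorphism exchanges [i] for the idempotent
   [i (e' i)^-1 e'] of [S e'] generating the same right ideal. *)
Lemma left_orbit_isomorphic e' : primitive_idempotent e' -> e * e' = e' ->
  e' * e = e -> alg_isomorphic (left_orbit e) (left_orbit e').
Proof.
move=> Pe' ee' e'e; have [Se' e'e' _] := Pe'.
have Ce x : left_orbit e x -> forall s, S s -> e * s = s -> corner e (s * x).
  move=> /(left_orbitP x Se ee) [Sx xe] s Ss es.
  by split; [exact: SM|rewrite mulgA es|rewrite -mulgA xe].
have invE x y : corner e x -> corner e y -> y * x = e -> inv x = y.
  by move=> Cx Cy yx; have [Ci xi ix] := invP Cx; rewrite (corner_eq_inv Cx Cy Ci yx xi).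
have Le x : left_orbit e x -> x * e = x by move=> /(left_orbitP x Se ee) [].
have Le' u : left_orbit e' u -> u * e' = u by move=> /(left_orbitP u Se' e'e') [].
have cP x : left_orbit e x ->
  exists c, [/\ inv (e' * x) = c, corner e c, e' * (x * c) = e & c * (e' * x) = e].
  move=> Lx; have [Cc xc cx] := invP (Ce x Lx e' Se' ee').
  by exists (inv (e' * x)); rewrite mulgA.
have gP x : left_orbit e x -> exists d, [/\ corner e d, e * (x * d) = e & d * (e * x) = e].
  move=> Lx; have [Cc xc cx] := invP (Ce x Lx e Se ee).
  by exists (inv (e * x)); rewrite mulgA.
(* Since [(e' x)^-1 = (e x)^-1 (e' i)^-1] in the group [e S e], the product [x (e' x)^-1] is
   [i (e' i)^-1]. *)
pose f x := x * inv (e' * x) * (e * x) * e'.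
have LS x : left_orbit e x -> S x by move=> /(left_orbitP x Se ee) [].
have fL x : left_orbit e x -> left_orbit e' (f x).
  move=> Lx; rewrite /f; have [c [-> [Sc _ _] _ _]] := cP x Lx.
  by exists (x * c * (e * x)) => //; exact: (SM (SM (LS x Lx) Sc) (SM Se (LS x Lx))).
have efx x : left_orbit e x -> e' * f x = e * x * e'.
  move=> Lx; rewrite /f; have [c [-> _ xc _]] := cP x Lx.
  by rewrite !mulgA -[e' * x * c]mulgA xc ee.
have fM x y : left_orbit e x -> left_orbit e y -> f (x * y) = f x * f y.
  move=> Lx Ly; have -> : f x * f y = x * inv (e' * x) * (e * x) * (e' * f y).
    by rewrite /f !mulgA.
  have Lxy : left_orbit e (x * y).
    by apply/left_orbitP => //; split; [exact: SM (LS x Lx) (LS y Ly)|rewrite -mulgA (Le y)].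
  rewrite (efx y Ly).
  have [c [ic Cc xc cx]] := cP x Lx; have [d [Cd yd dy]] := gP y Ly.
  have [[_ ec ce] [_ ed de]] := (Cc, Cd).
  have -> : f (x * y) = x * y * (d * c) * (e * (x * y)) * e'.
    rewrite /f (invE (e' * (x * y)) (d * c)) //; first exact: Ce.
      have [[Sc _ _] [Sd _ _]] := (Cc, Cd).
      by split; [exact: SM|rewrite mulgA ed|rewrite -mulgA ce].
    have -> : d * c * (e' * (x * y)) = d * (c * (e' * x) * y) by rewrite !mulgA.
    by rewrite cx dy.
  have -> : x * y * (d * c) = x * (e * (y * d)) * c by rewrite !mulgA (Le x).
  have -> : e * (x * y) = e * x * (e * y) by rewrite !mulgA -(mulgA e x e) (Le x).
  by rewrite yd (Le x) // ic !mulgA.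
have fI x y : left_orbit e x -> left_orbit e y -> f x = f y -> x = y.
  move=> Lx Ly fxy.
  have exy : e * x = e * y.
    have exye' : e * x * e' = e * y * e' by rewrite -!efx // fxy.
    have eE z : left_orbit e z -> e * z = e * z * e' * e.
      by move=> Lz; rewrite -mulgA e'e -mulgA Le.
    by rewrite (eE x Lx) exye' -eE.
  have [c [ic Cc xc cx]] := cP x Lx; have [c' [ic' Cc' yc' c'y]] := cP y Ly.
  have [d [Cd xd dx]] := gP x Lx.
  have [[_ ec ce] [_ ec' ce']] := (Cc, Cc').
  have [_ ed de] := Cd.
  (* Multiplying [f z] by [e (e z)^-1] recovers [z (e' z)^-1], which together with [e z] determines
     [z]. *)
  have fd z b : left_orbit e z -> e * z = e * x -> inv (e' * z) = b -> b * e = b ->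
      f z * e * d = z * b.
    move=> Lz ez iz be; rewrite /f iz ez.
    have -> : z * b * (e * x) * e' * e * d = z * b * (e * (x * (e' * e * d))).
      by rewrite !mulgA.
    by rewrite e'e ed xd -mulgA be.
  have xcyc : x * c = y * c' by rewrite -(fd x c) // fxy; exact: fd.
  have cc' : c = c'.
    have cE : c = d * (e * (x * c)) by rewrite !mulgA -[d * e * x]mulgA dx ec.
    have cE' : c' = d * (e * (y * c')).
      by rewrite (mulgA e) -exy !mulgA -[d * e * x]mulgA dx ec'.
    by rewrite cE xcyc -cE'.
  have e'xy : e' * x = e' * y.
    apply: (@corner_eq_inv e c) => //; try exact: Ce.
      by rewrite -mulgA.
    by rewrite cc'.
  have xE : x = x * c * (e' * x) by rewrite -mulgA cx Le.
  have yE : y = y * c' * (e' * y) by rewrite -mulgA c'y Le.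
  by rewrite xE xcyc e'xy -yE.
exists f; split; last by move=> x y; rewrite !inE; exact: fM.
split=> [x||u Lu]; [exact: fL|by move=> x y; rewrite !inE; exact: fI|].
have /(left_orbitP u Se' e'e') [Su ue'] := Lu.
have Ca : corner e (e * u * e) by exact: corner_sandwich.
have [[Sb eb be] ab ba] := invP Ca; set b := inv _ in Sb eb be ab ba.
have Cg : corner e (e' * u * e).
  split; [exact: SM (SM Se' Su) Se|by rewrite !mulgA ee'|by rewrite -mulgA ee].
have [[Sh eh he] gh hg] := invP Cg; set h := inv _ in Sh eh he gh hg.
have [g gE] : exists g, g = e' * u * e by eexists.
rewrite -gE in Cg gh hg; have [Sg eg ge] := Cg.
(* The construction read backwards: [u e b] is the idempotent of [S e] with the same right ideal as
   [u], and [g] becomes [e x]. *)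
pose x := u * e * b * g.
have Lx : left_orbit e x.
  by apply/left_orbitP => //; split; [exact: SM (SM (SM Su Se) Sb) Sg|rewrite -mulgA ge].
have ex : e * x = g by rewrite /x !mulgA ab eg.
exists x => //; rewrite /f ex (invE (e' * x) (h * (e * u * e) * h)) //.
- have -> : x * (h * (e * u * e) * h) * g * e'
      = u * e * (b * (g * h) * (e * u * e) * (h * g)) * e' by rewrite /x !mulgA.
  by rewrite gh hg be ba -(mulgA u) !ee -mulgA ee'.
- exact: Ce.
- split; [by do !apply: SM|by rewrite !mulgA eh|by rewrite -mulgA he].
have -> : e' * x = g * b * g by rewrite /x gE !mulgA.
have -> : h * (e * u * e) * h * (g * b * g) = h * (e * u * e) * (h * g) * b * g.
  by rewrite !mulgA.
by rewrite hg -(mulgA _ e b) eb -(mulgA h) ab he hg.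
Qed.

(** Left multiplication by [e] leads from [e1 S e1] into the group [e S e]; an inverse found there
    is brought back by [e1]. *)
Lemma primitive_left e1 : S e1 -> e * e1 = e -> e1 * e = e1 ->
  primitive_idempotent e1.
Proof.
move=> Se1 ee1 e1e; have e1e1 : e1 * e1 = e1 by rewrite -{1}e1e -mulgA ee1.
split=> // x [Sx e1x xe1].
have xe : x * e = x by rewrite -xe1 -mulgA e1e.
have Cex : corner e (e * x).
  by split; [exact: SM|rewrite mulgA ee|rewrite -mulgA xe].
have [[Sy ey ye] xy yx] := invP Cex; set y := inv _ in Sy ey ye xy yx.
exists (e1 * y).
  by split; [exact: SM|rewrite mulgA e1e1|rewrite -mulgA -{1}ye -mulgA ee1 ye].
split; last by rewrite -mulgA -ye -mulgA yx.
by rewrite mulgA xe1 -{1}e1x -{1}e1e -!mulgA [e * _]mulgA xy.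
Qed.

Lemma primitive_right c : S c -> c * e = e -> e * c = c -> primitive_idempotent c.
Proof.
move=> Sc ce ec; have cc : c * c = c by rewrite -{2}ec mulgA ce ec.
split=> // x [Sx cx xc].
have ex : e * x = x by rewrite -cx mulgA ec.
have Cxe : corner e (x * e).
  by split; [exact: SM|rewrite mulgA ex|rewrite -mulgA ee].
have [[Sy ey ye] xy yx] := invP Cxe; set y := inv _ in Sy ey ye xy yx.
exists (y * c).
  by split; [exact: SM|rewrite mulgA -ey mulgA ce|rewrite -mulgA cc].
split; first by rewrite mulgA -ey !mulgA xy.
by rewrite -mulgA cx -xc -ec !mulgA -[y * x * e]mulgA yx.
Qed.

End FromPrimitive.

(* [e1 = c e (e c e)^-1] generates the same right ideal as [c]. *)
Lemma maximal_subgroup_corner e G : primitive_idempotent e -> maximal_subgroup S G ->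
  exists c e1, [/\ S c /\ c * c = c, G = corner c,
    left_orbit e e1 /\ primitive_idempotent e1, c * e1 = e1 & e1 * c = c].
Proof.
move=> Pe; have [Se ee inv] := Pe; move=> [c [mc cc [[Gg GS Gc] maxG]]].
have Sc := GS c Gc.
(* [S e S] is a two-sided ideal, so it contains the minimal one. *)
have [s [t [Ss St cst]]] : exists s t, [/\ S s, S t & c = s * e * t].
  pose I : set T := [set x | exists s t, [/\ S s, S t & x = s * e * t]].
  apply: (mc I); split=> [|x []]; split.
  - by exists (e * e * e), e, e.
  - by move=> _ [s [t [Ss St ->]]]; exact: SM (SM Ss Se) St.
  - move=> s _ Ss [a [b [Sa Sb ->]]]; split.
      by exists (s * a), b; split=> //; [exact: SM|rewrite !mulgA].
    by exists a, (b * s); split=> //; [exact: SM|rewrite !mulgA].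
(* [S c] is a left ideal inside the minimal left ideal [S e t], hence equal to it. *)
have minc : minimal_left_ideal S (left_orbit c).
  have mt := minimal_left_translate Pe St; have [_ mint] := mt.
  rewrite (mint _ (left_orbit_ideal Sc)) // => _ [r Sr <-].
  exists (r * (s * e)); last by rewrite cst !mulgA.
  by exists (r * s); [exact: SM|rewrite mulgA].
have Cece := corner_sandwich Pe Sc.
have [d [Sd ed de] [xd dx]] := inv _ Cece.
have [e1 e1E] : exists e1, e1 = c * e * d by eexists.
have Se1 : S e1 by rewrite e1E; exact: SM (SM Sc Se) Sd.
have e1e : e1 * e = e1 by rewrite e1E -mulgA de.
have ee1 : e * e1 = e by rewrite e1E !mulgA xd.
have P1 := primitive_left Pe Se1 ee1 e1e; have [_ e1e1 _] := P1.
have ce1 : c * e1 = e1 by rewrite e1E !mulgA cc.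
have e1c : e1 * c = c.
  have : left_orbit c c by exists c.
  have [_ mc'] := minc.
  rewrite -(mc' _ (left_orbit_ideal (SM Se1 Sc))) => [[r Sr rc]|_ [r Sr <-]]; last first.
    by exists (r * e1); [exact: SM|rewrite mulgA].
  have cE : c * (e1 * c) = c.
    by rewrite -{1}rc -!mulgA (mulgA c e1 c) ce1 (mulgA e1 e1) e1e1 rc.
  by rewrite -[RHS]cE mulgA ce1.
have Pc := primitive_right P1 Sc ce1 e1c.
exists c, e1; split=> //; last by split=> //; apply/left_orbitP.
apply/seteqP; split=> [x Gx|]; last first.
  by apply: maxG; [exact: corner_subgroup|move=> x []|exact: corner_id].
have [Gmul [u Gu uP]] := Gg.
have [_ cu [y Gy [cy yc]]] := uP c Gc.
have -> : c = u by rewrite -cu -cy mulgA cc.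
by have [ux xu _] := uP x Gx; split=> //; exact: GS.
Qed.

End Rees.

(** * 2-groups with a unique involution *)

Lemma conjgg (G : groupType) (x : G) : x ^ x = x.
Proof. by rewrite conjgE mulKg. Qed.

Section UniqueInvolution.
Context {G : groupType} (z : G).
Hypothesis z1 : z != 1.
Hypothesis zz : z * z = 1.
Hypothesis invol : forall x : G, x * x = 1 -> x = 1 \/ x = z.
Hypothesis tors : forall x : G, exists n, x ^+ (2 ^ n) = 1.

Lemma involution_central x : x * z = z * x.
Proof.
have : (z ^ x) * (z ^ x) = 1 by rewrite -conjMg zz conj1g.
case/invol => /eqP; first by rewrite conjg_eq1 (negPf z1).
by move=> /eqP zx; rewrite [RHS]conjgC zx.
Qed.
Let zC := involution_central.

Lemma invg_involution : z^-1 = z.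
Proof. exact: mulg1_eq. Qed.

Definition order4 (x : G) := x * x = z.

Lemma order4_neq1 x : order4 x -> x <> 1.
Proof. by move=> x4 x1; move/eqP: z1; apply; rewrite -x4 x1 mulg1. Qed.

Lemma order4_neqz x : order4 x -> x <> z.
Proof. by move=> x4 xz; move/eqP: z1; apply; rewrite -x4 xz. Qed.

Lemma order4V x : order4 x -> x^-1 = x * z.
Proof.
move=> x4; apply: mulg1_eq; rewrite mulgA x4; exact: zz.
Qed.

Lemma order4_invg x : order4 x -> order4 x^-1.
Proof. by move=> x4; rewrite /order4 -invgM x4 invg_involution. Qed.

Lemma order4J x g : order4 x -> order4 (x ^ g).
Proof. by move=> x4; rewrite /order4 -conjMg x4 conjgE -zC mulKg. Qed.

Lemma order4_neqV x : order4 x -> x <> x^-1.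
Proof.
move=> x4 xV; move/eqP: z1; apply; rewrite -x4 {2}xV; exact: mulgV.
Qed.

Lemma power_order4 w : w <> 1 -> w <> z -> exists k, order4 (w ^+ k).
Proof.
move=> w1 wz.
have ex : exists n, w ^+ (2 ^ n) == 1 by have [n /eqP] := tors w; exists n.
case: (ex_minnP ex) => -[|[|n]] /eqP wn min.
- by case: w1; rewrite -wn expn0 expg1.
- by case: (@invol w) => //; rewrite -expg2 -wn expn1.
exists (2 ^ n)%N; rewrite /order4 -expgnDr addnn -mul2n -expnS.
case: (@invol (w ^+ (2 ^ n.+1))) => //.
  by rewrite -expgnDr addnn -mul2n -expnS.
by move/eqP/min; rewrite ltnn.
Qed.

Lemma commuting_order4 a b : order4 a -> order4 b -> commute a b ->
  b = a \/ b = a^-1.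
Proof.
move=> a4 b4 ab.
have : (a * b) * (a * b) = 1.
  by rewrite mulgA -[a * b * a]mulgA -ab mulgA a4 -mulgA b4 zz.
case/invol => [|ab1]; first by move/mulg1_eq ->; right.
by left; apply: (mulgI a); rewrite ab1 a4.
Qed.

(** Equality of the squares says that [x] inverts [w = x^-1 y]. Unless [w] is 1 or [z], some power
    of [w] has order 4; it is inverted by [x] and commutes with [x], although it differs from its
    inverse. *)
Lemma sqr_eq x y : x * x = y * y ->
  (forall k, order4 ((x^-1 * y) ^+ k) -> commute x ((x^-1 * y) ^+ k)) ->
  y = x \/ y = x * z.
Proof.
move=> xy wC; set w := x^-1 * y in wC.
have wx : w ^ x = w^-1.
  rewrite /w conjgE invgM invgK; apply: (mulgI y); apply: (mulgI y).
  have yyx t : y * (y * t) = x * (x * t) by rewrite !mulgA xy.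
  by rewrite yyx -[x^-1 * y * x]mulgA !mulVKg.
have yw : y = x * w by rewrite mulVKg.
have [w1|/eqP w1] := eqVneq w 1; first by left; rewrite yw w1 mulg1.
have [wz|/eqP wz] := eqVneq w z; first by right; rewrite yw wz.
have [k k4] := power_order4 w1 wz.
case: (order4_neqV k4); rewrite -{1}(mulKg x (w ^+ k)) (wC k k4) -conjgE.
by rewrite conjXg wx expVgn.
Qed.

(** Modulo [z] both elements are involutions and generate a dihedral group; its rotation [a b] is
    inverted by both, and so is a power of it of order 4. *)
Lemma common_inverted a b : order4 a -> order4 b -> b <> a -> b <> a^-1 ->
  exists w, [/\ order4 w, w ^ a = w^-1 & w ^ b = w^-1].
Proof.
move=> a4 b4 ba baV.
have ua : (a * b) ^ a = (a * b)^-1.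
  by rewrite conjgE !mulgA mulVg mul1g invgM (order4V a4) (order4V b4) -mulgA
    [z * _]mulgA -zC -!mulgA zz mulg1.
have ub : (a * b) ^ b = (a * b)^-1.
  by rewrite conjgE -mulgA b4 invgM (order4V a4).
have u1 : a * b <> 1 by move/mulg1_eq/esym.
have uz : a * b <> z by rewrite -a4 => /mulgI.
have [k k4] := power_order4 u1 uz.
by exists ((a * b) ^+ k); rewrite !conjXg ua ub !expVgn.
Qed.

Lemma invertedC a w : order4 a -> order4 w -> w ^ a = w^-1 -> a ^ w = a^-1.
Proof.
move=> a4 w4; rewrite conjgE => wa.
have aw : a * w = w^-1 * a.
  apply: (mulgI w); rewrite mulVKg mulgA -[w * a](mulVKg a) -mulgA wa.
  by rewrite mulVg mulg1.
by rewrite conjgE aw mulgA (order4_invg w4) -zC order4V.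
Qed.

(** Equality in the quotient by the central subgroup generated by [z], where order 4 elements become
    involutions. *)
Definition upto_z x y := y = x \/ y = x * z.

Lemma upto_z_sym x y : upto_z x y -> upto_z y x.
Proof. by case=> ->; [left|right; rewrite -mulgA zz mulg1]. Qed.

Lemma upto_z_trans x y t : upto_z x y -> upto_z y t -> upto_z x t.
Proof.
move=> [->|->] [->|->]; [by left|by right|by right|].
by left; rewrite -mulgA zz mulg1.
Qed.

Lemma upto_zJ x y g : upto_z x y -> upto_z (x ^ g) (y ^ g).
Proof.
case=> ->; first by left.
by right; rewrite conjMg [z ^ g]conjgE -zC mulKg.
Qed.

Lemma upto_zM x y x' y' : upto_z x y -> upto_z x' y' -> upto_z (x * x') (y * y').
Proof.
case=> -> [] ->; [by left|by right; rewrite mulgA|right|left].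
  by rewrite -mulgA -zC mulgA.
by rewrite -mulgA [z * _]mulgA -zC -!mulgA zz mulg1.
Qed.

Lemma upto_z_order4 x y : order4 x -> upto_z x y -> order4 y.
Proof.
move=> x4 [->//|->]; rewrite /order4 -mulgA [z * _]mulgA -zC.
by rewrite -[x * z * z]mulgA zz mulg1.
Qed.

Lemma upto_zV x y : order4 x -> y = x^-1 -> upto_z x y.
Proof. by move=> x4 ->; right; exact: order4V. Qed.

Lemma upto_zP x y : order4 x -> upto_z x y -> y = x \/ y = x^-1.
Proof. by move=> x4; rewrite (order4V x4). Qed.

Lemma upto_z1 x : upto_z 1 x <-> x = 1 \/ x = z.
Proof. by rewrite /upto_z mul1g. Qed.

(** For [a] of order 4 this says that the cyclic group of [a] lies in a cyclic group of order 8. *)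
Definition big a := exists g, upto_z a (g * g).

Lemma big_upto_z a b : upto_z a b -> big a -> big b.
Proof.
by move=> ab [g ga]; exists g; apply: upto_z_trans ga; exact: upto_z_sym.
Qed.

Lemma bigJ a g : big a -> big (a ^ g).
Proof. by move=> [h ha]; exists (h ^ g); rewrite -conjMg; exact: upto_zJ. Qed.

(** The square of [x] commutes with [a]. Were it neither 1 nor [z], a power of it would have order 4
    and so be [a] or [a^-1], which [x] does not centralize; were it 1, [x] would be central. *)
Lemma inverting_order4 a x : order4 a -> a ^ x = a^-1 -> order4 x.
Proof.
move=> a4 ax; have aV := order4_neqV a4.
have [xx1|/eqP xx1] := eqVneq (x * x) 1.
  by case: (invol xx1) ax => ->; rewrite ?conjg1 ?conjgE ?zC ?mulKg => /aV.
have [//|/eqP xxz] := eqVneq (x * x) z.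
have [k k4] := power_order4 xx1 xxz; exfalso.
have axx : a ^ (x * x) = a by rewrite conjgM ax conjVg ax invgK.
have axk : commute a ((x * x) ^+ k).
  by apply: commuteX; rewrite /commute conjgC axx.
have cx : commute x ((x * x) ^+ k) by apply: commuteX; rewrite /commute mulgA.
apply: aV; rewrite -ax conjgE.
case: (commuting_order4 a4 k4 axk) => e; move: cx; rewrite e /commute => cx.
  by rewrite -cx mulKg.
by have := commuteV cx; rewrite invgK /commute => <-; rewrite mulKg.
Qed.

(** As [g] commutes with [a], also [b g] inverts [a] and has order 4. Comparing [(b g)^2] with [b^2]
    gives [g b g = b], that is, [b ^ g = g^-2 b]. *)
Lemma big_moves a g b : order4 a -> order4 b -> upto_z a (g * g) -> b ^ a = b^-1 ->
  upto_z a (a ^ g) /\ upto_z (a * b) (b ^ g).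
Proof.
move=> a4 b4 gga ba; have ab := invertedC a4 b4 ba.
have ag : a ^ g = a.
  have gg : commute g (g * g) by rewrite /commute mulgA.
  case: gga => e; move: gg; rewrite e /commute conjgE => gg.
    by rewrite -gg mulKg.
  by apply: (mulIg z); rewrite -mulgA -[a * g * z]mulgA (zC g) (mulgA a) -gg mulKg.
split; first by left.
have bg4 : order4 (b * g).
  by apply: (inverting_order4 a4); rewrite conjgM ab conjVg ag.
have -> : b ^ g = (g * g)^-1 * b.
  rewrite conjgE invgM -mulgA; congr (_ * _); apply: (mulgI g); rewrite mulVKg.
  by apply: (mulgI b); rewrite b4 -[RHS]bg4 !mulgA.
apply: upto_zM; last by left.
apply: (upto_z_trans gga); apply: upto_zV => //; exact: upto_z_order4 gga.
Qed.

(** [x^3] fixes the class of [a]; the order of [x] being a power of 2, [x] is itself a power of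
    [x^3]. *)
Lemma three_cycle x a b c : upto_z (a ^ x) b -> upto_z (b ^ x) c ->
  upto_z (c ^ x) a -> upto_z a b.
Proof.
move=> ab bc ca.
pose N g := upto_z a (a ^ g).
have NM g h : N g -> N h -> N (g * h).
  by move=> /(upto_zJ h) Ng Nh; rewrite /N conjgM; exact: upto_z_trans Nh Ng.
have NX g n : N g -> N (g ^+ n).
  move=> Ng; elim: n => [|n IHn]; first by left; rewrite expg0 conjg1.
  by rewrite expgS; exact: NM.
have N3 : N (x ^+ 3).
  rewrite /N !expgS expg0 mulg1 !conjgM; apply: upto_z_sym.
  by apply: upto_z_trans ca; apply: upto_zJ; apply: upto_z_trans bc; exact: upto_zJ.
have [n xn] := tors x.
have co : coprime 3 (2 ^ n) by rewrite coprimeXr.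
have [[|u] v uv _] := @egcdnP 3 (2 ^ n) isT.
  by move: uv; rewrite (eqP co) addn1.
have Nx : N x.
  suff -> : x = (x ^+ 3) ^+ u.+1 by exact: NX.
  by rewrite -expgnA mulnC uv (eqP co) addn1 expgS mulnC expgnA xn expg1n mulg1.
exact: upto_z_trans Nx ab.
Qed.

Lemma inverted_upto_zC a b : order4 b -> b ^ a = b^-1 -> upto_z (b * a) (a * b).
Proof.
move=> b4 ba; rewrite [b * a]conjgC ba.
by apply: upto_zM; [left|rewrite order4V //; right; rewrite -mulgA zz mulg1].
Qed.

(** If [g^2] and [h^2] were [a] and [b] up to [z], conjugation by [g h] would permute the classes of
    [a], [a b], [b] in a 3-cycle, which no element of 2-power order can do. *)
Lemma inverted_not_big a b : order4 a -> order4 b -> b ^ a = b^-1 ->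
  big a -> ~ big b.
Proof.
move=> a4 b4 ba [g ga] [h hb].
have ab := invertedC a4 b4 ba.
have [aga abg] := big_moves a4 b4 ga ba.
have [bhb bah] := big_moves b4 a4 hb ab.
have baz := inverted_upto_zC b4 ba.
have abaz : upto_z (a * b * a) b.
  apply: (@upto_z_trans _ (a * (a * b))).
    by rewrite -mulgA; apply: upto_zM => //; left.
  by rewrite mulgA a4; right; rewrite zC mulgA zz mul1g.
have babz : upto_z (b * a * b) a.
  apply: (@upto_z_trans _ (a * b * b)); first by apply: upto_zM => //; left.
  by rewrite -mulgA b4; right; rewrite -mulgA zz mulg1.
have ax : upto_z (a ^ (g * h)) (a * b).
  apply: (upto_z_trans _ baz); rewrite conjgM; apply: upto_z_sym.
  exact: upto_z_trans bah (upto_zJ h aga).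
have bx : upto_z (b ^ (g * h)) a.
  rewrite conjgM; apply: upto_z_trans babz; apply: upto_z_sym.
  apply: (upto_z_trans (y := (a * b) ^ h)); last exact: upto_zJ.
  by rewrite conjMg; apply: upto_zM.
have abx : upto_z ((a * b) ^ (g * h)) b.
  by apply: upto_z_trans abaz; rewrite conjMg; exact: upto_zM.
case: (three_cycle ax abx bx) => [|/mulgI/(order4_neqz b4)//].
by rewrite -[RHS]mulg1 => /mulgI/(order4_neq1 b4).
Qed.

(** If [x] is outside the cyclic group of [b], an order 4 power of [x^2] commutes with [b] and so
    equals [b] up to [z], exhibiting [b] as a square up to [z]. *)
Lemma centralizer_order4 b x : order4 b -> b ^ x = b -> big b \/
  (upto_z 1 x \/ upto_z b x).
Proof.
move=> b4 bx; have bxC : commute b x by rewrite /commute conjgC bx.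
have [->|/eqP x1] := eqVneq x 1; first by right; left; left.
have [->|/eqP xz] := eqVneq x z; first by right; left; apply/upto_z1; right.
have [xx1|/eqP xx1] := eqVneq (x * x) 1; first by case: (invol xx1).
have [x4|/eqP xxz] := eqVneq (x * x) z.
  by right; right; case: (commuting_order4 b4 x4 bxC) => ->; [left|exact: upto_zV].
have [k k4] := power_order4 xx1 xxz; left; exists (x ^+ k).
have xxk : (x * x) ^+ k = x ^+ k * x ^+ k by rewrite expgMn.
rewrite -xxk.
case: (commuting_order4 b4 k4); first by apply: commuteX; exact: commuteM.
  by move=> ->; left.
by move=> ->; exact: upto_zV.
Qed.

(** With [b] not [big], its centralizer is the cyclic group of [b]; since [a] inverts [b], the
    normalizer of that group is the quaternion group of order 8, with four classes modulo [z]. *)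
Lemma normalizer_order4 a b x : order4 a -> order4 b -> b ^ a = b^-1 -> ~ big b ->
  upto_z b (b ^ x) ->
  [\/ upto_z 1 x, upto_z a x, upto_z b x | upto_z (a * b) x].
Proof.
move=> a4 b4 ba nb /(upto_zP b4) [bx|bx].
  case: (centralizer_order4 b4 bx) => [//|[]]; by [constructor 1|constructor 3].
have bxa : b ^ (x * a^-1) = b.
  by rewrite conjgM bx -ba conjgK.
have xE : x = x * a^-1 * a by rewrite mulgVK.
case: (centralizer_order4 b4 bxa) => [//|[]] xa; rewrite xE.
  constructor 2; rewrite -{1}[a]mul1g; apply: upto_zM => //; by left.
constructor 4; apply: (upto_z_trans (upto_z_sym (inverted_upto_zC b4 ba))).
by apply: upto_zM => //; left.
Qed.

Lemma order4_upto_z1 x : order4 x -> ~ upto_z 1 x.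
Proof. by move=> x4 /upto_z1 [/(order4_neq1 x4)|/(order4_neqz x4)]. Qed.

Lemma inverted_neq_upto_z a b : order4 a -> b ^ a = b^-1 -> order4 b -> ~ upto_z a b.
Proof.
move=> a4 ba b4 /(upto_zP a4) [] e; apply: (order4_neqV b4); rewrite -ba e.
  by rewrite conjgE mulKg.
by rewrite conjVg conjgE mulKg.
Qed.

Lemma order4_mul a b : order4 a -> order4 b -> b ^ a = b^-1 -> order4 (a * b).
Proof.
move=> a4 b4 ba; have ab := invertedC a4 b4 ba.
apply: (inverting_order4 b4); rewrite conjgM ba.
by rewrite conjVg conjgE mulKg.
Qed.

(** The conclusion says that the cyclic group of [a] is normal. Three cases: there is only one
    cyclic subgroup of order 4; a [big] element inverts another order 4 element; or there is no such
    [big] element, and the group is quaternion of order 8. *)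
Lemma normal_order4 : (exists a, order4 a) ->
  exists2 a, order4 a & forall g, upto_z a (a ^ g).
Proof.
move=> [a0 a04].
have [[a [a4 ua]]|nu] := pselect (exists a, order4 a /\ forall t, order4 t -> upto_z a t).
  by exists a => // g; apply: ua; exact: order4J.
have common s t : order4 s -> order4 t -> ~ upto_z s t ->
    exists w, [/\ order4 w, w ^ s = w^-1 & w ^ t = w^-1].
  move=> s4 t4 st; apply: common_inverted => // ts; apply: st.
    by left.
  exact: upto_zV.
have [a [b [a4 b4 ba]]] : exists a b, [/\ order4 a, order4 b & b ^ a = b^-1].
  have [t [t4 ut]] : exists t, order4 t /\ ~ upto_z a0 t.
    apply: contrapT => h; apply: nu; exists a0; split=> // t t4.
    by apply: contrapT => ut; apply: h; exists t.
  by have [w [w4 wa _]] := common _ _ a04 t4 ut; exists a0, w.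
(* Let [t] be a conjugate of [a'] outside its class. Some [w] is inverted by [b'] and [t], hence
   normalizes the cyclic group of [b']. This leaves only [w = a' b'] up to [z], and then [t] in the
   normalizer of [w] leads to [t = b'], which is not [big]. *)
have [[a' [b' [a'4 b'4 b'a' a'big]]]|nbig] := pselect
    (exists a b, [/\ order4 a, order4 b, b ^ a = b^-1 & big a]).
  exists a' => // g; apply: contrapT => at_.
  have t4 := order4J g a'4; have tbig := bigJ g a'big.
  have nb := inverted_not_big a'4 b'4 b'a' a'big.
  have bt : ~ upto_z b' (a' ^ g).
    by move=> /upto_z_sym bt; apply: nb; exact: big_upto_z bt tbig.
  have [w [w4 wb wt]] := common _ _ b'4 t4 bt.
  have tw := invertedC t4 w4 wt.
  have bw : upto_z b' (b' ^ w) by apply: upto_zV => //; exact: invertedC.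
  have wnt := inverted_neq_upto_z w4 tw t4.
  case: (normalizer_order4 a'4 b'4 b'a' nb bw) => [|aw||cw].
  - exact: order4_upto_z1.
  - by have := inverted_not_big w4 t4 tw (big_upto_z aw a'big); exact.
  - exact: inverted_neq_upto_z.
  have wa : w ^ a' = w^-1.
    have ca : (a' * b') ^ a' = (a' * b')^-1.
      have ab := invertedC a'4 b'4 b'a'; have c4 := order4_mul a'4 b'4 b'a'.
      by apply: invertedC => //; rewrite conjgM conjgg.
    case: (upto_zP (order4_mul a'4 b'4 b'a') cw) => -> //.
    by rewrite conjVg ca.
  have nw := inverted_not_big a'4 w4 wa a'big.
  have wwt : upto_z w (w ^ (a' ^ g)) by exact: upto_zV.
  case: (normalizer_order4 a'4 w4 wa nw wwt) => // [|awt].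
    exact: order4_upto_z1.
  apply: bt; apply: upto_z_trans awt.
  apply: (@upto_z_trans _ (a' * (a' * b'))); last by apply: upto_zM => //; left.
  by rewrite mulgA a'4 -zC; right.
have noB s t : order4 s -> order4 t -> t ^ s = t^-1 -> ~ big t.
  by move=> s4 t4 ts tb; apply: nbig; exists t, s; split=> //; exact: invertedC.
have ab := invertedC a4 b4 ba; have c4 := order4_mul a4 b4 ba.
have baC := inverted_upto_zC b4 ba.
have NaP x : upto_z a (a ^ x) ->
    [\/ upto_z 1 x, upto_z b x, upto_z a x | upto_z (a * b) x].
  case/(normalizer_order4 b4 a4 ab (noB _ _ b4 a4 ab)); try by constructor.
  by move=> bax; constructor 4; apply: upto_z_trans bax; exact: upto_z_sym.
have aab : upto_z b (a * (a * b)) by rewrite mulgA a4 -zC; right.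
(* Some [w] is inverted by [a] and by [t]. It normalizes the cyclic group of [a], so it is [b] or
   [a b] up to [z], and [t] normalizes that of [w]; both normalizers are the same quaternion
   group. *)
have ord4V t : order4 t -> [\/ upto_z a t, upto_z b t | upto_z (a * b) t].
  move=> t4; have [|nat_] := pselect (upto_z a t); first by constructor.
  have [w [w4 wa wt]] := common _ _ a4 t4 nat_.
  have aw : upto_z a (a ^ w) by apply: upto_zV => //; exact: invertedC.
  have tw : upto_z w (w ^ t) by exact: upto_zV.
  have := normalizer_order4 a4 w4 wa (noB _ _ a4 w4 wa) tw.
  case: (NaP w aw) => [/(order4_upto_z1 w4)//|bw|/(inverted_neq_upto_z a4 wa w4)//|cw].
    case=> [/(order4_upto_z1 t4)//|/nat_//|wt'|awt].
      by constructor 2; exact: upto_z_trans wt'.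
    constructor 3; apply: upto_z_trans awt; apply: upto_zM => //; by left.
  case=> [/(order4_upto_z1 t4)//|/nat_//|wt'|awt].
    by constructor 3; exact: upto_z_trans wt'.
  constructor 2; apply: (upto_z_trans aab); apply: upto_z_trans awt.
  by apply: upto_zM => //; left.
pose P x := upto_z a (a ^ x).
have PM x y : P x -> P y -> P (x * y).
  by move=> /(upto_zJ y) Px Py; rewrite /P conjgM; exact: upto_z_trans Py Px.
have Pz x y : upto_z x y -> P x -> P y.
  case=> -> // Px; apply: PM => //; left.
  by rewrite conjgE zC mulKg.
have P1 : P 1 by left; rewrite conjg1.
have Pa : P a by left; rewrite conjgE mulKg.
have Pb : P b by exact: upto_zV.
exists a => // x; have [->//|/eqP x1] := eqVneq x 1.
have [xz|/eqP xz] := eqVneq x z; first by apply: (Pz 1) => //; apply/upto_z1; right.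
(* [x] commutes with its power of order 4, hence normalizes one of the three cyclic groups and lies
   in the quaternion group of [a] and [b]. *)
have [k k4] := power_order4 x1 xz.
have kx : (x ^+ k) ^ x = x ^+ k.
  by apply/conjg_fixP/commgP/commute_sym; apply: commuteX; exact: commute_refl.
have xv v : upto_z v (x ^+ k) -> upto_z v (v ^ x).
  move=> vk; apply: (upto_z_trans vk); apply: upto_z_sym; rewrite -kx.
  exact: upto_zJ.
case: (ord4V _ k4) => /xv.
- case/NaP => /Pz; apply=> //; exact: PM.
- case/(normalizer_order4 a4 b4 ba (noB _ _ a4 b4 ba)) => /Pz; apply=> //; exact: PM.
have ca : (a * b) ^ a = (a * b)^-1.
  by apply: invertedC => //; rewrite conjgM conjgg.
case/(normalizer_order4 a4 c4 ca (noB _ _ a4 c4 ca)) => /Pz; apply=> //.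
  exact: PM.
by apply: (PM) => //; exact: PM.
Qed.

(** Both [x] and [x g] invert [a], so they have order 4; equating their squares gives
    [g x g = x]. *)
Lemma inverting_centralizer a x g : order4 a -> a ^ x = a^-1 -> a ^ g = a ->
  g ^ x = g^-1.
Proof.
move=> a4 ax ag; have x4 := inverting_order4 a4 ax.
have xg4 : order4 (x * g).
  by apply: (inverting_order4 a4); rewrite conjgM ax conjVg ag.
have gxg : g * x * g = x by apply: (mulgI x); rewrite x4 -[RHS]xg4 !mulgA.
by rewrite conjgE; apply: (mulIg g); rewrite -mulgA gxg !mulVg.
Qed.

(** Inside the centralizer of [a] every order 4 power of [x^-1 y] is [a] or its inverse, so it
    commutes with [x], as [sqr_eq] requires. *)
Lemma sqr_eq_centralizer a x y : order4 a -> a ^ x = a -> a ^ y = a ->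
  x * x = y * y -> y = x \/ y = x * z.
Proof.
move=> a4 ax ay xy; apply: sqr_eq => // k k4.
have ca g : a ^ g = a -> commute a g by move=> ag; rewrite /commute conjgC ag.
have cak : commute a ((x^-1 * y) ^+ k).
  by apply: commuteX; apply: commuteM; [apply: commuteV|]; exact: ca.
case: (commuting_order4 a4 k4 cak) => ->; last apply: commuteV.
  by apply: commute_sym; exact: ca.
by apply: commute_sym; exact: ca.
Qed.

End UniqueInvolution.

Lemma expg_eq1_dvd (G : groupType) (z a : G) n k : z != 1 -> z * z = 1 ->
  a ^+ (2 ^ n) = z -> (a ^+ k == 1) = (2 ^ n.+1 %| k)%N.
Proof.
move=> z1 zz an; apply/eqP/idP => [|/dvdnP[q ->]]; last first.
  by rewrite mulnC expgnA expnSr expgnA an expg2 zz expg1n.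
elim: n a k an => [|n IHn] a k.
  rewrite expn0 expg1 => -> zk.
  rewrite expn1 dvdn2; apply/negP => ok; move/eqP: z1; apply; rewrite -zk.
  rewrite -[k]odd_double_half ok -muln2 mulnC expgnDr expgnA expg2 zz.
  by rewrite expg1n mulg1 expg1.
rewrite expnS expgnA => an ak.
have ke : ~~ odd k.
  apply/negP => ok; move/eqP: z1; apply.
  have zk : z ^+ k = 1 by rewrite -an -!expgnA mulnC expgnA ak expg1n.
  rewrite -zk -[k]odd_double_half ok -muln2 mulnC expgnDr expgnA expg2 zz.
  by rewrite expg1n mulg1 expg1.
rewrite -[k]odd_double_half (negPf ke) add0n -mul2n in ak *.
rewrite expnS dvdn_pmul2l //; apply: (IHn _ _ an).
by rewrite -expgnA.
Qed.

Lemma eq_expg_mod (G : groupType) (z a : G) n k l : z != 1 -> z * z = 1 ->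
  a ^+ (2 ^ n) = z -> (a ^+ k == a ^+ l) = (k == l %[mod 2 ^ n.+1])%N.
Proof.
move=> z1 zz an; wlog kl : k l / (l <= k)%N => [th|].
  have [/th//|/ltnW/th] := leqP l k.
  by rewrite eq_sym => ->; rewrite eq_sym.
rewrite eqn_mod_dvd // -(expg_eq1_dvd _ z1 zz an) expgnFr //.
by rewrite divg_eq mul1g.
Qed.

(** * Roots of unity of 2-power order *)

Section Roots.
Variable R : realType.
Implicit Type u : R[i].

Lemma primitive_root_pow2 u n : (u ^+ (2 ^ n) = -1)%R ->
  ((2 ^ n.+1).-primitive_root u)%R.
Proof.
move=> un; have u2n : (u ^+ (2 ^ n.+1) = 1)%R.
  by rewrite expnSr GRing.exprM un sqrrN expr1n.
have [m mu] := prim_order_exists (expn_gt0 2 n.+1) u2n.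
case/(@dvdn_pfactor 2 m n.+1 isT) => j; rewrite leq_eqVlt => /orP[/eqP <- <- //|jn mE].
have : (u ^+ (2 ^ n) == 1)%R by rewrite -(prim_order_dvd mu) mE dvdn_exp2l.
rewrite un -subr_eq0 -opprD oppr_eq0 -(natrD _ 1 1) Num.Theory.pnatr_eq0.
by [].
Qed.

Lemma pow2_root_conj u n : (u ^+ (2 ^ n) = 1)%R -> (u * conjc u = 1)%R.
Proof.
move=> un; have n1 : (`|u| = 1)%R.
  apply/eqP; rewrite -(@Num.Theory.pexpr_eq1 _ _ (2 ^ n)) ?expn_gt0 //.
  by rewrite -Num.Theory.normrX un Num.Theory.normr1.
by rewrite -sqr_normc n1 expr1n.
Qed.

(** A coherent choice of primitive roots of unity: entry [n] has order [2 ^ n.+1] and is the square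
    of the next entry. *)
Fixpoint root_chain (n : nat) : R[i] :=
  if n is m.+1 then Num.Theory.sqrtC (root_chain m) else (-1)%R.

Lemma root_chainS n : (root_chain n.+1 ^+ 2 = root_chain n)%R.
Proof. exact: Num.Theory.sqrtCK. Qed.

Lemma root_chain_pow2 n : (root_chain n ^+ (2 ^ n) = -1)%R.
Proof.
elim: n => [|n IHn]; first by rewrite expn0 expr1.
by rewrite expnS GRing.exprM root_chainS.
Qed.

(* An isomorphism is transported along two parallel chains of generators. *)
Lemma chain_embedding (G : groupType) (z : G) (A : set G) (a : nat -> G)
    (zeta : nat -> R[i]) (e d : nat -> nat) :
    z != 1 -> z * z = 1 ->
    (forall n, a n ^+ (2 ^ e n) = z) ->
    (forall n, (zeta n ^+ (2 ^ e n) = -1)%R) ->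
    (forall n, a n = a n.+1 ^+ d n) -> (forall n, (zeta n = zeta n.+1 ^+ d n)%R) ->
    (forall n k, A (a n ^+ k)) ->
    (forall x, A x -> exists n k, x = a n ^+ k) ->
  exists phi : G -> R[i],
    [/\ forall x y, A x -> A y -> (phi (x * y)%g = phi x * phi y)%R,
        forall x y, A x -> A y -> phi x = phi y -> x = y,
        phi z = (-1)%R &
        phi @` A = [set u | exists n, (u ^+ (2 ^ (e n).+1) = 1)%R]].
Proof.
move=> z1 zz az zetaz aS zetaS Aa Agen.
have prim n := primitive_root_pow2 (zetaz n).
have lift n m : (n <= m)%N ->
    exists D, a n = a m ^+ D /\ (zeta n = zeta m ^+ D)%R.
  elim: m => [|m IHm]; first by rewrite leqn0 => /eqP ->; exists 1%N.
  rewrite leq_eqVlt => /orP[/eqP ->|/IHm [D [aD zD]]]; first by exists 1%N.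
  by exists (d m * D)%N; rewrite aD zD aS zetaS expgnA GRing.exprM.
(* [a n] and [zeta n] both have order [2 ^ (e n).+1], so their powers coincide for the same
   exponents; this makes [phi] well defined and injective. *)
have eqak n k l : (a n ^+ k == a n ^+ l) = (zeta n ^+ k == zeta n ^+ l)%R.
  by rewrite (eq_prim_root_expr (prim n)) (eq_expg_mod _ _ z1 zz (az n)).
have eqa n k m l : a n ^+ k = a m ^+ l <-> (zeta n ^+ k = zeta m ^+ l)%R.
  wlog nm : n k m l / (n <= m)%N => [th|].
    have [/th//|/ltnW/th H] := leqP n m.
    by split=> /esym /H /esym.
  have [D [-> ->]] := lift n m nm.
  rewrite -expgnA -GRing.exprM; split=> /eqP.
    by rewrite eqak => /eqP.
  by rewrite -eqak => /eqP.
pose phi x : R[i] := xget 0%R [set u | exists n k, x = a n ^+ k /\ (u = zeta n ^+ k)%R].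
have phiE n k : phi (a n ^+ k) = (zeta n ^+ k)%R.
  have [] // : [set u | exists m l, a n ^+ k = a m ^+ l /\ (u = zeta m ^+ l)%R] (phi (a n ^+ k)).
    by apply: xgetPex; exists (zeta n ^+ k)%R, n, k.
  by move=> m [l [/eqa -> ->]].
exists phi; split.
- move=> _ _ /Agen [n [k ->]] /Agen [m [l ->]].
  have [D [aD zD]] := lift n (maxn n m) (leq_maxl _ _).
  have [D' [aD' zD']] := lift m (maxn n m) (leq_maxr _ _).
  rewrite !phiE zD zD' aD aD' -!expgnA -expgnDr phiE.
  by rewrite -!GRing.exprM -exprD.
- move=> _ _ /Agen [n [k ->]] /Agen [m [l ->]]; rewrite !phiE.
  by move/eqa.
- by rewrite -(az 0%N) phiE zetaz.
apply/seteqP; split=> u.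
  move=> [_ /Agen [n [k ->]] <-]; exists n.
  by rewrite phiE -GRing.exprM mulnC GRing.exprM (prim_expr_order (prim n)) expr1n.
move=> [n un]; have [i ->] := prim_rootP (prim n) un.
by exists (a n ^+ i) => //; exact: phiE.
Qed.

Section SquareRoots.
Context {G : groupType} (z : G) (A : set G).
Hypothesis z1 : z != 1.
Hypothesis zz : z * z = 1.
Hypothesis tors : forall x : G, exists n, x ^+ (2 ^ n) = 1.
Hypothesis Az : A z.
Hypothesis AX : forall x k, A x -> A (x ^+ k).
Hypothesis sqr : forall x y, A x -> A y -> x * x = y * y -> y = x \/ y = x * z.

(** If some [x0] of [A] has no square root in [A], it generates [A], and a constant chain suffices.
    Otherwise iterated square roots of [z] form an infinite chain. Uniqueness of square roots up to
    [z] shows, by induction on the order, that the chain exhausts [A]. *)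
Lemma uniserial_embedding : exists phi : G -> R[i],
    [/\ forall x y, A x -> A y -> (phi (x * y)%g = phi x * phi y)%R,
        forall x y, A x -> A y -> phi x = phi y -> x = y,
        phi z = (-1)%R &
        (exists n, phi @` A = [set u | (u ^+ (2 ^ n.+1) = 1)%R]) \/
        phi @` A = [set u | exists n, (u ^+ (2 ^ n.+1) = 1)%R]].
Proof.
have A1 : A 1 by rewrite -(expg0 z); exact: AX.
have [[x0 [Ax0 nx0]]|sqrt] := pselect (exists x, A x /\ forall y, A y -> y * y <> x).
  have [n0 x0n] : exists n, x0 ^+ (2 ^ n) = z.
    have ex : exists n, x0 ^+ (2 ^ n) == 1 by have [n /eqP] := tors x0; exists n.
    case: (ex_minnP ex) => -[|n] /eqP xn min.
      by case: (nx0 _ A1); rewrite mulg1 -xn expg1.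
    exists n; have [] // := sqr A1 (AX (2 ^ n) Ax0).
    - by rewrite mulg1 -expgnDr addnn -mul2n -expnS.
    - by move/eqP/min; rewrite ltnn.
    by rewrite mul1g.
  have gen x : A x -> exists k, x = x0 ^+ k.
    have [n] := tors x; elim: n x => [|n IHn] x.
      by rewrite expn0 expg1 => -> _; exists 0%N.
    rewrite expnS expgnA => /IHn xn Ax.
    have [k xk] := xn (AX 2 Ax).
    have xxk : x * x = x0 ^+ k by rewrite -expg2.
    have [ok|ek] := boolP (odd k); last first.
      have xx : x0 ^+ k./2 * x0 ^+ k./2 = x * x.
        by rewrite xxk -expgnDr addnn -[in RHS](odd_double_half k) (negPf ek).
      case: (sqr (AX _ Ax0) Ax xx) => ->; first by exists k./2.
      by exists (k./2 + 2 ^ n0)%N; rewrite expgnDr x0n.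
    (* For odd [k], [x0] is a power of [x0 ^+ k = x^2], hence a square in [A], against its
       choice. *)
    have co : coprime k (2 ^ n0.+1) by rewrite coprimeXr // coprimen2.
    have [u v uv _] := @egcdnP k (2 ^ n0.+1) (odd_gt0 ok).
    case: (nx0 _ (AX u Ax)); rewrite -expgnDr addnn -mul2n expgnA expg2 xxk.
    rewrite -expgnA mulnC uv (eqP co) addn1 expgS mulnC expgnA expnSr expgnA x0n.
    by rewrite expg2 zz expg1n mulg1.
  have [||||||phi [phiM phiI phiz phiA]] := @chain_embedding G z A (fun=> x0)
    (fun=> root_chain n0) (fun=> n0) (fun=> 1%N) z1 zz.
  - by [].
  - by move=> _; exact: root_chain_pow2.
  - by move=> _; rewrite expg1.
  - by move=> _; rewrite expr1.
  - by move=> n k; exact: AX.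
  - by move=> x /gen [k ->]; exists 0%N, k.
  exists phi; split=> //; left; exists n0; rewrite phiA.
  by apply/seteqP; split=> u; [case|exists 0%N].
have /choice[f fP] : forall x, exists y, A x -> A y /\ y * y = x.
  move=> x.
  have [Ax|] := pselect (A x); last by exists 1.
  apply: contrapT => nx; apply: sqrt; exists x; split=> // y Ay yx.
  by apply: nx; exists y.
pose a n := iter n f z.
have Aa n : A (a n) by elim: n => [//|n /fP[]].
have aS n : a n = a n.+1 ^+ 2 by rewrite expg2; have [_] := fP _ (Aa n).
have az n : a n ^+ (2 ^ n) = z.
  by elim: n => [|n IHn]; rewrite ?expg1 // expnS expgnA -aS.
have [|||n k|x Ax|phi [phiM phiI phiz phiA]] := @chain_embedding G z A a
  root_chain id (fun=> 2) z1 zz az.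
- exact: root_chain_pow2.
- exact: aS.
- by move=> n; rewrite root_chainS.
- exact: AX.
- have [n xn] := tors x; exists n; elim: n x Ax xn => [|n IHn] x Ax.
    by rewrite expn0 expg1 => ->; exists 0%N.
  rewrite expnS expgnA => /(IHn _ (AX 2 Ax)) [k xk].
  have xx : a n.+1 ^+ k * a n.+1 ^+ k = x * x.
    by rewrite -[RHS]expg2 xk (aS n) -[LHS]expg2 -!expgnA mulnC.
  case: (sqr (AX k (Aa n.+1)) Ax xx) => ->; first by exists k.
  by exists (k + 2 ^ n.+1)%N; rewrite expgnDr az.
by exists phi; split=> //; right.
Qed.

End SquareRoots.
End Roots.

(** * Generalized quaternion groups in coordinates *)

Section Quaternion.
Variable R : realType.

Definition quat_of_set (P : set R[i]) : set (quat R) :=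
  [set Quat u 0%R | u in P] `|` [set Quat 0%R u | u in P].

Lemma quatM00 (a c : R[i]) : Quat a 0%R * Quat c 0%R = Quat (a * c)%R 0%R.
Proof.
by rewrite [LHS]/(quat_mul _ _) /quat_mul [qsnd _]/= [qsnd _]/= !(rmorph0, mulr0, mul0r, subr0, addr0).
Qed.

Lemma quatM01 (a d : R[i]) : Quat a 0%R * Quat 0%R d = Quat 0%R (a * d)%R.
Proof.
by rewrite [LHS]/(quat_mul _ _) /quat_mul [qsnd _]/= [qfst _]/= !(rmorph0, mulr0, mul0r, subr0, addr0).
Qed.

Lemma quatM10 (b c : R[i]) : Quat 0%R b * Quat c 0%R = Quat 0%R (b * conjc c)%R.
Proof.
by rewrite [LHS]/(quat_mul _ _) /quat_mul [qsnd (Quat 0 _)%R]/=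
  [qsnd (Quat c _)%R]/= [qfst (Quat 0 _)%R]/= [qfst (Quat c _)%R]/=
  !(rmorph0, mulr0, mul0r, subr0, add0r, oppr0).
Qed.

Lemma quatM11 (b d : R[i]) : Quat 0%R b * Quat 0%R d = Quat (- (b * conjc d))%R 0%R.
Proof.
by rewrite [LHS]/(quat_mul _ _) /quat_mul [qsnd _]/= [qfst _]/=
  !(rmorph0, mulr0, mul0r, sub0r, addr0).
Qed.

(** The roots must be stable under complex conjugation, by which [j] acts, and contain -1, the
    square of [j]; hence the exponent [n.+1]. *)
Lemma subgroup_quat_of_set n :
  subgroup (quat_of_set [set u : R[i] | u ^+ (2 ^ n.+1) = 1]%R).
Proof.
set P := [set u | _]%R.
have PM u v : P u -> P v -> P (u * v)%R.
  by rewrite /P /= exprMn => -> ->; rewrite mulr1.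
have PN u : P u -> P (- u)%R.
  by rewrite /P /= exprNn => ->; rewrite mulr1 expnS exprM sqrrN expr1n expr1n.
have PJ u : P u -> P (conjc u) by rewrite /P /= -rmorphXn => -> ; rewrite rmorph1.
have P1 : P 1%R by rewrite /P /= expr1n.
have KJ u : P u -> (u * conjc u = 1)%R by move=> /pow2_root_conj.
have PMJ u v : P u -> P v -> P (u * conjc v)%R by move=> Pu Pv; apply: PM => //; exact: PJ.
split=> [x y [] [u Pu <-] [] [v Pv <-]|].
- by rewrite quatM00; left; exists (u * v)%R => //; exact: PM.
- by rewrite quatM01; right; exists (u * v)%R => //; exact: PM.
- by rewrite quatM10; right; exists (u * conjc v)%R => //; exact: PMJ.
- by rewrite quatM11; left; exists (- (u * conjc v))%R => //; exact/PN/PMJ.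
exists (Quat 1 0)%R; first by left; exists 1%R.
move=> x [] [u Pu <-]; split.
- by rewrite quatM00 mul1r.
- by rewrite quatM00 mulr1.
- exists (Quat (conjc u) 0)%R; first by left; exists (conjc u) => //; exact: PJ.
  by rewrite !quatM00 KJ // mulrC KJ.
- by rewrite quatM01 mul1r.
- by rewrite quatM10 rmorph1 mulr1.
exists (Quat 0 (- u))%R; first by right; exists (- u)%R => //; exact: PN.
by rewrite !quatM11 rmorphN mulrN mulNr opprK KJ.
Qed.

(** Right multiplication by [j] moves the cyclic part onto the other coset; for [2 <= n] the cyclic
    part contains the fourth roots of unity, so [Q8] is included. *)
Lemma Q2nE n : (2 <= n)%N ->
  @Q2n R n.+1 = quat_of_set [set u : R[i] | u ^+ (2 ^ n) = 1]%R.
Proof.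
case: n => // -[|n] // _; apply/seteqP; split; last first.
  move=> p Pp S [Sg sub].
  have Q0 : S (Quat 0 1)%R by apply: sub; right; right; exists 1%R => //=; do 3!left.
  case: Sg => SM _; case: Pp => [[u Pu <-]|[u Pu <-]].
    by apply: sub; left; exists u.
  have -> : Quat 0%R u = Quat u 0%R * Quat 0%R 1%R by rewrite quatM01 mulr1.
  by apply: SM => //; apply: sub; left; exists u.
move=> p; apply; split; first exact: subgroup_quat_of_set.
have root4 u : [set 1; -1; 'i; -'i]%C%R u -> (u ^+ (2 ^ n.+2) = 1 :> R[i])%R.
  have i2 : ('i ^+ 2 = -1 :> R[i])%C%R by rewrite sqr_i.
  move=> u4; suff u4E : (u ^+ 4 = 1)%R by rewrite !expnS mulnA exprM u4E expr1n.
  rewrite -[4%N]/((2 * 2)%N) exprM.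
  by case: u4 => [[[->|->]|->]|->]; rewrite ?sqrrN ?i2 ?sqrrN ?expr1n.
move=> q [[u Pu <-]|[[u Pu <-]|[u Pu <-]]]; [left|left|right]; exists u => //; exact: root4.
Qed.

Lemma C2nP k p : @C2n R k p <-> qsnd p = 0%R /\ (qfst p ^+ (2 ^ k) = 1)%R.
Proof.
case: p => a b; split=> [[u Pu [<- <-]] //|/= [-> Pa]]; by exists a.
Qed.

Lemma N1_neq1 : (-1 <> 1 :> R[i])%R.
Proof.
move/eqP; rewrite -subr_eq0 -opprD oppr_eq0 -(natrD _ 1 1).
by rewrite Num.Theory.pnatr_eq0.
Qed.
End Quaternion.

(** * Classification of 2-groups with a unique involution *)

Section Classification.
Variable R : realType.
Context {G : groupType} (z : G).
Hypothesis z1 : z != 1.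
Hypothesis zz : z * z = 1.
Hypothesis invol : forall x : G, x * x = 1 -> x = 1 \/ x = z.
Hypothesis tors : forall x : G, exists n, x ^+ (2 ^ n) = 1.

Let cyclic_or_quaternion (psi : G -> quat R) :=
  (exists2 k, range_inf 1 k & range psi = C2 R k) \/
  (exists2 k, range_inf 3 k & range psi = Q2 R k).

Lemma classification_cyclic :
    (forall x y, x * x = y * y -> y = x \/ y = x * z) ->
  exists psi : G -> quat R,
    [/\ {morph psi : x y / x * y}, injective psi & cyclic_or_quaternion psi].
Proof.
move=> sqr.
have [|||phi [phiM phiI _ phiA]] :=
  @uniserial_embedding R G z setT z1 zz tors; [by []|by []|by move=> ? ? _ _; exact: sqr|].
exists (fun x => Quat (phi x) 0%R); split.
- by move=> x y; rewrite quatM00 phiM.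
- by move=> x y [] /phiI; apply.
left; case: phiA => [[n phiA]|phiA].
  exists (Fin n.+1) => //; apply/seteqP; split=> [_ [x _ <-]|p /C2nP [p0 pn]].
    apply/C2nP; split=> //=.
    by have : (phi @` setT) (phi x) by [exists x]; rewrite phiA.
  have : [set u | u ^+ (2 ^ n.+1) = 1]%R (qfst p) by [].
  by rewrite -phiA => -[x _ xp]; exists x => //; rewrite xp -p0; case: (p).
exists Infty => //; apply/seteqP; split=> [_ [x _ <-]|p [[//|n] _ /C2nP [p0 pn]]].
  have : (phi @` setT) (phi x) by exists x.
  by rewrite phiA => -[n xn]; exists n.+1 => //; apply/C2nP.
have : [set u | exists n, u ^+ (2 ^ n.+1) = 1]%R (qfst p) by exists n.
by rewrite -phiA => -[x _ xp]; exists x => //; rewrite xp -p0; case: (p).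
Qed.

(** When the [i] of [normal_order4] is central, square roots are unique up to [z] in the whole
    group. Otherwise some [b] inverts [i] and, with it, every element of the centralizer [A], which
    has index 2; [phi] embeds [A] into the roots of unity, where inversion is complex conjugation,
    and [b] is sent to [j]. *)
Lemma classification : exists psi : G -> quat R,
  [/\ {morph psi : x y / x * y}, injective psi & cyclic_or_quaternion psi].
Proof.
have [has4|no4] := pselect (exists a : G, order4 z a); last first.
  apply: classification_cyclic => x y xy; apply: (sqr_eq z1 invol tors xy) => k k4.
  by case: no4; exists ((x^-1 * y) ^+ k).
have [i i4 iN] := normal_order4 z1 zz invol tors has4.
have [central|] := pselect (forall g, i ^ g = i).
  apply: classification_cyclic => x y xy.
  exact: (sqr_eq_centralizer z1 zz invol tors i4).
move=> /existsNP [b ib].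
have iP g : i ^ g = i \/ i ^ g = i^-1 by exact: upto_zP (iN g).
have {}ib : i ^ b = i^-1 by case: (iP b).
pose A : set G := [set g | i ^ g = i].
have [|||phi [phiM phiI phiz phiA]] := @uniserial_embedding R G z A z1 zz tors.
- by rewrite /A /= conjgE (involution_central z1 zz invol) mulKg.
- move=> x k Ax; rewrite /A /=; elim: k => [|k IHk]; first by rewrite conjg1.
  by rewrite expgS conjgM Ax.
- by move=> x y Ax Ay; exact: (sqr_eq_centralizer z1 zz invol tors i4).
have AM x y : A x -> A y -> A (x * y) by move=> Ax Ay; rewrite /A /= conjgM Ax.
have AV x : A x -> A x^-1.
  by move=> Ax; rewrite /A /= -[X in X ^ _]Ax conjgK.
have Az : A z by rewrite /A /= conjgE (involution_central z1 zz invol) mulKg.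
have A1 : A 1 by rewrite -zz; exact: AM.
have b4 := inverting_order4 z1 zz invol tors i4 ib.
have Ab x : A x -> b * x * b^-1 = x^-1.
  move=> Ax; have := conjgK b x^-1.
  rewrite conjVg (inverting_centralizer z1 zz invol tors i4 ib Ax) invgK.
  by rewrite conjgE invgK mulgA.
have phi1 : (phi 1%g = 1)%R.
  have /eqP := phiM z 1 Az A1; rewrite mulg1 phiz mulN1r eqr_opp eq_sym => /eqP //.
have phi_root x : A x -> exists n, (phi x ^+ (2 ^ n) = 1)%R.
  move=> Ax; have : (phi @` A) (phi x) by exists x.
  by case: phiA => [[n ->]|->]; [move=> xn; exists n.+1|move=> [n xn]; exists n.+1].
have phiV x : A x -> (phi x^-1%g = conjc (phi x))%R.
  move=> Ax; have [n /pow2_root_conj xx] := phi_root x Ax.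
  have := phiM _ _ Ax (AV _ Ax); rewrite mulgV phi1 -xx => /esym.
  apply: mulfI; apply/eqP => x0; move: xx; rewrite x0 mul0r => /esym/eqP.
  by rewrite oner_eq0.
pose psi x := if i ^ x == i then Quat (phi x) 0%R else Quat 0%R (phi (x * b^-1)).
have psiA x : A x -> psi x = Quat (phi x) 0%R by rewrite /psi => ->; rewrite eqxx.
have iV := order4_neqV z1 i4.
have psiNA x : A x -> psi (x * b) = Quat 0%R (phi x).
  move=> Ax; rewrite /psi conjgM Ax ib mulgK; case: eqP => // /esym.
  by move=> iiV; case: iV.
have AP x : A x \/ exists2 y, A y & x = y * b.
  have [Ax|xi] := iP x; [by left|right]; exists (x * b^-1); last by rewrite mulgVK.
  by rewrite /A /= conjgM xi -ib conjgK.
have bA y : A y -> b * y = y^-1 * b by move=> /Ab <-; rewrite mulgVK.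
exists psi; split.
- move=> x y; have [Ax|[x' Ax ->]] := AP x; have [Ay|[y' Ay ->]] := AP y.
  + by rewrite !psiA ?quatM00 ?phiM //; exact: AM.
  + by rewrite mulgA (psiNA _ (AM _ _ Ax Ay)) (psiA _ Ax) (psiNA _ Ay) quatM01 phiM.
  + have -> : x' * b * y = x' * y^-1 * b by rewrite -mulgA bA // mulgA.
    have Ay' := AV _ Ay.
    by rewrite (psiNA _ (AM _ _ Ax Ay')) (psiNA _ Ax) (psiA _ Ay) quatM10 phiM // phiV.
  have Ay' := AV _ Ay; have Axy := AM _ _ Ax Ay'.
  have -> : x' * b * (y' * b) = x' * y'^-1 * z.
    by rewrite mulgA -(mulgA x') bA // -mulgA -mulgA b4 mulgA.
  by rewrite (psiA _ (AM _ _ Axy Az)) (psiNA _ Ax) (psiNA _ Ay) quatM11 !phiM // phiz phiV // mulrN1.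
- move=> x y; have [Ax|[x' Ax ->]] := AP x; have [Ay|[y' Ay ->]] := AP y.
  + by rewrite !psiA // => -[]; exact: phiI.
  + rewrite (psiA _ Ax) (psiNA _ Ay) => -[x0 _]; have [n] := phi_root x Ax.
    by rewrite x0 expr0n expn_eq0 /= => /esym/eqP; rewrite oner_eq0.
  + rewrite (psiA _ Ay) (psiNA _ Ax) => -[y0 _]; have [n] := phi_root y Ay.
    by rewrite -y0 expr0n expn_eq0 /= => /esym/eqP; rewrite oner_eq0.
  by rewrite (psiNA _ Ax) (psiNA _ Ay) => -[/phiI ->].
right.
have -> : range psi = quat_of_set (phi @` A).
  apply/seteqP; split.
    move=> _ [x _ <-]; have [Ax|[x' Ax ->]] := AP x.
      by rewrite psiA //; left; exists (phi x) => //; exists x.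
    by rewrite psiNA //; right; exists (phi x') => //; exists x'.
  move=> _ [] [_ [x Ax <-] <-]; first by exists x => //; exact: psiA.
  by exists (x * b) => //; exact: psiNA.
have Ai : A i by rewrite /A /= conjgg.
(* [A] contains [i] of order 4, which excludes the group of order 2. The roots of unity of order
   dividing [2 ^ n.+2], with their products by [j], form [Q2n n.+3]. *)
case: phiA => [[[|n] phiA]|phiA].
- have : (phi @` A) (phi i) by exists i.
  by rewrite phiA /= expn1 exprS expr1 -phiM // i4 phiz => /N1_neq1.
- by exists (Fin n.+3) => //; rewrite phiA /= Q2nE.
exists Infty => //; apply/seteqP; split=> p.
  rewrite phiA => -[] [u [n un] <-]; exists n.+3 => //; rewrite Q2nE //.
    by left; exists u => //=; rewrite expnSr exprM un expr1n.
  by right; exists u => //=; rewrite expnSr exprM un expr1n.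
move=> [[//|[//|[//|n]]] _]; rewrite Q2nE // phiA => -[] [u un <-].
  by left; exists u => //; exists n.+1.
by right; exists u => //; exists n.+1.
Qed.
End Classification.

(** * Invariants separating the model groups *)

Section Exponent.
Context {T : semigroupType}.
Implicit Types S : set T.

Definition iter_sqr m (x : T) : T := iter m (fun y => y * y) x.

(** A subset of a semigroup carries no named unit, so the triviality of [x^(2^m)] is expressed by
    its acting as a left unit. *)
Definition exponent_le S m := forall x y, S x -> S y -> iter_sqr m x * y = y.

Definition commutative_on S := forall x y, S x -> S y -> x * y = y * x.

End Exponent.

Lemma alg_isomorphic_invariants (T U : semigroupType) (S : set T) (S' : set U) :
  (forall x y, S x -> S y -> S (x * y)) -> alg_isomorphic S S' ->
  (commutative_on S <-> commutative_on S') /\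
  (forall m, exponent_le S m <-> exponent_le S' m).
Proof.
move=> SM [f [[fS finj fsurj] fM]].
have fM' x y : S x -> S y -> f (x * y) = f x * f y.
  by move=> Sx Sy; apply: fM; rewrite inE.
have finj' x y : S x -> S y -> f x = f y -> x = y.
  by move=> Sx Sy; apply: finj; rewrite inE.
have Sit m x : S x -> S (iter_sqr m x).
  by move=> Sx; elim: m => //= m IHm; exact: SM.
have fit m x : S x -> f (iter_sqr m x) = iter_sqr m (f x).
  by move=> Sx; elim: m => //= m IHm; rewrite fM' ?IHm //; exact: Sit.
split=> [|m]; split=> H.
- by move=> _ _ /fsurj[x Sx <-] /fsurj[y Sy <-]; rewrite -!fM' // H.
- by move=> x y Sx Sy; apply: finj'; rewrite ?fM' //; [exact: SM|exact: SM|apply: H; exact: fS].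
- move=> _ _ /fsurj[x Sx <-] /fsurj[y Sy <-]; rewrite -fit // -fM' ?H //; exact: Sit.
- move=> x y Sx Sy; apply: finj'; rewrite ?fM' ?fit //; try exact: Sit.
    by apply: SM => //; exact: Sit.
  by apply: H; exact: fS.
Qed.

Section Types.
Variable R : realType.

Lemma iter_sqr_quat m (u : R[i]) : iter_sqr m (Quat u 0%R) = Quat (u ^+ (2 ^ m))%R 0%R.
Proof.
elim: m => [|m IHm]; first by rewrite expn0 expr1.
by rewrite /iter_sqr /= -/(iter_sqr m _) IHm quatM00 -expr2 -exprM mulnC expnS.
Qed.

Lemma root_chain_eq1 n m : (root_chain R n ^+ (2 ^ m) == 1)%R = (n < m)%N.
Proof.
rewrite -(prim_order_dvd (primitive_root_pow2 (root_chain_pow2 R n))).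
by rewrite dvdn_Pexp2l.
Qed.

Definition exponent_bound (k : exponent) (m : nat) : Prop :=
  if k is Fin n then (n <= m)%N else False.

Lemma exponent_bound_inj k l :
  (forall m, exponent_bound k m <-> exponent_bound l m) -> k = l.
Proof.
case: k l => [k|] [l|] H //.
- congr Fin; apply/eqP; rewrite eqn_leq.
  by apply/andP; split; [apply/H => /=|apply/(H k) => /=].
- by have /= [/(_ (leqnn k))] := H k.
- by have /= [_ /(_ (leqnn l))] := H l.
Qed.

Lemma commutative_C2 k : commutative_on (C2 R k).
Proof.
have main n m (p q : quat R) : C2n n p -> C2n m q -> p * q = q * p.
  by move=> [u _ <-] [v _ <-]; rewrite !quatM00 mulrC.
by case: k => [n|] p q; [exact: main|move=> [n _ pn] [m _ qm]; exact: main pn qm].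
Qed.

Lemma exponent_C2 k : range_inf 1 k ->
  forall m, exponent_le (C2 R k) m <-> exponent_bound k m.
Proof.
have up n m (p q : quat R) : (n <= m)%N -> C2n n p -> qsnd q = 0%R -> iter_sqr m p * q = q.
  move=> nm [u un <-]; case: q => v w /= ->.
  by rewrite iter_sqr_quat -(subnKC nm) expnD exprM un expr1n quatM00 mul1r.
have down (S : set (quat R)) m n : exponent_le S m -> S (Quat (root_chain R n) 0)%R ->
    S (Quat 1 0)%R -> (n < m)%N.
  move=> Sm Sn S1; have := Sm _ _ Sn S1.
  by rewrite iter_sqr_quat quatM00 mulr1 => -[/eqP]; rewrite root_chain_eq1.
have rc n : C2n n.+1 (Quat (root_chain R n) 0)%R.
  by apply/C2nP; split=> //=; apply/eqP; rewrite root_chain_eq1.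
have one n : @C2n R n (Quat 1 0)%R by apply/C2nP; split=> //=; rewrite expr1n.
case: k => [[//|n] _|_] m; split => //.
- by move=> /down; apply; [exact: rc|exact: one].
- by move=> nm p q /= pn [u _ <-]; exact: (up n.+1).
- move=> Em; suff : (m < m)%N by rewrite ltnn.
  apply: (down _ _ _ Em); first by exists m.+1 => //; exact: rc.
  by exists 1%N => //; exact: one.
Qed.

Lemma noncommutative_Q2 k : range_inf 3 k -> ~ commutative_on (Q2 R k).
Proof.
move=> k3 H.
have Q3 (p : quat R) : Q2n 3 p -> Q2 R k p.
  case: k k3 {H} => [[|[|[|n]]]//= _|_]; last by exists 3%N.
  rewrite !Q2nE // => -[] [u un <-]; [left|right]; exists u => //=.
    by rewrite -[n.+2]/((2 + n)%N) expnD exprM un expr1n.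
  by rewrite -[n.+2]/((2 + n)%N) expnD exprM un expr1n.
have i4 : ('i ^+ (2 ^ 2) = 1 :> R[i])%C%R.
  by rewrite -[(2 ^ 2)%N]/((2 * 2)%N) exprM sqr_i sqrrN expr1n.
have Qi : Q2 R k (Quat 'i 0)%C%R by apply: Q3; rewrite Q2nE //; left; exists 'i%C.
have Q1 : Q2 R k (Quat 0 1)%R.
  by apply: Q3; rewrite Q2nE //; right; exists 1%R => //=; rewrite expr1n.
have := H _ _ Qi Q1; rewrite quatM01 quatM10 mulr1 mul1r.
move=> /(congr1 (fun p : quat R => complex.Im (qsnd p))) /= /eqP.
by rewrite -subr_eq0 opprK -(natrD _ 1 1) Num.Theory.pnatr_eq0.
Qed.

(** The elements outside the cyclic subgroup of index 2 square to -1, so the exponent of [Q_{2^n}]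
    is that of the subgroup; hence [n.-1]. *)
Lemma exponent_Q2 k : range_inf 3 k ->
  forall m, exponent_le (Q2 R k) m <->
    exponent_bound (if k is Fin n then Fin n.-1 else Infty) m.
Proof.
have Q2i n m (p q : quat R) : (n.+2 <= m)%N -> Q2n n.+3 p -> iter_sqr m p * q = q.
  move=> nm; rewrite Q2nE // => pn.
  have -> : iter_sqr m p = Quat 1%R 0%R.
    case: pn => -[u un <-].
      by rewrite iter_sqr_quat -(subnKC nm) expnD exprM un expr1n.
    rewrite -(prednK (leq_trans _ nm)) // /iter_sqr iterSr quatM11.
    rewrite (pow2_root_conj un) -/(iter_sqr _ _) iter_sqr_quat.
    by case: m nm => [//|[//|m]] _; rewrite /= expnS exprM sqrrN !expr1n.
  case: q => v w; rewrite [LHS]/(quat_mul _ _) /quat_mul.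
  by rewrite [qfst (Quat 1 0)%R]/= [qsnd (Quat 1 0)%R]/= !mul0r subr0 addr0 !mul1r.
have down (S : set (quat R)) m n : exponent_le S m -> S (Quat (root_chain R n) 0)%R ->
    S (Quat 1 0)%R -> (n < m)%N.
  move=> Sm Sn S1; have := Sm _ _ Sn S1.
  by rewrite iter_sqr_quat quatM00 mulr1 => -[/eqP]; rewrite root_chain_eq1.
have rc n : Q2n n.+3 (Quat (root_chain R n.+1) 0)%R.
  by rewrite Q2nE //; left; exists (root_chain R n.+1) => //; apply/eqP; rewrite root_chain_eq1.
have one n : @Q2n R n.+3 (Quat 1 0)%R.
  by rewrite Q2nE //; left; exists 1%R => //=; rewrite expr1n.
case: k => [[|[|[|n]]]// _|_] m; split => //.
- by move=> /down; apply; [exact: rc|exact: one].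
- by move=> nm p q /= pn _; exact: (Q2i n).
- move=> Em; suff : (m.+1 < m)%N by rewrite ltnNge leqnSn.
  apply: (down _ _ _ Em); first by exists m.+3 => //; exact: rc.
  by exists 3%N => //; exact: one.
Qed.

(** Together with the next two lemmas this ensures that no orbit is counted in two of the powers:
    exponents distinguish the sizes, commutativity the two families. *)
Lemma C2_type_inj (T : semigroupType) (S : set T) k l :
  (forall x y, S x -> S y -> S (x * y)) -> range_inf 1 k -> range_inf 1 l ->
  alg_isomorphic S (C2 R k) -> alg_isomorphic S (C2 R l) -> k = l.
Proof.
move=> SM k1 l1 /(alg_isomorphic_invariants SM) [_ Ek].
move=> /(alg_isomorphic_invariants SM) [_ El].
by apply: exponent_bound_inj => m; rewrite -exponent_C2 // -exponent_C2 // -Ek -El.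
Qed.

Lemma Q2_type_inj (T : semigroupType) (S : set T) k l :
  (forall x y, S x -> S y -> S (x * y)) -> range_inf 3 k -> range_inf 3 l ->
  alg_isomorphic S (Q2 R k) -> alg_isomorphic S (Q2 R l) -> k = l.
Proof.
move=> SM k3 l3 /(alg_isomorphic_invariants SM) [_ Ek].
move=> /(alg_isomorphic_invariants SM) [_ El].
have : (if k is Fin n then Fin n.-1 else Infty) = (if l is Fin n then Fin n.-1 else Infty).
  by apply: exponent_bound_inj => m; rewrite -exponent_Q2 // -exponent_Q2 // -Ek -El.
case: k k3 {Ek} => [[|k]//|]; case: l l3 {El} => [[|l]//|] //.
by move=> _ _ [->].
Qed.

Lemma C2_Q2_disjoint (T : semigroupType) (S : set T) k l :
  (forall x y, S x -> S y -> S (x * y)) -> range_inf 3 l ->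
  alg_isomorphic S (C2 R k) -> alg_isomorphic S (Q2 R l) -> False.
Proof.
move=> SM l3 /(alg_isomorphic_invariants SM) [Ck _].
move=> /(alg_isomorphic_invariants SM) [Cl _].
by apply: (noncommutative_Q2 l3); apply/Cl/Ck; exact: commutative_C2.
Qed.
End Types.

(** * Shifts, 2-cogroups and superextensions *)

Section Shifts.
Context {X : groupType}.
Implicit Types (A B K : set X) (x y : X).

Lemma left_shiftE x A y : left_shift x A y = A (x^-1 * y).
Proof.
apply/propext; split=> [[a Aa <-]|Ay]; first by rewrite mulKg.
by exists (x^-1 * y); rewrite // mulVKg.
Qed.

Lemma left_shiftM x y A : left_shift x (left_shift y A) = left_shift (x * y) A.
Proof. by apply/funext => z; rewrite !left_shiftE invgM mulgA. Qed.

Lemma left_shift1 A : left_shift 1 A = A.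
Proof. by apply/funext => z; rewrite left_shiftE invg1 mul1g. Qed.

Lemma left_shiftC x A : left_shift x (~` A) = ~` left_shift x A.
Proof. by apply/funext => z; rewrite /setC /= !left_shiftE. Qed.

Lemma left_shiftI x A B : left_shift x (A `&` B) = left_shift x A `&` left_shift x B.
Proof. by apply/funext => z; rewrite /setI /= !left_shiftE. Qed.

Lemma left_shiftS x A B : A `<=` B -> left_shift x A `<=` left_shift x B.
Proof. by move=> AB z; rewrite !left_shiftE => /AB. Qed.

Lemma left_shiftK x A : left_shift x^-1 (left_shift x A) = A.
Proof. by rewrite left_shiftM mulVg left_shift1. Qed.

Lemma left_shiftVK x A : left_shift x (left_shift x^-1 A) = A.
Proof. by rewrite left_shiftM mulgV left_shift1. Qed.

Lemma conjugateE x K y : conjugate x K y = K (x^-1 * y * x).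
Proof.
apply/propext; split=> [[a Ka <-]|Ky]; first by rewrite -!mulgA mulVg mulg1 mulKg.
by exists (x^-1 * y * x) => //; rewrite -!mulgA mulgV mulg1 mulVKg.
Qed.

Lemma conjugateM x y K : conjugate x (conjugate y K) = conjugate (x * y) K.
Proof. by apply/funext => z; rewrite !conjugateE invgM !mulgA. Qed.

Lemma conjugate1 K : conjugate 1 K = K.
Proof. by apply/funext => z; rewrite conjugateE invg1 mul1g mulg1. Qed.

Lemma conjugateK x K : conjugate x^-1 (conjugate x K) = K.
Proof. by rewrite conjugateM mulVg conjugate1. Qed.

Lemma conjugateS x K K' : K `<=` K' -> conjugate x K `<=` conjugate x K'.
Proof. by move=> KK' z; rewrite !conjugateE => /KK'. Qed.

(** A 2-cogroup is the nontrivial coset of [K K] in a group containing it with index 2; the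
    right-hand side expresses this by elements, in a form that passes to unions of chains. *)
Lemma cogroupP K : is_2cogroup K <->
  [/\ K !=set0, forall a b c, K a -> K b -> K c -> K (a * b * c),
      forall a, K a -> K a^-1 & forall a b, K a -> K b -> ~ K (a * b)].
Proof.
split=> [[K0 Kx]|[K0 K3 KV K2]].
  have one x : K x -> left_shift x K 1.
    move=> /Kx [_ [_ [e xe eP]] _]; have [ee _ _] := eP e xe.
    by have -> : 1 = e by apply: (mulgI e); rewrite mulg1 ee.
  have KV a : K a -> K a^-1 by move=> /one; rewrite left_shiftE mulg1.
  split=> // [a b c Ka Kb Kc|a b Ka Kb Kab]; last first.
    have [_ _ d] := Kx a Ka; have : (left_shift a K `&` K) (a * b).
      by split=> //; rewrite left_shiftE mulKg.
    by rewrite d.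
  have [cE [cM _] _] := Kx c Kc.
  have cca : left_shift c K (c * a) by rewrite left_shiftE mulKg.
  have cbc : left_shift c K (b * c) by rewrite cE; exists b.
  by have := cM _ _ cca cbc; rewrite left_shiftE -!mulgA mulKg.
split=> // x Kx; split.
- apply/seteqP; split=> [_ [a Ka <-]|_ [a Ka <-]].
    exists (x * a * x^-1); first by apply: (K3) => //; exact: KV.
    by rewrite mulgVK.
  exists (x^-1 * a * x); first by apply: (K3) => //; exact: KV.
  by rewrite -mulgA mulVKg.
- split=> [_ _ [a Ka <-] [b Kb <-]|].
    by exists (a * x * b); [exact: K3|rewrite !mulgA].
  exists 1; first by exists x^-1; [exact: KV|rewrite mulgV].
  move=> _ [a Ka <-]; rewrite mul1g mulg1; split=> //.
  exists (a^-1 * x^-1); last by rewrite -invgM mulgV mulVg.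
  exists (x^-1 * a^-1 * x^-1); first by apply: (K3); exact: KV.
  by rewrite -mulgA mulVKg.
apply/seteqP; split=> // _ [[a Ka <-] xa]; exact: K2 xa.
Qed.

Lemma conjugate_cogroup x K : is_2cogroup K -> is_2cogroup (conjugate x K).
Proof.
move=> /cogroupP [[k Kk] K3 KV K2]; apply/cogroupP; split.
- by exists (x * k * x^-1); exists k.
- move=> _ _ _ [a Ka <-] [b Kb <-] [c Kc <-]; exists (a * b * c); first exact: K3.
  by rewrite !mulgA !mulgVK.
- move=> _ [a Ka <-]; exists a^-1; first exact: KV.
  by rewrite !invgM invgK mulgA.
move=> _ _ [a Ka <-] [b Kb <-]; rewrite conjugateE !mulgA mulVg mul1g !mulgVK.
exact: K2.
Qed.

Lemma conjugate_maximal x K : maximal_2cogroups X K -> maximal_2cogroups X (conjugate x K).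
Proof.
move=> [cK maxK]; split; first exact: conjugate_cogroup.
move=> K' cK' /(@conjugateS x^-1); rewrite conjugateK => KK'.
by rewrite -(maxK _ (conjugate_cogroup x^-1 cK') KK') conjugateM mulgV conjugate1.
Qed.

Lemma subset_maximal_cogroup K : is_2cogroup K ->
  exists2 K', maximal_2cogroups X K' & K `<=` K'.
Proof.
move=> cK; pose P K' := K' = set0 \/ (is_2cogroup K' /\ K `<=` K').
have [F FP tot|M [PM maxM]] := @Zorn_bigcup X P.
  have [[D [FD [cD KD]]]|noD] := pselect (exists D, F D /\ (is_2cogroup D /\ K `<=` D)); last first.
    left; apply/seteqP; split=> // y [D FD Dy]; case: (FP D FD) => [D0|cD].
      by rewrite D0 in Dy.
    by case: noD; exists D.
  right; split; last by move=> y Ky; exists D => //; exact: KD.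
  have in1 a b : (\bigcup_(Y in F) Y) a -> (\bigcup_(Y in F) Y) b ->
      exists D', [/\ F D', is_2cogroup D', D' a & D' b].
    move=> [Y FY Ya] [Z FZ Zb].
    have cY : is_2cogroup Y by case: (FP _ FY) => [Y0|[]//]; rewrite Y0 in Ya.
    have cZ : is_2cogroup Z by case: (FP _ FZ) => [Z0|[]//]; rewrite Z0 in Zb.
    by case: (tot Y Z FY FZ) => YZ; [exists Z; split=> //; exact: YZ|exists Y; split=> //; exact: YZ].
  apply/cogroupP; split.
  - by have [k Kk] := cK.1; exists k, D => //; exact: KD.
  - move=> a b c Fa Fb [Z FZ Zc]; have [Y [FY cY Ya Yb]] := in1 _ _ Fa Fb.
    have cZ : is_2cogroup Z by case: (FP _ FZ) => [Z0|[]//]; rewrite Z0 in Zc.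
    case: (tot Y Z FY FZ) => YZ.
      exists Z => //; have /cogroupP [_ Z3 _ _] := cZ; apply: Z3 => //; exact: YZ.
    exists Y => //; have /cogroupP [_ Y3 _ _] := cY; apply: Y3 => //; exact: YZ.
  - move=> a Fa; have [Y [FY /cogroupP[_ _ YV _] Ya _]] := in1 _ _ Fa Fa.
    by exists Y => //; exact: YV.
  move=> a b Fa Fb [Z FZ Zab]; have [Y [FY cY Ya Yb]] := in1 _ _ Fa Fb.
  have cZ : is_2cogroup Z by case: (FP _ FZ) => [Z0|[]//]; rewrite Z0 in Zab.
  case: (tot Y Z FY FZ) => YZ.
    by have /cogroupP [_ _ _ Z2] := cZ; apply: Z2 Zab; exact: YZ.
  by have /cogroupP [_ _ _ Y2] := cY; apply: (Y2 a b) => //; exact: YZ.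
case: PM => [M0|[cM KM]].
  case: (maxM K); last by right; split.
  split; first by rewrite M0.
  by rewrite M0 => K0; have [k /K0] := cK.1.
exists M => //; split=> // K' cK' MK'; apply: contrapT => neq.
apply: (maxM K'); last by right; split=> //; exact: subset_trans MK'.
by split=> // K'M; apply: neq; apply/seteqP.
Qed.

Definition square K : set X := (K : power X) * (K : power X).

Lemma squareP K y : square K y <-> exists a b, [/\ K a, K b & y = a * b].
Proof.
split=> [[a Ka [b Kb <-]]|[a [b [Ka Kb ->]]]]; first by exists a, b.
by exists a => //; exists b.
Qed.

Section Cogroup.
Variable K : set X.
Hypothesis cK : is_2cogroup K.

Let K3 a b c : K a -> K b -> K c -> K (a * b * c).
Proof. by have /cogroupP [_ + _ _] := cK; exact. Qed.

Lemma cogroupV a : K a -> K a^-1.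
Proof. by have /cogroupP [_ _ + _] := cK; exact. Qed.

Lemma square_disjoint a : K a -> square K a -> False.
Proof.
move=> + /squareP [b [c [Kb Kc aE]]]; rewrite aE.
by have /cogroupP [_ _ _ K2] := cK; exact: K2.
Qed.

Lemma square1 : square K 1.
Proof.
have [k Kk] := cK.1; apply/squareP; exists k, k^-1.
by split=> //; [exact: cogroupV|rewrite mulgV].
Qed.

Lemma squareM a b : square K a -> square K b -> square K (a * b).
Proof.
move=> /squareP [c [d [Kc Kd ->]]] /squareP [e [f [Ke Kf ->]]].
by apply/squareP; exists (c * d * e), f; split; rewrite ?mulgA //; exact: K3.
Qed.

Lemma squareV a : square K a -> square K a^-1.
Proof.
move=> /squareP [c [d [Kc Kd ->]]]; apply/squareP; exists d^-1, c^-1.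
by split; [exact: cogroupV|exact: cogroupV|rewrite invgM].
Qed.

Lemma cogroup_squareM a b : K a -> square K b -> K (a * b).
Proof. by move=> Ka /squareP [c [d [Kc Kd ->]]]; rewrite mulgA; exact: K3. Qed.

Lemma square_cogroupM a b : square K a -> K b -> K (a * b).
Proof. by move=> /squareP [c [d [Kc Kd ->]]] Ka; exact: K3. Qed.

Lemma cogroup_square a b : K a -> K b -> square K (a * b).
Proof. by move=> Ka Kb; apply/squareP; exists a, b. Qed.

Lemma cogroupMr a b : K b -> K (a * b) <-> square K a.
Proof.
move=> Kb; split=> [Kab|sa]; last exact: square_cogroupM.
by rewrite -(mulgK b a); apply: cogroup_square => //; exact: cogroupV.
Qed.

Lemma squareMsr a b : square K b -> square K (a * b) <-> square K a.
Proof.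
move=> sb; split=> [sab|sa]; last exact: squareM.
by rewrite -(mulgK b a); apply: squareM => //; exact: squareV.
Qed.

Lemma squareMsl a b : square K a -> square K (a * b) <-> square K b.
Proof.
move=> sb; split=> [sab|sa]; last exact: squareM.
by rewrite -(mulKg a b); apply: squareM => //; exact: squareV.
Qed.

Lemma stab1 : stab K 1. Proof. exact: conjugate1. Qed.

Lemma stabM x y : stab K x -> stab K y -> stab K (x * y).
Proof. by rewrite /stab /= => Kx Ky; rewrite -conjugateM Ky. Qed.

Lemma stabV x : stab K x -> stab K x^-1.
Proof. by rewrite /stab /= => Kx; rewrite -{1}Kx conjugateK. Qed.

Lemma stab_conj x y : stab K x -> K (x * y * x^-1) <-> K y.
Proof.
by move=> Kx; rewrite -{1}Kx conjugateE -!mulgA mulVg mulg1 mulKg.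
Qed.

Lemma stab_square_conj x y : stab K x -> square K (x * y * x^-1) <-> square K y.
Proof.
move=> Kx; split=> /squareP [a [b [Ka Kb e]]]; apply/squareP.
  exists (x^-1 * a * x^-1^-1), (x^-1 * b * x^-1^-1).
  split; try by apply/stab_conj => //; exact: stabV.
  rewrite !mulgA mulgVK -[x^-1 * a * b]mulgA -e.
  by rewrite invgK -!mulgA mulVg mulg1 mulKg.
exists (x * a * x^-1), (x * b * x^-1); split; try by apply/stab_conj.
by rewrite e !mulgA mulgVK.
Qed.

Lemma cogroup_stab x : K x -> stab K x.
Proof.
move=> Kx; apply/funext => y; rewrite conjugateE; apply/propext; split=> [H|Ky].
  have -> : y = x * (x^-1 * y * x) * x^-1 by rewrite !mulgA mulgK mulgV mul1g.
  by apply: K3 => //; exact: cogroupV.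
by apply: K3 => //; exact: cogroupV.
Qed.

Lemma square_stab x : square K x -> stab K x.
Proof. by move=> /squareP [a [b [Ka Kb ->]]]; apply: stabM; exact: cogroup_stab. Qed.
End Cogroup.
End Shifts.

Section Superextension.
Context {X : groupType}.
Implicit Types (L M : double_power X) (A B S : set X).

(** By maximality a nonempty set meeting every member is a member. Hence these are the monotone
    families containing exactly one of each set and its complement, the form used from here on. *)
Lemma superextensionP L : superextension X L <->
  (forall A B, A `<=` B -> L A -> L B) /\ (forall A, L (~` A) <-> ~ L A).
Proof.
split=> [[lL maxL]|[mono symm]].
  have add A : (forall B, L B -> A `&` B !=set0) -> A !=set0 -> L A.
    move=> AL A0; have -> : L = (L `|` [set A] : set (set X)); last by right.
    apply: maxL; last by move=> B; left.
    move=> B C [LB|->] [LC|->]; [exact: lL|by rewrite setIC; exact: AL|exact: AL|by rewrite setIid].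
  have L0 A : L A -> A !=set0 by move=> LA; have := lL A A LA LA; rewrite setIid.
  have mono A B : A `<=` B -> L A -> L B.
    move=> AB LA; apply: add; last by have [x Ax] := L0 A LA; exists x; exact: AB.
    by move=> C LC; have [x [Ax Cx]] := lL A C LA LC; exists x; split=> //; exact: AB.
  split=> // A; split=> [LCA LA|nLA].
    by have [x []] := lL _ _ LCA LA.
  apply: contrapT => nLCA; apply: nLA; apply: (add).
    move=> B LB; apply: contrapT => AB; apply: nLCA; apply: mono LB => x Bx Ax.
    by apply: AB; exists x.
  apply: contrapT => A0; apply: nLCA; apply: (add).
    move=> B /L0 [x Bx]; exists x; split=> // Ax; apply: A0; by exists x.
  by exists 1 => A1; apply: A0; exists 1.
split=> [A B LA LB|M lM LM].
  apply: contrapT => AB; have /symm : L (~` A) by apply: mono LB => x Bx Ax; apply: AB; exists x.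
  exact.
apply/seteqP; split=> // A MA; apply: contrapT => /symm /LM MCA.
by have [x []] := lM _ _ MA MCA.
Qed.

(** The equivariant map on subsets represented by [L]; products of systems correspond to
    compositions of these maps. *)
Definition hull L S : set X := [set x | L (left_shift x^-1 S)].

Lemma double_power_mulE L M S : (L * M) S = L (hull M S).
Proof. by []. Qed.

Lemma hull_shift L x S : hull L (left_shift x S) = left_shift x (hull L S).
Proof.
apply/funext => y; rewrite left_shiftE /hull /= left_shiftM.
by rewrite invgM invgK.
Qed.

Lemma hullC L S : superextension X L -> hull L (~` S) = ~` hull L S.
Proof.
move=> /superextensionP [_ symm]; apply/funext => x.
by rewrite /hull /= left_shiftC; apply/propext; exact: symm.
Qed.

Lemma hullS L A B : superextension X L -> A `<=` B -> hull L A `<=` hull L B.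
Proof.
move=> /superextensionP [mono _] AB x; apply: mono.
exact: left_shiftS.
Qed.

Lemma superextensionM L M : superextension X L -> superextension X M ->
  superextension X (L * M).
Proof.
move=> sL sM; have /superextensionP [mL cL] := sL.
apply/superextensionP; split=> [A B AB|A]; rewrite !double_power_mulE.
  by apply: mL; exact: hullS.
by rewrite hullC.
Qed.

Lemma superextension_setT L : superextension X L -> L setT.
Proof.
move=> /superextensionP [mL cL]; apply: contrapT => /cL.
by move=> LC; have /cL := LC; apply; exact: mL LC.
Qed.

Lemma superextension_set0 L : superextension X L -> ~ L set0.
Proof.
move=> sL; have /superextensionP [_ cL] := sL.
by rewrite -setCT => /cL; apply; exact: superextension_setT.
Qed.
End Superextension.

(** * Twin sets *)

Lemma twinic_ideal_twinic (X : groupType) : is_twinic X -> is_twinic_ideal (twinic_ideal X).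
Proof.
move=> [I0 I0t]; split.
- split; first by exists set0 => I [[[A IA] _ IS _] _ _]; apply: IS IA _.
  + move=> A B IA IB I It; have [[_ IU _ _] _ _] := It.
    by apply: IU; [exact: IA|exact: IB].
  + by move=> A B IA BA I It; have [[_ _ IS _] _ _] := It; apply: IS BA; exact: IA.
  + by move=> /(_ _ I0t); have [[_ _ _]] := I0t.
- by move=> A x IA I It; have [_ + _] := It; apply; exact: IA.
move=> A x y xA Ay; split=> I It; have [_ _ tw] := It;
  by have [] := tw A x y (xA I It) (Ay I It).
Qed.

Section Twins.
Context {X : groupType} (I : set (set X)).
Hypothesis It : is_twinic_ideal I.
Implicit Types (A B K : set X) (x y : X).

Let IU A B : I A -> I B -> I (A `|` B).
Proof. by have [[_ + _ _] _ _] := It; exact. Qed.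

Let IS A B : I A -> B `<=` A -> I B.
Proof. by have [[_ _ + _] _ _] := It; exact. Qed.

Let I0 : I set0.
Proof. by have [[[A IA] _ IS' _] _ _] := It; apply: IS' IA _. Qed.

Let IL A x : I A -> I (left_shift x A).
Proof. by have [_ + _] := It; exact. Qed.

Lemma subset_mod_sub A B : A `<=` B -> subset_mod I A B.
Proof. by move=> AB; rewrite /subset_mod (_ : A `\` B = set0)//; apply/seteqP; split=> // x [/AB]. Qed.

Lemma subset_mod_trans A B C : subset_mod I A B -> subset_mod I B C -> subset_mod I A C.
Proof.
move=> AB BC; apply: IS (IU AB BC) _ => x [Ax Cx].
by have [Bx|Bx] := pselect (B x); [right|left].
Qed.

Lemma subset_mod_shift x A B : subset_mod I A B -> subset_mod I (left_shift x A) (left_shift x B).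
Proof.
move=> /(@IL _ x); rewrite /subset_mod; congr I; apply/funext => y.
by rewrite left_shiftE /setD /= !left_shiftE.
Qed.

Lemma subset_modC A B : subset_mod I A B -> subset_mod I (~` B) (~` A).
Proof.
by rewrite /subset_mod; congr I; apply/seteqP; split=> x [] /=; [move=> ? ?; split=> // /[apply]|move=> ? /contrapT].
Qed.

Lemma eq_mod_refl A : eq_mod I A A.
Proof. by split; exact: subset_mod_sub. Qed.

Lemma eq_mod_sym A B : eq_mod I A B -> eq_mod I B A.
Proof. by case. Qed.

Lemma eq_mod_trans A B C : eq_mod I A B -> eq_mod I B C -> eq_mod I A C.
Proof. by move=> [? ?] [? ?]; split; apply: subset_mod_trans; eassumption. Qed.

Lemma eq_mod_shift x A B : eq_mod I A B -> eq_mod I (left_shift x A) (left_shift x B).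
Proof. by case; split; exact: subset_mod_shift. Qed.

Lemma eq_modC A B : eq_mod I A B -> eq_mod I (~` A) (~` B).
Proof. by case; split; exact: subset_modC. Qed.

Definition twin A := exists x, eq_mod I (left_shift x A) (~` A).

Definition twin_cogroup A : set X := [set x | eq_mod I (left_shift x A) (~` A)].

(** Modulo [I], [yB = ~B] is contained in [~A = xA], and this in [xB]; twinicity gives [xB = yB],
    and the inclusions in between collapse. *)
Lemma twin_subset_eq_mod A B : twin A -> twin B -> A `<=` B -> eq_mod I A B.
Proof.
have [_ _ tw] := It.
move=> [x xA] [y yB] AB.
have xAB : left_shift x A `<=` left_shift x B := left_shiftS AB.
have h1 : subset_mod I (~` B) (left_shift x B).
  apply: (@subset_mod_trans _ (~` A)); first by apply: subset_mod_sub; exact: subsetC.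
  by apply: (@subset_mod_trans _ (left_shift x A)); [exact: xA.2|exact: subset_mod_sub].
have yx := tw B y x yB.1 h1.
have h2 : subset_mod I (left_shift x B) (left_shift x A).
  apply: (subset_mod_trans yx.2); apply: (subset_mod_trans yB.1).
  apply: (@subset_mod_trans _ (~` A)); first by apply: subset_mod_sub; exact: subsetC.
  exact: xA.2.
split; first exact: subset_mod_sub.
by have := subset_mod_shift x^-1 h2; rewrite !left_shiftK.
Qed.

Lemma twin_cogroup_eq_mod A B : eq_mod I A B -> twin_cogroup A = twin_cogroup B.
Proof.
have main A' B' : eq_mod I A' B' -> twin_cogroup A' `<=` twin_cogroup B'.
  move=> AB x xA; apply: (eq_mod_trans (eq_mod_shift x (eq_mod_sym AB))).
  by apply: (eq_mod_trans xA); exact: eq_modC.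
by move=> AB; apply/seteqP; split; apply: main => //; exact: eq_mod_sym.
Qed.

Lemma twin_cogroup_shift x A : twin_cogroup (left_shift x A) = conjugate x (twin_cogroup A).
Proof.
apply/funext => y; rewrite conjugateE; apply/propext; split.
  move=> /(eq_mod_shift x^-1); rewrite -left_shiftC left_shiftK !left_shiftM.
  by [].
by move=> /(eq_mod_shift x); rewrite !left_shiftC -!left_shiftM left_shiftVK.
Qed.

Lemma eq_mod_fixP A x y : twin_cogroup A y ->
  eq_mod I (left_shift x A) A <-> twin_cogroup A (x * y).
Proof.
move=> yA; split=> [/eq_modC|] H; rewrite /twin_cogroup /= -?left_shiftM.
  apply: eq_mod_trans H; rewrite -left_shiftC; exact: eq_mod_shift.
have /eq_modC := H; rewrite setCK /twin_cogroup /= -left_shiftM -left_shiftC.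
by apply: eq_mod_trans; apply: eq_mod_shift; have := eq_modC yA; rewrite setCK => /eq_mod_sym.
Qed.

Lemma twin_not_eq A : ~ eq_mod I A (~` A).
Proof.
have [[_ _ _ IT] _ _] := It; move=> [h1 h2]; apply: IT.
apply: IS (IU h1 h2) _ => x _; have [Ax|Ax] := pselect (A x); [by left; split=> // /(_ Ax)|by right].
Qed.

Lemma twin_cogroupP A : twin A -> is_2cogroup (twin_cogroup A).
Proof.
move=> tA; apply/cogroupP; split=> //.
- move=> a b c Ka Kb Kc; apply/(eq_mod_fixP _ Kc); rewrite -left_shiftM.
  apply: eq_mod_trans (eq_mod_shift a Kb) _; rewrite left_shiftC.
  by have := eq_modC Ka; rewrite setCK.
- move=> a Ka; have := eq_modC (eq_mod_shift a^-1 Ka).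
  by rewrite left_shiftK left_shiftC setCK => /eq_mod_sym.
move=> a b Ka Kb /(eq_mod_fixP _ Kb) aA; apply: (@twin_not_eq A).
exact: eq_mod_trans (eq_mod_sym aA) Ka.
Qed.

Lemma eq_mod_fix_square A x : twin A ->
  eq_mod I (left_shift x A) A <-> square (twin_cogroup A) x.
Proof.
move=> tA; have cK := twin_cogroupP tA; have [y Ky] := tA.
by rewrite (eq_mod_fixP _ Ky); exact: cogroupMr.
Qed.

Definition twins_of K : set (set X) := [set A | forall x, K x -> left_shift x A = ~` A].

Lemma twins_of_cogroup K A : maximal_2cogroups X K -> twins_of K A ->
  twin A /\ twin_cogroup A = K.
Proof.
move=> [cK maxK] KA.
have sub : K `<=` twin_cogroup A by move=> x /KA xA; rewrite /twin_cogroup /= xA; exact: eq_mod_refl.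
have tA : twin A by have [k /sub] := cK.1; exists k.
by split=> //; apply: maxK => //; exact: twin_cogroupP.
Qed.

Definition linked_mod (F : set (set X)) := (forall A B, F A -> F B -> ~ I (A `&` B)) /\
  (forall A x, F A -> F (left_shift x A)).

Lemma maximal_linked_mod : exists F, [/\ linked_mod F,
  forall A, [\/ F A, F (~` A) | twin A],
  forall A, F A -> ~ F (~` A) &
  (forall A, F A -> ~ twin A) /\ (forall A B, F A -> A `<=` B -> F B)].
Proof.
have [_ _ tw] := It.
have [F FP tot|F [[Fl Fi] maxF]] := @Zorn_bigcup _ linked_mod.
  split=> [A B [Y FY YA] [Z FZ ZB]|A x [Y FY YA]].
    case: (tot Y Z FY FZ) => YZ.
      by have [+ _] := FP _ FZ; apply=> //; exact: YZ.
    by have [+ _] := FP _ FY; apply=> //; exact: YZ.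
  by exists Y => //; have [_] := FP _ FY; apply.
have dich A : ~ F A -> (exists x, I (left_shift x A `&` A)) \/ (exists2 B, F B & I (A `&` B)).
  move=> nFA; apply: contrapT => /not_orP [no1 no2].
  apply: (maxF (F `|` [set left_shift x A | x in setT])).
    split; first by move=> B; left.
    by move=> sub; apply: nFA; apply: sub; right; exists 1 => //; rewrite left_shift1.
  have no1' x y : ~ I (left_shift x A `&` left_shift y A).
    move=> /(@IL _ y^-1); rewrite left_shiftI left_shiftK left_shiftM => h.
    by apply: no1; exists (y^-1 * x).
  have no2' x B : F B -> ~ I (left_shift x A `&` B).
    move=> FB /(@IL _ x^-1); rewrite left_shiftI left_shiftK => h.
    by apply: no2; exists (left_shift x^-1 B) => //; exact: Fi.
  split=> [B C [FB|[x _ <-]] [FC|[y _ <-]]|B x [FB|[y _ <-]]].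
  - exact: Fl.
  - by rewrite setIC; exact: no2'.
  - exact: no2'.
  - exact: no1'.
  - by left; exact: Fi.
  - by right; exists (x * y) => //; rewrite left_shiftM.
have up A B : F A -> A `<=` B -> F B.
  move=> FA AB; apply: contrapT => /dich [[x xB]|[C FC BC]].
    apply: (Fl (left_shift x A) A) => //; first exact: Fi.
    by apply: IS xB _ => y [xA Ay]; split; [exact: (left_shiftS AB)|exact: AB].
  by apply: (Fl A C) => //; apply: IS BC _ => y [/AB].
have excl A : F A -> ~ F (~` A) by move=> FA /(Fl _ _ FA); rewrite setICr.
have comp A B : F B -> I (A `&` B) -> F (~` A).
  move=> FB AB; apply: contrapT => /dich [[x xA]|[C FC AC]].
    apply: (Fl (left_shift x B) B) => //; first exact: Fi.
    have xAB := IL x AB; rewrite left_shiftI in xAB.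
    apply: IS (IU xA (IU AB xAB)) _ => y [xB yB].
    have [Ay|Ay] := pselect (A y); first by right; left.
    have [xAy|xAy] := pselect (left_shift x A y); first by right; right.
    by left; split=> //; rewrite left_shiftC.
  apply: (Fl B C) => //; apply: IS (IU AB AC) _ => y [By Cy].
  by have [Ay|Ay] := pselect (A y); [left|right].
exists F; split=> //; last first.
  split=> // A FA [x [xA _]].
  apply: (Fl (left_shift x A) A) => //; first exact: Fi.
  by apply: IS xA _ => y [xAy Ay]; split.
move=> A; have [FA|/dich] := pselect (F A); first by constructor.
case=> [[x xA]|[B FB AB]]; last by constructor 2; exact: comp AB.
have [FA|/dich] := pselect (F (~` A)); first by constructor.
case=> [[y yA]|[B FB AB]]; last by constructor 1; have := comp _ _ FB AB; rewrite setCK.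
constructor 3; have h1 : subset_mod I (left_shift x A) (~` A).
  by apply: IS xA _ => z [xAz /contrapT].
have h2 : subset_mod I (~` A) (left_shift y A).
  by apply: IS yA _ => z [Az yAz]; split=> //; rewrite left_shiftC.
have [xy yx] := tw A x y h1 h2.
by exists x; split=> //; exact: subset_mod_trans yx.
Qed.
End Twins.

Section CosetRepresentatives.
Context {X : groupType} (K : set X).
Hypothesis cK : is_2cogroup K.

Definition plus_minus : set X := K `|` square K.

Lemma plus_minus1 : plus_minus 1.
Proof. by right; exact: square1. Qed.

Lemma plus_minusM x y : plus_minus x -> plus_minus y -> plus_minus (x * y).
Proof.
move=> [Kx|sx] [Ky|sy]; [right|left|left|right].
- exact: cogroup_square.
- exact: cogroup_squareM.
- exact: square_cogroupM.
- exact: squareM.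
Qed.

Lemma plus_minusV x : plus_minus x -> plus_minus x^-1.
Proof. by move=> [Kx|sx]; [left; exact: cogroupV|right; exact: squareV]. Qed.

Lemma plus_minus_stab x : plus_minus x -> stab K x.
Proof. by move=> [Kx|sx]; [exact: cogroup_stab|exact: square_stab]. Qed.

Definition coset_rep (x : X) : X := xget 1 [set y | plus_minus (y * x^-1)].

Lemma coset_repP x : plus_minus (coset_rep x * x^-1).
Proof.
apply: (@xgetPex _ 1 [set y | plus_minus (y * x^-1)]).
by exists x; rewrite /= mulgV; exact: plus_minus1.
Qed.

Lemma coset_repP' x : plus_minus (x * (coset_rep x)^-1).
Proof. by have := plus_minusV (coset_repP x); rewrite invgM invgK. Qed.

Lemma coset_rep_eq x y : plus_minus (x * y^-1) -> coset_rep x = coset_rep y.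
Proof.
move=> xy; rewrite /coset_rep; congr xget; apply/funext => u /=; apply/propext.
split=> h.
  by have := plus_minusM h xy; rewrite mulgA mulgVK.
by have := plus_minusM h (plus_minusV xy); rewrite invgM invgK mulgA mulgVK.
Qed.

Lemma coset_repK x : coset_rep (coset_rep x) = coset_rep x.
Proof. by apply: coset_rep_eq; exact: coset_repP. Qed.

(* The elements of [twins_of K] are obtained by picking one of the two halves
   of each coset of [plus_minus]. *)
Definition twin_of_choice (c : X -> Prop) : set X :=
  [set y | if `[< c (coset_rep y) >] then square K (y * (coset_rep y)^-1)
           else K (y * (coset_rep y)^-1)].

Lemma twin_of_choiceP c : twins_of K (twin_of_choice c).
Proof.
move=> x Kx; apply/funext => y; rewrite left_shiftE /setC /twin_of_choice /=.
have -> : coset_rep (x^-1 * y) = coset_rep y.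
  by apply: coset_rep_eq; rewrite mulgK; left; exact: cogroupV.
have w := coset_repP' y; set u := y * _ in w.
have -> : x^-1 * y * (coset_rep y)^-1 = x^-1 * u by rewrite mulgA.
have KV := cogroupV cK Kx.
apply/propext; case: asboolP => _.
  split; last first.
    by case: w => // Ku _; exact: cogroup_square.
  move=> sxu su; apply: (square_disjoint cK KV).
  by apply/(squareMsr cK x^-1 su).
split; last first.
  by case: w => // su _; exact: cogroup_squareM.
move=> sxu Ku; apply: (square_disjoint cK KV).
by apply/(cogroupMr cK x^-1 Ku).
Qed.

Lemma twin_square_shift A x y : twins_of K A -> square K x -> A (x * y) <-> A y.
Proof.
move=> KA /squareP [a [b [Ka Kb ->]]].
have aA u k : K k -> A (k * u) <-> ~ A u.
  move=> Kk; have <- : left_shift k^-1 A u = A (k * u) by rewrite left_shiftE invgK.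
  by rewrite (KA _ (cogroupV cK Kk)).
by rewrite -mulgA aA // aA //; split=> [/contrapT|Ay /(_ Ay)].
Qed.

Lemma twin_cogroup_shiftN A x y : twins_of K A -> K x -> A (x * y) <-> ~ A y.
Proof.
move=> KA Kk; have <- : left_shift x^-1 A y = A (x * y) by rewrite left_shiftE invgK.
by rewrite (KA _ (cogroupV cK Kk)).
Qed.

Lemma twins_of_eq_at A B x : twins_of K A -> twins_of K B ->
  (A (coset_rep x) <-> B (coset_rep x)) -> (A x <-> B x).
Proof.
move=> KA KB rAB.
have -> : x = x * (coset_rep x)^-1 * coset_rep x by rewrite mulgVK.
case: (coset_repP' x) => h.
  have hA := twin_cogroup_shiftN (coset_rep x) KA h.
  have hB := twin_cogroup_shiftN (coset_rep x) KB h.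
  tauto.
have hA := twin_square_shift (coset_rep x) KA h.
have hB := twin_square_shift (coset_rep x) KB h.
tauto.
Qed.

Lemma twin_of_choice_rep c x : twin_of_choice c (coset_rep x) <-> c (coset_rep x).
Proof.
rewrite /twin_of_choice /= coset_repK mulgV; case: asboolP => h.
  by split=> // _; exact: square1.
by split=> // K1; case: (square_disjoint cK K1 (square1 cK)).
Qed.

Lemma twins_of_shift A x : stab K x -> twins_of K A -> twins_of K (left_shift x A).
Proof.
move=> sx KA k Kk; rewrite left_shiftM -left_shiftC.
have -> : k * x = x * (x^-1 * k * x^-1^-1) by rewrite invgK !mulgA mulgV mul1g.
rewrite -left_shiftM KA //; apply/stab_conj => //; exact: stabV.
Qed.

Lemma twins_of_square A x : twins_of K A -> square K x -> left_shift x A = A.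
Proof.
move=> KA sx; apply/funext => y; rewrite left_shiftE; apply/propext.
by apply: twin_square_shift => //; exact: squareV.
Qed.

(** The characteristic group acts freely: the shifts sending [A] to its complement form a 2-cogroup
    containing [K], hence equal to [K]; a shift fixing [A], times an element of [K], is one of
    them. *)
Lemma twins_of_fix A x : twins_of K A -> left_shift x A = A -> maximal_2cogroups X K ->
  square K x.
Proof.
move=> KA xA mK; have [k Kk] := cK.1.
pose K' := [set y | left_shift y A = ~` A].
have cK' : is_2cogroup K'.
  apply/cogroupP; split; first by exists k; exact: KA.
  - move=> a b c Ka Kb Kc; rewrite /K' /= -!left_shiftM Kc left_shiftC Kb setCK.
    exact: Ka.
  - by move=> a Ka; rewrite /K' /= -[X in left_shift _ X]setCK -Ka left_shiftC left_shiftK.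
  move=> a b Ka Kb; rewrite /K' /= -left_shiftM Kb left_shiftC Ka setCK => AA.
  have AE : A 1 = ~ A 1 by rewrite {1}AA.
  have nA : ~ A 1 by move=> A1; have := A1; rewrite AE; apply.
  by apply: (nA); rewrite AE.
have [_ /(_ K' cK' KA) K'E] := mK.
apply/(cogroupMr cK x Kk); rewrite -K'E /K' /= -left_shiftM (KA _ Kk) left_shiftC.
by rewrite xA.
Qed.
End CosetRepresentatives.

(** * Maximal linked systems determined by codes *)

Section Codes.
Context {X : groupType} (I : set (set X)).
Hypothesis It : is_twinic_ideal I.
Context {J : Type} (K : J -> set X).
Hypothesis Kmax : forall j, maximal_2cogroups X (K j).
Hypothesis Krep : forall K', maximal_2cogroups X K' ->
  exists j x, K' = conjugate x (K j).
Hypothesis Kinj : forall i j x, K i = conjugate x (K j) -> i = j.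

Let cK j : is_2cogroup (K j). Proof. exact: (Kmax j).1. Qed.

(* A pair [(j, B)] of a code is sent to a prescribed twin set with 2-cogroup
   [K j]; the second condition makes the equivariant, [I]-invariant extension
   of this assignment well-defined. *)
Definition is_code (R : set (J * set X)) :=
  (forall j B, R (j, B) -> twin I B /\ twin_cogroup I B `<=` K j) /\
  (forall j B j' B' x, R (j, B) -> R (j', B') ->
     eq_mod I (left_shift x B) B' -> j = j' /\ square (K j) x).

(** Zorn's lemma. A twin set not yet reached is shifted so that its 2-cogroup lies in some [K j],
    possibly properly. The shifted set can be added, since the elements fixing it modulo [I] form
    the square of its own 2-cogroup. *)
Lemma code_extension R0 : is_code R0 -> exists R, [/\ R0 `<=` R, is_code R &
  forall A, twin I A -> exists j B x, R (j, B) /\ eq_mod I (left_shift x B) A].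
Proof.
move=> cR0; pose P R := is_code (R0 `|` R).
have [F FP tot|M [PM maxM]] := @Zorn_bigcup _ P.
  have inF p q : (R0 `|` \bigcup_(Y in F) Y) p -> (R0 `|` \bigcup_(Y in F) Y) q ->
      exists R, [/\ is_code R, R p & R q].
    move=> [R0p|[Y FY Yp]] [R0q|[Z FZ Zq]].
    - by exists R0.
    - by exists (R0 `|` Z); split; [exact: FP|left|right].
    - by exists (R0 `|` Y); split; [exact: FP|right|left].
    case: (tot Y Z FY FZ) => YZ.
      by exists (R0 `|` Z); split; [exact: FP|right; exact: YZ|right].
    by exists (R0 `|` Y); split; [exact: FP|right|right; exact: YZ].
  split=> [j B Rj|j B j' B' x Rj Rj'].
    by have [R [[h _] Rp _]] := inF _ _ Rj Rj; exact: h.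
  by have [R [[_ h] Rp Rq]] := inF _ _ Rj Rj'; exact: h.
exists (R0 `|` M); split=> [p R0p||A tA]; [by left|exact: PM|].
apply: contrapT => nA.
have [K' K'max AK'] := subset_maximal_cogroup (twin_cogroupP It tA).
have [j [x K'E]] := Krep K'max.
pose B := left_shift x^-1 A.
have BA : left_shift x B = A by exact: left_shiftVK.
have tB : twin I B.
  have [y yA] := tA; exists (x^-1 * y * x); rewrite -left_shiftM BA -left_shiftM -left_shiftC.
  exact: eq_mod_shift.
have KB : twin_cogroup I B `<=` K j.
  by rewrite twin_cogroup_shift //; have := @conjugateS _ x^-1 _ _ AK'; rewrite K'E conjugateK.
have newB i C y : (R0 `|` M) (i, C) -> ~ eq_mod I (left_shift y C) B.
  move=> Ri yC; apply: nA; exists i, C, (x * y); split=> //.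
  by rewrite -left_shiftM -BA; exact: eq_mod_shift.
have newB' i C y : (R0 `|` M) (i, C) -> ~ eq_mod I (left_shift y B) C.
  move=> Ri yC; apply: (newB i C y^-1) => //.
  by apply: eq_mod_sym; have := eq_mod_shift It y^-1 yC; rewrite left_shiftK.
apply: (maxM (M `|` [set (j, B)])).
  split; first by move=> p; left.
  move=> sub; apply: (newB j B 1); last by rewrite left_shift1; exact: eq_mod_refl.
  by right; apply: sub; right.
have [PM1 PM2] := PM.
rewrite /P setUA; split=> [i C [Ri|[-> ->]]|i C i' C' y [Ri|[-> ->]] [Ri'|[-> ->]] yC] //.
- exact: PM1.
- exact: PM2 yC.
- by case: (newB _ _ _ Ri yC).
- by case: (newB' _ _ _ Ri' yC).
split=> //; have /(eq_mod_fix_square It _ tB) := yC.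
move=> /squareP [a [b [Ka Kb ->]]]; apply/squareP; exists a, b.
by split=> //; exact: KB.
Qed.

Variable F : set (set X).
Hypothesis Flinked : linked_mod I F.
Hypothesis Ftri : forall A, [\/ F A, F (~` A) | twin I A].
Hypothesis Fexcl : forall A, F A -> ~ F (~` A).
Hypothesis Ftwin : forall A, F A -> ~ twin I A.
Hypothesis Fup : forall A B, F A -> A `<=` B -> F B.

Variable R : set (J * set X).
Hypothesis Rcode : is_code R.
Hypothesis Rtot : forall A, twin I A ->
  exists j B x, R (j, B) /\ eq_mod I (left_shift x B) A.

Definition family (C : J -> set X) := forall j, twins_of (K j) (C j).

(** The prescribed equivariant map sends [B] to [C j], hence [A = xB] to [x C j]; [A] is a member
    when 1 lies in [x C j], that is, [x^-1] lies in [C j]. *)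
Definition system (C : J -> set X) : double_power X :=
  [set A | F A \/ exists j B x, [/\ R (j, B), eq_mod I (left_shift x B) A & C j x^-1]].

Lemma twinC A : twin I A -> twin I (~` A).
Proof.
by move=> [x xA]; exists x; rewrite left_shiftC; exact: eq_modC.
Qed.

Lemma twin_shift A x : twin I A -> twin I (left_shift x A).
Proof.
move=> [y yA]; exists (x * y * x^-1); rewrite -left_shiftM left_shiftK -left_shiftM -left_shiftC.
exact: eq_mod_shift.
Qed.

Lemma twin_of_code j B x A : R (j, B) -> eq_mod I (left_shift x B) A -> twin I A.
Proof.
move=> RB xB; have [tB _] := Rcode.1 j B RB.
have [y yB] := twin_shift x tB; exists y; apply: (eq_mod_trans It (eq_mod_shift It y (eq_mod_sym xB))).
by apply: (eq_mod_trans It yB); exact: eq_modC.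
Qed.

Lemma system_not_twin C A : ~ twin I A -> system C A <-> F A.
Proof.
move=> ntA; split=> [[//|[j [B [x [RB xB _]]]]]|]; last by left.
by case: ntA; exact: twin_of_code RB xB.
Qed.

(** Two codes of the same set differ by an element of the square of [K j], which leaves [C j]
    invariant. *)
Lemma system_code C j B x A : family C -> R (j, B) -> eq_mod I (left_shift x B) A ->
  system C A <-> C j x^-1.
Proof.
move=> fC RB xB; have tA := twin_of_code RB xB.
split=> [[/Ftwin//|[j' [B' [x' [RB' xB' Cx']]]]]|Cx]; last by right; exists j, B, x.
have e : eq_mod I (left_shift (x^-1 * x') B') B.
  rewrite -left_shiftM -[B](left_shiftK x); apply: eq_mod_shift => //.
  exact: eq_mod_trans xB' (eq_mod_sym xB).
have [jj' s] := Rcode.2 _ _ _ _ _ RB' RB e.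
subst j'; apply/(twin_square_shift (cK j) x^-1 (fC j) (squareV (cK j) s)).
by rewrite invgM invgK mulgK.
Qed.

(** Nested twin sets are equal modulo [I] and so share a code; passing to the complement multiplies
    the code by an element of [K j], which complements [C j]. *)
Lemma system_superextension C : family C -> superextension X (system C).
Proof.
move=> fC; apply/superextensionP.
have code A : twin I A -> exists j B x, [/\ R (j, B), eq_mod I (left_shift x B) A & system C A <-> C j x^-1].
  move=> tA; have [j [B [x [RB xB]]]] := Rtot tA; exists j, B, x; split=> //.
  exact: (system_code fC RB xB).
split=> [A B AB CA|A].
  have [tB|ntB] := pselect (twin I B); last first.
    case: (Ftri B) => [FB|FB|//]; first by left.
    case: CA => [FA|[j [D [x [RD xD _]]]]]; first by left; exact: Fup AB.
    (* [~B] in [F] would put the larger twin set [~A] into [F]. *)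
    exfalso; have tA := twin_of_code RD xD.
    by apply: (Ftwin _ (twinC tA)); apply: Fup FB _; exact: subsetC.
  case: CA => [FA|[j [D [x [RD xD Cx]]]]]; first by left; exact: Fup AB.
  have tA := twin_of_code RD xD.
  apply/(system_code fC RD _); last exact: Cx.
  exact: eq_mod_trans xD (twin_subset_eq_mod It tA tB AB).
have [tA|ntA] := pselect (twin I A); last first.
  have ntAC : ~ twin I (~` A) by move=> /twinC; rewrite setCK.
  rewrite !system_not_twin //; split=> [FA /Fexcl//|nA].
  by case: (Ftri A).
have [j [B [x [RB xB CA]]]] := code A tA.
have [[y yB] KB] := Rcode.1 _ _ RB.
have xyB : eq_mod I (left_shift (x * y) B) (~` A).
  rewrite -left_shiftM; apply: (eq_mod_trans It (eq_mod_shift It x yB)).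
  by rewrite left_shiftC; exact: eq_modC.
rewrite (system_code fC RB xyB) CA invgM.
by apply: twin_cogroup_shiftN => //; apply: cogroupV => //; exact: KB.
Qed.

(** Membership of one set depends on at most one point of one [C j]; the continuity of the inverse
    isomorphisms rests on this. *)
Lemma system_coordinate A :
  (exists j y, forall C, family C -> system C A <-> C j y) \/
  (exists P : Prop, forall C, system C A <-> P).
Proof.
have [tA|ntA] := pselect (twin I A); last by right; exists (F A) => C; exact: system_not_twin.
left; have [j [B [x [RB xB]]]] := Rtot tA; exists j, x^-1 => C fC.
exact: system_code RB xB.
Qed.

Lemma hull_system C j B x A : family C -> R (j, B) -> eq_mod I (left_shift x B) A ->
  hull (system C) A = left_shift x (C j).
Proof.
move=> fC RB xB; apply/funext => y; rewrite left_shiftE /hull /=; apply/propext.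
have -> : x^-1 * y = (y^-1 * x)^-1 by rewrite invgM invgK.
have xyB : eq_mod I (left_shift (y^-1 * x) B) (left_shift y^-1 A).
  by rewrite -left_shiftM; exact: eq_mod_shift.
exact: (system_code fC RB xyB).
Qed.

Lemma hull_twins L j A : superextension X L -> twins_of (K j) A ->
  twins_of (K j) (hull L A).
Proof.
by move=> sL KA x Kx; rewrite -hull_shift KA // hullC.
Qed.

Lemma family_hull L C : superextension X L -> family C -> family (fun j => hull L (C j)).
Proof. by move=> sL fC j; exact: hull_twins. Qed.

(** On twin sets the map of [system C] takes values [x C j], to which [hull L] is applied. Elsewhere
    its values are [setT] and [set0], as [F] is shift-invariant, and every maximal linked system
    decides these alike. *)
Lemma mul_system L C : superextension X L -> family C ->
  L * system C = system (fun j => hull L (C j)).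
Proof.
move=> sL fC; apply/funext => A; rewrite double_power_mulE; apply/propext.
have [tA|ntA] := pselect (twin I A).
  have [j [B [x [RB xB]]]] := Rtot tA.
  rewrite (hull_system fC RB xB) (system_code (family_hull sL fC) RB xB).
  by rewrite /hull /= invgK.
have ntx x : ~ twin I (left_shift x A).
  by move=> /(twin_shift x^-1); rewrite left_shiftK.
have Fx x : F (left_shift x A) <-> F A.
  split=> [/(Flinked.2 _ x^-1)|/Flinked.2]; last exact.
  by rewrite left_shiftK.
rewrite [in X in _ <-> X]system_not_twin //; split=> [LA|FA]; last first.
  rewrite (_ : hull _ A = setT); first exact: superextension_setT.
  by apply/seteqP; split=> // x _; apply/(system_not_twin _ (ntx _))/Fx.
apply: contrapT => nFA; apply: (superextension_set0 sL).
rewrite (_ : set0 = hull (system C) A) //.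
by apply/esym/seteqP; split=> // x /(system_not_twin _ (ntx _)) /Fx.
Qed.

(** An inclusion of [K j] in a conjugate of [K i] is an equality by maximality, and then the indices
    agree; so the shift involved stabilizes [K j]. *)
Lemma twins_of_code j D : twins_of (K j) D ->
  exists B x, [/\ R (j, B), stab (K j) x & eq_mod I (left_shift x B) D].
Proof.
move=> KD; have [tD DE] := twins_of_cogroup It (Kmax j) KD.
have [i [B [x [RB xB]]]] := Rtot tD.
have [tB KB] := Rcode.1 _ _ RB.
have Kj : conjugate x (twin_cogroup I B) = K j.
  by rewrite -twin_cogroup_shift // (twin_cogroup_eq_mod It xB).
have sub : K j `<=` conjugate x (K i) by rewrite -Kj; exact: conjugateS.
have KE : conjugate x (K i) = K j.
  by have [_ maxj] := Kmax j; apply: maxj => //; exact: conjugate_cogroup.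
have ij : j = i by apply: (Kinj (x := x)).
by subst i; exists B, x.
Qed.

(** Determined modulo the square of [K j]; its class is the position of [D] in the characteristic
    group relative to the chosen codes. *)
Definition code_of j (D : set X) : X :=
  xget 1 [set x | exists B, [/\ R (j, B), stab (K j) x & eq_mod I (left_shift x B) D]].

Lemma code_ofP j D : twins_of (K j) D ->
  exists B, [/\ R (j, B), stab (K j) (code_of j D) & eq_mod I (left_shift (code_of j D) B) D].
Proof.
move=> /twins_of_code [B [x H]].
apply: (@xgetPex _ 1 [set x | exists B, [/\ R (j, B), stab (K j) x & eq_mod I (left_shift x B) D]]).
by exists x, B.
Qed.

Lemma code_of_stab j D : twins_of (K j) D -> stab (K j) (code_of j D).
Proof. by move=> /code_ofP [B []]. Qed.

Lemma code_of_unique j D B x : twins_of (K j) D -> R (j, B) ->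
  eq_mod I (left_shift x B) D -> square (K j) ((code_of j D)^-1 * x).
Proof.
move=> KD RB xB; have [B' [RB' _ xB']] := code_ofP KD.
have e : eq_mod I (left_shift ((code_of j D)^-1 * x) B) B'.
  rewrite -left_shiftM -[B'](left_shiftK (code_of j D)); apply: eq_mod_shift => //.
  exact: eq_mod_trans xB (eq_mod_sym xB').
by have [_ s] := Rcode.2 _ _ _ _ _ RB RB' e.
Qed.

Lemma code_of_shift j D x : stab (K j) x -> twins_of (K j) D ->
  square (K j) ((code_of j (left_shift x D))^-1 * (x * code_of j D)).
Proof.
move=> sx KD; have [B [RB _ xB]] := code_ofP KD.
apply: (code_of_unique (B := B)) => //; first exact: twins_of_shift.
by rewrite -left_shiftM; exact: eq_mod_shift.
Qed.

Lemma hull_system_twins C j D : family C -> twins_of (K j) D ->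
  hull (system C) D = left_shift (code_of j D) (C j).
Proof. by move=> fC /code_ofP [B [RB _ xB]]; exact: hull_system xB. Qed.

(** The right factor acts on each coordinate of the left one by a shift; this is the source of the
    left zero multiplication on orbits. *)
Lemma system_mul C D : family C -> family D ->
  system C * system D = system (fun j => left_shift (code_of j (D j)) (C j)).
Proof.
move=> fC fD; rewrite mul_system //; last exact: system_superextension.
by congr system; apply/funext => j; exact: hull_system_twins.
Qed.

(* A reference family with trivial codes yields an idempotent. *)
Variable E : J -> set X.
Hypothesis Efam : family E.
Hypothesis ER : forall j, R (j, E j).

Lemma code_of_ref j : square (K j) (code_of j (E j)).
Proof.
have /(squareV (cK j)) : square (K j) ((code_of j (E j))^-1 * 1).
  by apply: (code_of_unique (B := E j)) => //; rewrite left_shift1; exact: eq_mod_refl.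
by rewrite invgM invgK invg1 mul1g.
Qed.

Lemma hull_system_ref C j : family C -> hull (system C) (E j) = C j.
Proof.
move=> fC; rewrite (hull_system_twins fC (@Efam j)); apply: (twins_of_square (cK j) (fC j)).
exact: code_of_ref.
Qed.

Lemma system_inj C D : family C -> family D -> system C = system D -> C = D.
Proof.
move=> fC fD CD; apply/funext => j.
by rewrite -(hull_system_ref j fC) CD hull_system_ref.
Qed.

Lemma system_mul_ref C : family C -> system C * system E = system C.
Proof.
move=> fC; rewrite system_mul //; congr system; apply/funext => j.
exact: (twins_of_square (cK j) (fC j) (code_of_ref j)).
Qed.

Lemma left_orbit_ref : left_orbit (superextension X) (system E) =
  [set system C | C in family].
Proof.
apply/seteqP; split=> [_ [L sL <-]|_ [C fC <-]].
  by exists (fun j => hull L (E j)); [exact: family_hull|rewrite mul_system].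
by exists (system C); [exact: system_superextension|exact: system_mul_ref].
Qed.

(** The coordinates of an idempotent are fixed by their own codes; freeness of the action makes
    these codes trivial. *)
Lemma code_of_idempotent C j : family C -> system C * system C = system C ->
  square (K j) (code_of j (C j)).
Proof.
move=> fC CC; apply: (twins_of_fix (cK j) (fC j) _ (Kmax j)).
have fCC : family (fun i => left_shift (code_of i (C i)) (C i)).
  by move=> i; apply: twins_of_shift => //; exact: code_of_stab.
have := CC; rewrite system_mul // => /(system_inj fCC fC) CE.
by have := congr1 (fun f : J -> set X => f j) CE.
Qed.

(** Left multiplication by [system C] turns any system of the left ideal into one made of shifts of
    [C], so the corner is a copy of the product of the characteristic groups. *)
Lemma corner_systemP C : family C -> system C * system C = system C ->
  forall L, corner (superextension X) (system C) L <->
  exists2 x : J -> X, (forall j, stab (K j) (x j)) &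
    L = system (fun j => left_shift (x j) (C j)).
Proof.
move=> fC CC L; split=> [[sL CL LC]|[x sx ->]].
  pose D j := hull L (C j); have fD : family D by exact: family_hull.
  have LD : L = system D by rewrite -LC mul_system.
  exists (fun j => code_of j (D j)); first by move=> j; exact: code_of_stab.
  by rewrite -{1}CL LD system_mul.
have fx : family (fun j => left_shift (x j) (C j)).
  by move=> j; exact: twins_of_shift.
have code1 j := code_of_idempotent j fC CC.
split; first exact: system_superextension.
  rewrite system_mul //; congr system; apply/funext => j.
  have s := code_of_shift (sx j) (fC j).
  set u := code_of _ _ in s *.
  have su : square (K j) (u^-1 * x j).
    by apply/(squareMsr (cK j) _ (code1 j)); rewrite -mulgA.
  by rewrite -[in RHS](mulVKg u (x j)) -left_shiftM (twins_of_square (cK j) (fC j) su).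
rewrite system_mul //; congr system; apply/funext => j.
by apply: (twins_of_square (cK j)) => //; exact: twins_of_shift.
Qed.

(** The corner consists of shifts of [E], and the product of the shifts by [y] and [y'] is the shift
    by [y' y]; inverse shifts are therefore inverse elements. *)
Lemma system_primitive : primitive_idempotent (superextension X) (system E).
Proof.
have EE : system E * system E = system E by exact: system_mul_ref.
split=> //; first exact: system_superextension.
move=> L /(corner_systemP Efam EE) [x sx ->].
have fx y : (forall j, stab (K j) (y j)) -> family (fun j => left_shift (y j) (E j)).
  by move=> sy j; exact: twins_of_shift.
have sV j : stab (K j) (x j)^-1 by exact: stabV.
exists (system (fun j => left_shift (x j)^-1 (E j))).
  by apply/(corner_systemP Efam EE); exists (fun j => (x j)^-1).
have mulxy y y' : (forall j, stab (K j) (y j)) -> (forall j, stab (K j) (y' j)) ->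
    (forall j, y' j * y j = 1) ->
    system (fun j => left_shift (y j) (E j)) * system (fun j => left_shift (y' j) (E j)) = system E.
  move=> sy sy' yy; rewrite system_mul; [|exact: fx|exact: fx].
  congr system; apply/funext => j.
  have s := code_of_shift (sy' j) (@Efam j); set u := code_of _ _ in s *.
  have su : square (K j) (u^-1 * y' j).
    by apply/(squareMsr (cK j) _ (code_of_ref j)); rewrite -mulgA.
  have yE : y j = (y' j)^-1 by rewrite -[LHS](mulKg (y' j)) yy mulg1.
  rewrite left_shiftM yE; apply: (twins_of_square (cK j) (@Efam j)).
  have -> : u * (y' j)^-1 = (y' j * (u^-1 * y' j) * (y' j)^-1)^-1.
    by rewrite [y' j * _]mulgA mulgK invgM invgK.
  by apply: squareV => //; apply/stab_square_conj.
split; apply: mulxy => // j; first exact: mulVg.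
exact: mulgV.
Qed.
End Codes.

(** * The characteristic group *)

Section SubgroupType.
Context {T : semigroupType} {S : set T} (SG : subgroup S).

(** The proof is an argument of the type so that the group structure, which depends on it, can be
    attached. *)
Definition subgroup_type of subgroup S : Type := set_type S.

HB.instance Definition _ := Choice.copy (subgroup_type SG) (set_type S).

Let SP (x : set_type S) : S (\val x). Proof. by have := valP x; rewrite inE. Qed.

Let mkS x (Sx : S x) : subgroup_type SG := exist _ x (mem_set Sx).

Definition subgroup_mul (x y : subgroup_type SG) : subgroup_type SG :=
  mkS (SG.1 _ _ (SP x) (SP y)).

Let one_ex : {e | S e /\ forall x, S x ->
    [/\ e * x = x, x * e = x & exists2 y, S y & x * y = e /\ y * x = e]}.
Proof. by apply: cid; have [_ [e Se eP]] := SG; exists e. Qed.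

Definition subgroup_one : subgroup_type SG := mkS (svalP one_ex).1.

Let inv_ex (x : subgroup_type SG) : {y | S y /\
  \val x * y = sval one_ex /\ y * \val x = sval one_ex}.
Proof.
by apply: cid; have [_ _ [y Sy xy]] := (svalP one_ex).2 _ (SP x); exists y.
Qed.

Definition subgroup_inv (x : subgroup_type SG) : subgroup_type SG :=
  mkS (svalP (inv_ex x)).1.

Fact subgroup_mulA : associative subgroup_mul.
Proof. by move=> x y z; apply: val_inj; exact: mulgA. Qed.

Fact subgroup_mul1 : left_id subgroup_one subgroup_mul.
Proof. by move=> x; apply: val_inj; have [] := (svalP one_ex).2 _ (SP x). Qed.

Fact subgroup_1mul : right_id subgroup_one subgroup_mul.
Proof. by move=> x; apply: val_inj; have [] := (svalP one_ex).2 _ (SP x). Qed.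

Fact subgroup_mulV : left_inverse subgroup_one subgroup_inv subgroup_mul.
Proof. by move=> x; apply: val_inj; have [_ []] := svalP (inv_ex x). Qed.

Fact subgroup_Vmul : right_inverse subgroup_one subgroup_inv subgroup_mul.
Proof. by move=> x; apply: val_inj; have [_ []] := svalP (inv_ex x). Qed.

HB.instance Definition _ := isGroup.Build (subgroup_type SG)
  subgroup_mulA subgroup_mul1 subgroup_1mul subgroup_mulV subgroup_Vmul.

Lemma subgroup_group : exists (G : groupType) (iota : G -> T),
  [/\ {morph iota : x y / x * y}, injective iota & range iota = S].
Proof.
exists (subgroup_type SG), (fun x => \val x); split=> //.
by apply/seteqP; split=> [_ [x _ <-]|x Sx]; [exact: SP|exists (mkS Sx)].
Qed.
End SubgroupType.

Section CharacteristicGroup.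
Context {X : groupType}.
Implicit Types (K N : set X) (x y : X).

Definition square_coset K x : power X := left_shift x (square K).

Lemma square_coset_eq K x y : is_2cogroup K ->
  square_coset K x = square_coset K y <-> square K (x^-1 * y).
Proof.
move=> cK; split=> [xy|sxy].
  have : square_coset K y y by rewrite /square_coset left_shiftE mulVg; exact: square1.
  by rewrite -xy /square_coset left_shiftE.
apply/funext => u; rewrite /square_coset !left_shiftE.
have -> : x^-1 * u = x^-1 * y * (y^-1 * u) by rewrite -mulgA mulVKg.
by apply/propext; exact: squareMsl.
Qed.

Lemma square_cosetM K x y : is_2cogroup K -> stab K y ->
  square_coset K x * square_coset K y = square_coset K (x * y).
Proof.
move=> cK sy; apply/seteqP; split=> u; rewrite /square_coset.
  move=> [a + [b + <-]]; rewrite /square_coset !left_shiftE => xa yb.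
  have -> : (x * y)^-1 * (a * b) = y^-1 * (x^-1 * a) * y^-1^-1 * (y^-1 * b).
    by rewrite invgM invgK !mulgA mulgK.
  apply: squareM => //; apply/stab_square_conj => //; exact: stabV.
rewrite left_shiftE => h; exists x; first by rewrite /= /square_coset left_shiftE mulVg; exact: square1.
exists (x^-1 * u); last by rewrite mulVKg.
by rewrite /square_coset left_shiftE mulgA -invgM.
Qed.

Lemma subgroup_characteristic K : is_2cogroup K -> subgroup (characteristic_group K).
Proof.
move=> cK; split=> [_ _ [x sx <-] [y sy <-]|].
  by exists (x * y); [exact: stabM|exact: esym (square_cosetM x cK sy)].
exists (square_coset K 1); first by exists 1 => //; exact: stab1.
move=> _ [x sx <-]; have sV := stabV sx.
rewrite -!/(square_coset K _) !square_cosetM ?mul1g ?mulg1 //; last exact: stab1.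
split=> //; exists (square_coset K x^-1); first by exists x^-1.
by rewrite !square_cosetM // mulgV mulVg.
Qed.

Section Maximal.
Variable K : set X.
Hypothesis mK : maximal_2cogroups X K.

Let cK : is_2cogroup K. Proof. exact: mK.1. Qed.

(* Otherwise [N K] would be a strictly larger 2-cogroup. *)
Lemma disjoint_subgroup_square N : N `<=` stab K -> N 1 ->
  (forall x y, N x -> N y -> N (x * y)) -> (forall x, N x -> N x^-1) ->
  (forall x, N x -> ~ K x) -> N `<=` square K.
Proof.
move=> Nst N1 NM NV NK; pose K' := [set y | exists2 n, N n & K (n^-1 * y)].
have /cogroupP [_ K3 KV K2] := cK.
have cj n k : N n -> K k -> K (n^-1 * k * n).
  by move=> Nn Kk; have := stab_conj k (stabV (Nst n Nn)); rewrite invgK => ->.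
have cK' : is_2cogroup K'.
  apply/cogroupP; split.
  - by have [k Kk] := cK.1; exists k, 1; rewrite // invg1 mul1g.
  - move=> a b c [n Nn Ka] [m Nm Kb] [l Nl Kc].
    exists (n * m * l); first exact: NM (NM _ _ Nn Nm) Nl.
    have -> : (n * m * l)^-1 * (a * b * c) =
      l^-1 * (m^-1 * (n^-1 * a) * m) * l * (l^-1 * (m^-1 * b) * l) * (l^-1 * c).
      by rewrite !invgM -!mulgA !(mulVKg, mulKg).
    by apply: (K3) => //; apply: (cj) => //; exact: cj.
  - move=> a [n Nn Ka]; exists n^-1; first exact: NV.
    have := cj _ _ (NV n Nn) (KV _ Ka).
    by rewrite [(n^-1 * a)^-1]invgM -!mulgA mulVg mulg1.
  move=> a b [n Nn Ka] [m Nm Kb] [l Nl Kab].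
  apply: (NK (m^-1 * n^-1 * l)); first exact: NM (NM _ _ (NV _ Nm) (NV _ Nn)) Nl.
  have sq : square K (m^-1 * (n^-1 * a) * m * (m^-1 * b)).
    by apply: cogroup_square => //; exact: cj.
  have -> : m^-1 * n^-1 * l = m^-1 * (n^-1 * a) * m * (m^-1 * b) * (l^-1 * (a * b))^-1.
    by rewrite !invgM invgK -!mulgA !mulVKg.
  by apply: square_cogroupM => //; exact: KV.
have K'E : K' = K.
  by apply: mK.2 => // k Kk; exists 1; rewrite // invg1 mul1g.
move=> n Nn; have [k Kk] := cK.1; apply/(cogroupMr cK n Kk).
by rewrite -K'E; exists n; rewrite // mulKg.
Qed.

Lemma square_expg x n : square K x -> square K (x ^+ n).
Proof.
move=> sx; elim: n => [|n IHn]; first exact: square1.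
by rewrite expgS; exact: squareM.
Qed.

Lemma cogroup_sqr x : K x -> square K (x ^+ 2).
Proof. by move=> Kx; rewrite expg2; exact: cogroup_square. Qed.

Lemma cogroup_expg_odd x n : K x -> odd n -> K (x ^+ n).
Proof.
move=> Kx on; rewrite -[n]odd_double_half on -muln2 mulnC expgnDr expg1 expgnA.
by apply: cogroup_squareM => //; apply: square_expg; exact: cogroup_sqr.
Qed.

Lemma expg_stab x n : stab K x -> stab K (x ^+ n).
Proof.
move=> sx; elim: n => [|n IHn]; first exact: stab1.
by rewrite expgS; exact: stabM.
Qed.

(** [disjoint_subgroup_square] applied to the cyclic group of [x], whose elements are written with
    two natural exponents. *)
Lemma cyclic_meets_cogroup x : stab K x -> square K x \/
  exists a b, K (x ^+ a * x ^- b).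
Proof.
move=> sx; apply: contrapT => /not_orP [nsx nK]; apply: nsx.
pose N := [set y | exists a b, y = x ^+ a * x ^- b].
have cVX a b : commute (x ^+ a) (x ^- b).
  by apply/commuteV/commuteX2; exact: commute_refl.
apply: (@disjoint_subgroup_square N); last by exists 1%N, 0%N; rewrite expg1 invg1 mulg1.
- by move=> _ [a [b ->]]; apply: stabM; [exact: expg_stab|apply: stabV; exact: expg_stab].
- by exists 0%N, 0%N; rewrite mulgV.
- move=> _ _ [a [b ->]] [c [d ->]]; exists (a + c)%N, (b + d)%N.
  rewrite !expgnDr [(x ^+ b * x ^+ d)^-1]invgM -!mulgA; congr (_ * _).
  rewrite mulgA -cVX -mulgA; congr (_ * _).
  by rewrite -!invgM -!expgnDr addnC.
- by move=> _ [a [b ->]]; exists b, a; rewrite invgM invgK.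
by move=> _ [a [b ->]] Kab; apply: nK; exists a, b.
Qed.

(** A power of [x] in [K] yields [n > 0] with [x ^+ n] in the square. Splitting off the 2-part of
    [n] leaves [y] of odd order modulo the square; a power of [y] in [K], raised to that odd
    exponent, would lie both in [K] and in the square. *)
Lemma stab_torsion x : stab K x -> exists n, square K (x ^+ (2 ^ n)).
Proof.
move=> sx; have [?|[a [b Kab]]] := cyclic_meets_cogroup sx; first by exists 0%N.
have ab2 : square K (x ^+ (2 * a) * x ^- (2 * b)).
  have -> : x ^+ (2 * a) * x ^- (2 * b) = (x ^+ a * x ^- b) ^+ 2.
    rewrite expgMn; last by apply/commuteV/commuteX2; exact: commute_refl.
    by rewrite (mulnC 2 a) (mulnC 2 b) !expgnA expVgn.
  exact: cogroup_sqr.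
have [n n0 sn] : exists2 n, (0 < n)%N & square K (x ^+ n).
  case: (ltngtP a b) => ab; last by subst b; case: (square_disjoint cK Kab); rewrite mulgV; exact: square1.
    exists (2 * b - 2 * a)%N; first by rewrite subn_gt0 ltn_pmul2l.
    rewrite expgnFr ?leq_pmul2l 1?ltnW //; have := squareV cK ab2.
    by rewrite invgM invgK.
  exists (2 * a - 2 * b)%N; first by rewrite subn_gt0 ltn_pmul2l.
  by rewrite expgnFr ?leq_pmul2l 1?ltnW.
exists (logn 2 n); have := @cyclic_meets_cogroup (x ^+ (2 ^ logn 2 n)) (expg_stab _ sx).
case=> // -[c [d Kcd]]; exfalso.
pose q := (n %/ 2 ^ logn 2 n)%N.
have nE : n = (2 ^ logn 2 n * q)%N by rewrite mulnC divnK // pfactor_dvdnn.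
have oq : odd q.
  have [m com mE] := pfactor_coprime (isT : prime 2) n0.
  have -> : q = m by rewrite /q {1}mE mulnK // expn_gt0.
  by rewrite -coprime2n.
set y := x ^+ _ in Kcd; have yq : square K (y ^+ q) by rewrite -expgnA -nE.
apply: (square_disjoint cK (cogroup_expg_odd Kcd oq)).
rewrite expgMn; last by apply/commuteV/commuteX2; exact: commute_refl.
rewrite expVgn -!expgnA (mulnC c) (mulnC d) !expgnA.
by apply: squareM => //; [|apply: squareV => //]; exact: square_expg.
Qed.

(** Modulo the square only the parity of an exponent counts: a power of [x] in [K] must be odd, and
    then [x] itself lies in [K]. *)
Lemma stab_involution x : stab K x -> square K (x * x) -> K x \/ square K x.
Proof.
move=> sx sxx; have [?|[a [b Kab]]] := cyclic_meets_cogroup sx; [by right|left].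
have KS : K (x ^+ (a + b)).
  have -> : x ^+ (a + b) = x ^+ a * x ^- b * ((x * x) ^+ b).
    rewrite -expg2 -expgnA expgnDr -mulgA; congr (_ * _).
    by rewrite mulnC muln2 -addnn expgnDr mulKg.
  by apply: cogroup_squareM => //; exact: square_expg.
have [odd_ab|even_ab] := boolP (odd (a + b)).
  have := KS; rewrite -[(a + b)%N]odd_double_half odd_ab -muln2 mulnC expgnDr expg1 expgnA expg2.
  move=> Kx; rewrite -(mulgK ((x * x) ^+ (a + b)./2) x).
  by apply: cogroup_squareM => //; apply: squareV => //; exact: square_expg.
case: (square_disjoint cK KS).
rewrite -[(a + b)%N]odd_double_half (negPf even_ab) add0n -muln2 mulnC expgnA expg2.
exact: square_expg.
Qed.

(** The unique involution is the coset [K] itself, written as the coset of any [k0] in [K]; its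
    uniqueness and the 2-power orders come from the maximality of [K]. *)
Lemma characteristic_group_type (R : realType) :
  (exists2 k, range_inf 1 k & alg_isomorphic (characteristic_group K) (C2 R k)) \/
  (exists2 k, range_inf 3 k & alg_isomorphic (characteristic_group K) (Q2 R k)).
Proof.
have [G [iota [iM iI iR]]] := subgroup_group (subgroup_characteristic cK).
have gE g : exists2 x, stab K x & iota g = square_coset K x.
  have : characteristic_group K (iota g) by rewrite -iR; exists g.
  by move=> [x sx <-]; exists x.
have xE x : stab K x -> exists g, iota g = square_coset K x.
  move=> sx; have : characteristic_group K (square_coset K x) by exists x.
  by rewrite -iR => -[g _ gx]; exists g.
have i1 : iota 1 = square_coset K 1.
  have [e eE] := xE 1 (stab1 K); rewrite -eE; congr iota.
  have : e * e = e.
    by apply: iI; rewrite iM eE square_cosetM ?mulg1 //; exact: stab1.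
  by move=> ee; apply: (mulgI e); rewrite mulg1 ee.
have iX g x n : stab K x -> iota g = square_coset K x -> iota (g ^+ n) = square_coset K (x ^+ n).
  move=> sx gx; elim: n => [//|n IHn]; rewrite !expgS iM IHn gx square_cosetM //.
  exact: expg_stab.
have i1P g x : stab K x -> iota g = square_coset K x -> g = 1 <-> square K x.
  move=> sx gx; have e : square_coset K 1 = square_coset K x <-> square K x.
    by rewrite square_coset_eq // invg1 mul1g.
  split=> [g1|/e xe]; first by apply/e; rewrite -gx g1.
  by apply: iI; rewrite gx i1.
have [k0 Kk0] := cK.1; have sk0 := cogroup_stab cK Kk0.
have [z zE] := xE k0 sk0.
have z1 : z != 1.
  by apply/eqP => /(i1P z k0 sk0 zE); exact: (square_disjoint cK Kk0).
have zz : z * z = 1.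
  apply/(i1P _ (k0 * k0)); first exact: stabM.
    by rewrite iM zE square_cosetM.
  exact: cogroup_square.
have invol g : g * g = 1 -> g = 1 \/ g = z.
  have [x sx gx] := gE g; move=> /(i1P _ (x * x) (stabM sx sx)) h.
  have {}h : square K (x * x) by apply: h; rewrite iM gx square_cosetM.
  have [Kx|sqx] := stab_involution sx h; [right|by left; apply/(i1P g x)].
  apply: iI; rewrite gx zE; apply/square_coset_eq => //.
  by apply: cogroup_square => //; exact: cogroupV.
have tors (g : G) : exists n, g ^+ (2 ^ n) = 1.
  have [x sx gx] := gE g; have [n sn] := stab_torsion sx; exists n.
  by apply/(i1P _ (x ^+ (2 ^ n))) => //; [exact: expg_stab|exact: iX].
have [psi [psiM psiI psiR]] := classification R z1 zz invol tors.
have iso S : range psi = S -> alg_isomorphic (characteristic_group K) S.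
  move=> psiS; pose h c := psi (xget 1 [set g | iota g = c]).
  have hE g : h (iota g) = psi g.
    rewrite /h; congr psi; apply: iI.
    by apply: (@xgetPex _ 1 [set g' | iota g' = iota g]); exists g.
  exists h; split; last first.
    by move=> x y; rewrite !inE -iR => -[g _ <-] [g' _ <-]; rewrite -iM !hE psiM.
  rewrite -iR -psiS; split=> [_ [g _ <-]|x y|_ [g _ <-]]; first by rewrite hE; exists g.
    by rewrite !inE => -[g _ <-] [g' _ <-]; rewrite !hE => /psiI ->.
  by exists (iota g); [exists g|exact: hE].
by case: psiR => -[k kr /iso]; [left|right]; exists k.
Qed.
End Maximal.

Lemma square_conjugate x K : square (conjugate x K) = conjugate x (square K).
Proof.
apply/seteqP; split=> y.
  move=> [_ [a Ka <-] [_ [b Kb <-] <-]]; exists (a * b); first by exists a => //; exists b.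
  by rewrite !mulgA mulgVK.
move=> [_ [a Ka [b Kb <-]] <-]; exists (x * a * x^-1); first by exists a.
by exists (x * b * x^-1); [exists b|rewrite !mulgA mulgVK].
Qed.

Lemma characteristic_conjugate x K : is_2cogroup K ->
  alg_isomorphic (characteristic_group K) (characteristic_group (conjugate x K)).
Proof.
move=> cK; pose f : power X -> power X := conjugate x.
have fK S : conjugate x^-1 (f S) = S by exact: conjugateK.
have fE y : f (square_coset K y) = square_coset (conjugate x K) (x * y * x^-1).
  apply/funext => u; rewrite /f conjugateE /square_coset !left_shiftE.
  by rewrite square_conjugate conjugateE !invgM invgK -!mulgA mulKg.
have st y : stab K y -> stab (conjugate x K) (x * y * x^-1).
  by rewrite /stab /= => sy; rewrite conjugateM mulgVK -conjugateM sy.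
exists f; split; last first.
  move=> a b; rewrite !inE => -[y sy <-] [y' sy' <-].
  rewrite -!/(square_coset K _) square_cosetM // !fE square_cosetM //.
  - by congr square_coset; rewrite !mulgA mulgVK.
  - exact: conjugate_cogroup.
  - exact: st.
split=> [_ [y sy <-]|a b _ _ ab|_ [y sy <-]].
- rewrite -/(square_coset K _) fE; exists (x * y * x^-1) => //; exact: st.
- by rewrite -[a]fK ab fK.
have sy' : stab K (x^-1 * y * x).
  move: sy; rewrite /stab /= => /(congr1 (conjugate x^-1)).
  by rewrite conjugateK !conjugateM.
exists (square_coset K (x^-1 * y * x)); first by exists (x^-1 * y * x).
by rewrite fE !mulgA mulgV mul1g mulgK.
Qed.

End CharacteristicGroup.

Lemma alg_isomorphic_trans (T U V : semigroupType) (A : set T) (B : set U) (C : set V) :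
  alg_isomorphic A B -> alg_isomorphic B C -> alg_isomorphic A C.
Proof.
move=> [f [[fS fI fsurj] fM]] [g [[gS gI gsurj] gM]]; exists (g \o f); split; last first.
  move=> x y Ax Ay /=; rewrite fM // gM //; rewrite inE; apply: fS; exact: set_mem.
split=> [x Ax|x y Ax Ay /= /gI|z /gsurj[y /fsurj[x Ax <-] <-]]; last by exists x.
  by apply: gS; exact: fS.
by move=> fxy; apply: fI => //; apply: fxy; rewrite inE; apply: fS; exact: set_mem.
Qed.

(** * Orbits of the characteristic group on twin sets *)

(** All orbits have size [2 ^ b] in a set of size [2 ^ n], so their number is a power of 2 and bit
    vectors can number them. The group enters as a list of its elements, its laws being replaced by
    the existence of indices. *)
Lemma free_action_orbits (T : choiceType) (A : set T) (W : finType) (n b : nat)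
    (e : T -> W) (d : W -> T) (act : 'I_(2 ^ b) -> T -> T) :
    (#|W| = 2 ^ n)%N -> (forall w, A (d w)) -> (forall w, e (d w) = w) ->
    (forall x, A x -> d (e x) = x) -> (forall i x, A x -> A (act i x)) ->
    (forall x, A x -> exists i, act i x = x) ->
    (forall x i, A x -> exists j, act j (act i x) = x) ->
    (forall x i j, A x -> exists k, act j (act i x) = act k x) ->
    (forall x i j, A x -> act i x = act j x -> i = j) ->
  exists c (q : T -> 'I_c -> bool) (rep : T -> T),
    [/\ forall x, A x -> A (rep x) /\ exists i, act i (rep x) = x,
        forall x i, A x -> rep (act i x) = rep x,
        forall x y, A x -> A y -> q x = q y <-> rep x = rep y &
        forall f, exists2 x, A x & q x = f].
Proof.
move=> cW Ad ed de Aact refl sym trans free.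
have /card_gt0P[w0 _] : (0 < #|W|)%N by rewrite cW expn_gt0.
pose orb x : set T := [set y | exists i, act i x = y].
pose rep x := xget (d w0) (orb x).
have repP x : A x -> exists i, act i x = rep x.
  move=> Ax; apply: (@xgetPex _ (d w0) (orb x)); have [i ix] := refl x Ax.
  by exists x, i.
have Arep x : A x -> A (rep x).
  by move=> Ax; have [i <-] := repP x Ax; exact: Aact.
have rep_act x i : A x -> rep (act i x) = rep x.
  move=> Ax; rewrite /rep; congr xget.
  apply/seteqP; split=> y [j <-].
    by have [k ->] := trans x i j Ax; exists k.
  have [k kx] := sym x i Ax; have [l lE] := trans (act i x) k j (Aact _ _ Ax).
  by exists l; rewrite -lE kx.
have repK x : A x -> rep (rep x) = rep x.
  by move=> Ax; have [i ix] := repP x Ax; rewrite -{1}ix rep_act.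
have rep_orb x : A x -> exists i, act i (rep x) = x.
  by move=> Ax; have [i <-] := repP x Ax; exact: sym.
(* [S] holds one code per orbit, and [g] is a bijection from ['I_(2 ^ b)] times [S] onto [W]. *)
pose S := [set w : W | rep (d w) == d w]%SET.
pose g (p : 'I_(2 ^ b) * W) : W := e (act p.1 (d p.2)).
have gimg : (g @: finset.setX [set: 'I_(2 ^ b)] S = [set: W])%SET.
  apply/setP => w; rewrite finset.in_setT; apply/imsetP.
  have [i iw] := rep_orb _ (Ad w).
  exists (i, e (rep (d w))); last by rewrite /g /= de ?iw ?ed //; exact: Arep.
  by rewrite finset.in_setX finset.in_setT /= finset.inE de ?repK //; exact: Arep.
have ginj : {in finset.setX [set: 'I_(2 ^ b)] S &, injective g}%SET.
  move=> [i w] [j v]; rewrite !finset.in_setX !finset.inE /= => /eqP wE /eqP vE.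
  rewrite /g /= => /(congr1 d); rewrite !de; [|exact: Aact|exact: Aact] => ij.
  have wv : d w = d v.
    by rewrite -wE -vE -(rep_act _ i) // ij rep_act.
  have -> : w = v by rewrite -(ed w) wv ed.
  by congr pair; apply: (free (d v)) => //; rewrite -ij wv.
have cS : (2 ^ b * #|S| = 2 ^ n)%N.
  by rewrite -cW -cardsT -gimg card_in_imset // cardsX cardsT card_ord.
have [c _ cE] : exists2 c, (c <= n)%N & #|S| = (2 ^ c)%N.
  by apply/(@dvdn_pfactor 2 _ n isT); rewrite -cS dvdn_mull.
have eqc : #|S| = #|{: {ffun 'I_c -> bool}}|.
  by rewrite card_ffun card_bool card_ord.
have [w1 w1S] : exists w, w \in S by apply/card_gt0P; rewrite cE expn_gt0.
have eS x : A x -> e (rep x) \in S.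
  by move=> Ax; rewrite finset.inE de ?repK //; exact: Arep.
pose q x : 'I_c -> bool := enum_val (cast_ord eqc (enum_rank_in w1S (e (rep x)))).
exists c, q, rep; split=> // [x Ax|x y Ax Ay|f].
- by split; [exact: Arep|exact: rep_orb].
- split=> [|qe]; last by rewrite /q qe.
  rewrite /q => /(congr1 (@finfun _ _)); rewrite !ffunK.
  move=> /enum_val_inj/cast_ord_inj/(congr1 enum_val).
  by rewrite !enum_rankK_in ?eS // => /(congr1 d); rewrite !de //; exact: Arep.
pose w := enum_val (cast_ord (esym eqc) (enum_rank (finfun f))).
have wS : w \in S by exact: enum_valP.
have rw : rep (d w) = d w by apply/eqP; rewrite finset.inE in wS.
exists (d w) => //; rewrite /q rw ed enum_valK_in cast_ordKV enum_rankK.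
by apply/funext => i; rewrite ffunE.
Qed.

Section FiniteOrbits.
Context {X : groupType} (K : set X).
Hypothesis mK : maximal_2cogroups X K.

Let cK : is_2cogroup K. Proof. exact: mK.1. Qed.

Lemma left_shift_stab x : stab K x -> left_shift x (stab K) = stab K.
Proof.
move=> sx; apply/funext => y; rewrite left_shiftE; apply/propext; split=> sy.
  by rewrite -(mulVKg x y); exact: stabM.
by apply: stabM => //; exact: stabV.
Qed.

(* Same argument as for [twins_of_fix], inside the stabilizer. *)
Lemma twins_of_fix_stab A x : twins_of K A -> stab K x ->
  left_shift x (A `&` stab K) = A `&` stab K -> square K x.
Proof.
move=> KA sx; set E := A `&` stab K => xE; have [k Kk] := cK.1.
have shE y : stab K y -> left_shift y (stab K `\` E) = stab K `\` left_shift y E.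
  move=> sy; rewrite -{2}(left_shift_stab sy).
  by apply/funext => u; rewrite left_shiftE /setD /= !left_shiftE.
have EE : stab K `\` (stab K `\` E) = E.
  by rewrite setDD setIC /E -setIA setIid.
pose K' := [set y | stab K y /\ left_shift y E = stab K `\` E].
have KK' : K `<=` K'.
  move=> y Ky; have sy := cogroup_stab cK Ky; split=> //.
  rewrite /E left_shiftI left_shift_stab // (KA y Ky).
  by apply/seteqP; split=> [u [nA su]|u [su nE]]; [split=> // -[]|split=> // Au; apply: nE].
have cK' : is_2cogroup K'.
  apply/cogroupP; split; first by exists k; exact: KK'.
  - move=> a b c [sa Ka] [sb Kb] [sc Kc]; split; first exact: stabM (stabM sa sb) sc.
    by rewrite -!left_shiftM Kc shE // Kb EE.
  - move=> a [sa Ka]; split; first exact: stabV.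
    have aE : left_shift a (stab K `\` E) = E by rewrite shE // Ka EE.
    by rewrite -{1}aE left_shiftK.
  move=> a b [sa Ka] [sb Kb] []; rewrite -left_shiftM Kb shE // Ka EE => _ EN.
  have s1 := stab1 K; have E1 : ~ E 1.
    by move=> E1; have := E1; rewrite EN => -[].
  by apply: (E1); rewrite EN.
have K'E : K' = K by exact: mK.2.
apply/(cogroupMr cK x Kk); rewrite -K'E; have [sk Ek] := KK' k Kk.
by split; [exact: stabM|rewrite -left_shiftM Ek shE // xE].
Qed.

Variables (b : nat) (t : 'I_(2 ^ b) -> X).
Hypothesis t_stab : forall i, stab K (t i).
Hypothesis t_rep : forall x, stab K x -> exists i, square K ((t i)^-1 * x).
Hypothesis t_inj : forall i j, square K ((t i)^-1 * t j) -> i = j.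

(* [D |-> (p D, h D KK)] is a homeomorphism of [twins_of K] onto
   [2^M * H(K)], [p] being constant on the orbits and [h] equivariant. *)
Definition orbit_structure M (p : set X -> M -> bool) (h : set X -> X) :=
  [/\ forall D, twins_of K D -> stab K (h D),
      forall D x, twins_of K D -> stab K x ->
        square K ((h (left_shift x D))^-1 * (x * h D)),
      forall D x, twins_of K D -> stab K x -> p (left_shift x D) = p D,
      forall f x, stab K x -> exists D, [/\ twins_of K D, p D = f & square K ((h D)^-1 * x)] &
      [/\ forall D y, twins_of K D -> exists2 F, finite_set F & forall D', twins_of K D' ->
            square K ((h D)^-1 * h D') -> (forall m, F m -> p D m = p D' m) -> (D y <-> D' y),
          forall D, twins_of K D -> exists2 F, finite_set F & forall D', twins_of K D' ->
            (forall y, F y -> (D y <-> D' y)) -> square K ((h D)^-1 * h D') &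
          forall D m, twins_of K D -> exists2 F, finite_set F & forall D', twins_of K D' ->
            (forall y, F y -> (D y <-> D' y)) -> p D m = p D' m]].

(* Inside [stab K] a twin set takes finitely many shapes [D `&` N], freely
   permuted by [H(K)], so that both the orbit and the position [h D] are read
   off this part.  Outside, the translate of [D] by [(h D)^-1] is an orbit
   invariant, given by its values at the representatives of the cosets of
   [plus_minus K]. *)
Lemma finite_orbit_structure : exists M (p : set X -> M -> bool) h, orbit_structure p h.
Proof.
pose N := stab K; pose rho := coset_rep K.
have rho_stab x : stab K x -> stab K (rho x).
  move=> sx; have := plus_minus_stab cK (coset_repP cK x) => h.
  by rewrite -(mulgVK x (rho x)); exact: stabM.
have rho_stab' x : stab K (rho x) -> stab K x.
  move=> sx; have := plus_minus_stab cK (coset_repP' cK x) => h.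
  by rewrite -(mulgVK (rho x) x); exact: stabM.
(* Representatives of the finitely many cosets of [plus_minus K] in [stab K]; the values there
   determine [D] inside [stab K]. *)
pose s := undup [seq rho (t i) | i <- enum 'I_(2 ^ b)].
have s_rho x : stab K x -> rho x \in s.
  move=> sx; have [i ti] := t_rep sx; rewrite mem_undup.
  apply/mapP; exists i; first by rewrite mem_enum.
  apply: coset_rep_eq => //; right.
  have -> : x * (t i)^-1 = t i * ((t i)^-1 * x) * (t i)^-1 by rewrite mulVKg.
  by apply/stab_square_conj.
have s_stab y : y \in s -> stab K y /\ rho y = y.
  rewrite mem_undup => /mapP[i _ ->]; split; first exact: rho_stab.
  exact: coset_repK.
pose A := [set D `&` N | D in twins_of K].
pose W : finType := {ffun seq_sub s -> bool}.
pose e (D : set X) : W := [ffun y => `[< D (ssval y) >]].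
pose d (w : W) : set X := twin_of_choice K (fun x => exists2 y, ssval y = x & w y) `&` N.
have Ad w : A (d w).
  exists (twin_of_choice K (fun x => exists2 y : seq_sub s, ssval y = x & w y)) => //.
  exact: twin_of_choiceP.
have ed w : e (d w) = w.
  apply/ffunP => y; rewrite ffunE.
  have [sy yE] := s_stab _ (ssvalP y).
  have := twin_of_choice_rep cK (fun x => exists2 y, ssval y = x & w y) (ssval y).
  rewrite -/rho yE => H; case: asboolP => [[/H [y' /val_inj <- wy] _]//|nd].
  apply/esym/negP => wy; apply: nd; split=> //; apply/H; by exists y.
have agreeN D D' : twins_of K D -> twins_of K D' -> (forall y, y \in s -> (D y <-> D' y)) ->
    D `&` N = D' `&` N.
  move=> KD KD' H; apply/funext => x; apply/propext.
  have HN : N x -> (D x <-> D' x).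
    by move=> Nx; apply: (twins_of_eq_at cK) => //; apply: H; exact: s_rho.
  by split=> -[Dx Nx]; split=> //; apply/(HN Nx).
have de D : A D -> d (e D) = D.
  move=> [D' KD' <-]; apply: (agreeN) => //; first exact: twin_of_choiceP.
  move=> y ys; have [sy yE] := s_stab _ ys.
  have := twin_of_choice_rep cK (fun x => exists2 y0, ssval y0 = x & e (D' `&` N) y0) y.
  rewrite -/rho yE => H; split=> [/H [y' <-]|Dy].
    by rewrite ffunE => /asboolP [].
  by apply/H; exists (SeqSub ys) => //; rewrite ffunE; apply/asboolP.
pose act i D := left_shift (t i) D.
have shN x D : stab K x -> left_shift x (D `&` N) = left_shift x D `&` N.
  by move=> sx; rewrite left_shiftI left_shift_stab.
have fixN x y D : twins_of K D -> stab K x -> stab K y -> square K (x^-1 * y) ->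
    left_shift x (D `&` N) = left_shift y (D `&` N).
  move=> KD sx sy sxy; rewrite !shN //; congr (_ `&` _).
  by rewrite -(mulVKg x y) -left_shiftM (twins_of_square cK KD sxy).
have fixN' x y D : twins_of K D -> stab K x -> stab K y ->
    left_shift x (D `&` N) = left_shift y (D `&` N) -> square K (x^-1 * y).
  move=> KD sx sy xy; apply: (twins_of_fix_stab KD).
    by apply: stabM => //; exact: stabV.
  by rewrite -left_shiftM -xy left_shiftK.
have Ash x D : stab K x -> A D -> A (left_shift x D).
  move=> sx [D' KD' <-]; exists (left_shift x D'); first exact: twins_of_shift.
  by rewrite shN.
have actE x D : stab K x -> A D -> exists i, act i D = left_shift x D.
  move=> sx [D' KD' <-]; have [i ti] := t_rep sx; exists i.
  exact: fixN.
have [|||||||||c [q [rep [rep1 rep2 q1 q2]]]] :=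
  @free_action_orbits (set X : choiceType) A W #|{: seq_sub s}| b e d act; try assumption.
- by rewrite card_ffun card_bool.
- by move=> i D AD; exact: Ash.
- by move=> D AD; have := actE 1 D (stab1 K) AD; rewrite left_shift1.
- move=> D i AD; have [j jE] := actE _ _ (stabV (t_stab i)) (Ash _ _ (t_stab i) AD).
  by exists j; rewrite jE /act left_shiftK.
- move=> D i j AD; have [k kE] := actE _ D (stabM (t_stab j) (t_stab i)) AD.
  by exists k; rewrite kE /act left_shiftM.
- move=> D i j [D' KD' <-] ij; apply: t_inj; exact: (fixN' _ _ D').
have i0 : 'I_(2 ^ b) by exists 0%N; rewrite expn_gt0.
pose ti E := xget i0 [set i | act i (rep E) = E].
pose h (D : set X) := t (ti (D `&` N)).
have hstab D : stab K (h D) by exact: t_stab.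
have AN D : twins_of K D -> A (D `&` N) by move=> KD; exists D.
have hP D : twins_of K D -> left_shift (h D) (rep (D `&` N)) = D `&` N.
  move=> KD; have [_ [i iE]] := rep1 _ (AN D KD).
  by apply: (@xgetPex _ i0 [set i | act i (rep (D `&` N)) = D `&` N]); exists i.
have repA D : twins_of K D -> exists2 D', twins_of K D' & rep (D `&` N) = D' `&` N.
  by move=> KD; have [[D' KD' <-] _] := rep1 _ (AN D KD); exists D'.
have rep_shift D x : twins_of K D -> stab K x ->
    rep (left_shift x D `&` N) = rep (D `&` N).
  move=> KD sx; rewrite -shN //; have [i <-] := actE x _ sx (AN D KD).
  exact: rep2 (AN D KD).
have h_eq D D' : twins_of K D -> twins_of K D' -> rep (D `&` N) = rep (D' `&` N) ->
    square K ((h D)^-1 * h D') -> D `&` N = D' `&` N.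
  move=> KD KD' repE hh; rewrite -(hP D KD) -(hP D' KD') repE.
  have [E KE ->] := repA D' KD'; exact: fixN.
(* The index set is a sum: bits numbering the orbits of the finite part, and one bit for each coset
   of [plus_minus K] outside [stab K]. *)
pose p (D : set X) (m : 'I_c + set_type [set x | rho x = x /\ ~ N x]) :=
  match m with inl i => q (D `&` N) i | inr x => `[< D (h D * set_val x) >] end.
have h_shift D x : twins_of K D -> stab K x ->
    square K ((h (left_shift x D))^-1 * (x * h D)).
  move=> KD sx; have KxD := twins_of_shift sx KD.
  have [E KE repE] := repA D KD.
  apply: (fixN' _ _ E KE (hstab _) (stabM sx (hstab D))).
  rewrite -repE -left_shiftM hP // -(rep_shift D x KD sx) hP //.
  by rewrite shN.
have q_shift D x : twins_of K D -> stab K x -> q (left_shift x D `&` N) = q (D `&` N).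
  move=> KD sx; apply/(q1 _ _ (AN _ (twins_of_shift sx KD)) (AN D KD)).
  exact: rep_shift.
have outside D D' y : twins_of K D -> twins_of K D' -> h D = h D' ->
    (D (h D * rho ((h D)^-1 * y)) <-> D' (h D * rho ((h D)^-1 * y))) -> (D y <-> D' y).
  move=> KD KD' hh H; set u := h D in H *; set r := rho _ in H.
  have sh : stab K u by exact: hstab.
  have DE : u * (u^-1 * y * r^-1) * u^-1 * (u * r) = y.
    by rewrite -!mulgA mulVKg mulKg mulVg mulg1.
  rewrite -DE.
  case: (coset_repP' cK (u^-1 * y)) => Kw.
    have Kuw : K (u * (u^-1 * y * r^-1) * u^-1) by apply/stab_conj.
    have h1 := twin_cogroup_shiftN cK (u * r) KD Kuw.
    have h2 := twin_cogroup_shiftN cK (u * r) KD' Kuw.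
    tauto.
  have Kuw : square K (u * (u^-1 * y * r^-1) * u^-1) by apply/stab_square_conj.
  have h1 := twin_square_shift cK (u * r) KD Kuw.
  have h2 := twin_square_shift cK (u * r) KD' Kuw.
  tauto.
have p_shift D x : twins_of K D -> stab K x -> p (left_shift x D) = p D.
  move=> KD sx; apply/funext => -[i|[m mP]] /=; first by rewrite q_shift.
  rewrite left_shiftE; apply: asbool_equiv_eq.
  set u := h (left_shift x D).
  have w := h_shift D x KD sx; rewrite -/u in w.
  have -> : x^-1 * (u * m) = h D * (u^-1 * (x * h D))^-1 * (h D)^-1 * (h D * m).
    by rewrite !invgM invgK -!mulgA mulVKg mulKg.
  apply: (twin_square_shift cK _ KD); apply/stab_square_conj => //; exact: squareV.
exists _, p, h; split; [by move=> D _; exact: hstab|exact: h_shift|exact: p_shift|..].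
- move=> f x sx; have [E AE qE] := q2 (fun i => f (inl i)).
  (* Inside [stab K] the set is an orbit representative, so its [h] is trivial and the bits outside
     can be prescribed directly; the shift by [x] then sets the position. *)
  pose c0 z := rep E z \/ exists m, set_val m = z /\ f (inr m).
  pose D0 := twin_of_choice K c0.
  have KD0 : twins_of K D0 by exact: twin_of_choiceP.
  have D0rep z : rho z = z -> D0 z <-> c0 z.
    by move=> rz; have := twin_of_choice_rep cK c0 z; rewrite -/rho rz.
  have [[R KR RE] [i iE]] := rep1 _ AE.
  have RA : A (rep E) by exists R.
  have repK : rep (rep E) = rep E by rewrite -[in RHS]iE rep2.
  have D0N : D0 `&` N = rep E.
    rewrite -RE; apply: (agreeN) => // y /s_stab [sy ry].
    rewrite D0rep // /c0 -RE; split=> [[[Ry _] //|[m [my _]]]|Ry]; last by left.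
    have [_ nm] := set_mem (valP m); case: nm.
    by have -> : \val m = y by exact: my.
  have hD0 : square K (h D0).
    have := fixN' 1 (h D0) R KR (stab1 K) (hstab D0).
    rewrite invg1 mul1g; apply; rewrite left_shift1 RE -{1}D0N -hP // D0N repK.
    by [].
  exists (left_shift x D0); split; first exact: twins_of_shift.
    rewrite p_shift //; apply/funext => -[k|m] /=.
      by have := (q1 _ _ RA AE).2 repK; rewrite D0N qE => ->.
    have [rm nm] := set_mem (valP m).
    have H1 : D0 (h D0 * set_val m) <-> D0 (set_val m) := twin_square_shift cK _ KD0 hD0.
    have H2 := D0rep _ rm.
    have H3 : c0 (set_val m) <-> f (inr m).
      split=> [[|[m' [/val_inj -> //]]]|fm]; last by right; exists m.
      by rewrite -RE => -[].
    by apply/asboolP/idP; tauto.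
  have := h_shift D0 x KD0 sx; rewrite mulgA; exact: (squareMsr cK _ hD0).1.
split.
- move=> D y KD; pose r := rho ((h D)^-1 * y).
  (* All bits of the finite part, and the single bit of the coset of [(h D)^-1 y]. *)
  exists (range inl `|` [set inr m | m in [set m | set_val m = r]]).
    rewrite finite_setU; split; first by apply: finite_image; exact: finite_finset.
    apply: finite_image.
    have [[m0 m0r]|no] := pselect (exists m : set_type [set x | rho x = x /\ ~ N x], set_val m = r).
      apply: (sub_finite_set _ (finite_set1 m0)) => m /= mr.
      by apply: val_inj; exact: etrans mr (esym m0r).
    apply: (sub_finite_set _ (finite_set0 _)) => m mr; apply: no; by exists m.
  move=> D' KD' hh pp.
  have qq : q (D `&` N) = q (D' `&` N).
    by apply/funext => i; apply: (pp (inl i)); left; exists i.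
  have DN : D `&` N = D' `&` N.
    by apply: h_eq => //; apply/(q1 _ _ (AN D KD) (AN D' KD')).
  have hE : h D = h D' by rewrite /h DN.
  have [sy|nsy] := pselect (N y).
    have : (D `&` N) y <-> (D' `&` N) y by rewrite DN.
    by rewrite /setI /=; tauto.
  apply: outside => //; rewrite -/r.
  have rr : rho r = r by exact: coset_repK.
  have nr : ~ N r.
    move=> /rho_stab' Nr; apply: nsy; rewrite -(mulVKg (h D) y).
    by apply: stabM => //; exact: hstab.
  pose m : set_type [set x | rho x = x /\ ~ N x] := exist _ r (mem_set (conj rr nr)).
  have : p D (inr m) = p D' (inr m) by apply: pp; right; exists m.
  rewrite /= -hE => pE.
  by split=> /asboolP; [rewrite pE|rewrite -pE] => /asboolP.
- move=> D KD; exists [set` s]; first exact: finite_seq.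
  move=> D' KD' DD'; have DN : D `&` N = D' `&` N by apply: (agreeN) => // y ys; exact: DD'.
  by rewrite /h DN mulVg; exact: square1.
move=> D [i|m] KD.
  exists [set` s]; first exact: finite_seq.
  move=> D' KD' DD' /=; have -> // : D `&` N = D' `&` N by apply: (agreeN) => // y ys; exact: DD'.
exists ([set` s] `|` [set h D * set_val m]).
  by rewrite finite_setU; split; [exact: finite_seq|exact: finite_set1].
move=> D' KD' DD'; have DN : D `&` N = D' `&` N.
  by apply: (agreeN) => // y ys; apply: DD'; left.
apply: asbool_equiv_eq; have hE : h D' = h D by rewrite /h DN.
by rewrite hE; apply: DD'; right.
Qed.
End FiniteOrbits.

(** * Orbit spaces of twin sets for each type of characteristic group *)

Section Enumeration.
Context {X : groupType} (K : set X) (R : realType).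
Hypothesis mK : maximal_2cogroups X K.

Let cK : is_2cogroup K. Proof. exact: mK.1. Qed.

(** The isomorphism is lifted to a homomorphism on the stabilizer with kernel the square of [K]. *)
Lemma characteristic_iso_data (S : set (quat R)) :
  alg_isomorphic (characteristic_group K) S -> exists phi : X -> quat R,
  [/\ forall x, stab K x -> S (phi x),
      forall x y, stab K x -> stab K y -> phi (x * y) = phi x * phi y,
      forall x y, stab K x -> stab K y -> phi x = phi y <-> square K (x^-1 * y) &
      forall q, S q -> exists2 x, stab K x & phi x = q].
Proof.
move=> [f [[fS fI fsurj] fM]]; exists (fun x => f (square_coset K x)).
have cx x : stab K x -> characteristic_group K (square_coset K x) by exists x.
split=> [x sx|x y sx sy|x y sx sy|q /fsurj[_ [x sx <-] <-]].
- exact/fS/cx.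
- by rewrite -fM ?inE ?square_cosetM //; exact: cx.
- rewrite -square_coset_eq //; split=> [|-> //]; apply: fI; rewrite inE; exact: cx.
- by exists x.
Qed.

Lemma enumerate_stab (S : set (quat R)) b (u : 'I_(2 ^ b) -> quat R) :
  alg_isomorphic (characteristic_group K) S ->
  (forall i, S (u i)) -> injective u -> (forall q, S q -> exists i, q = u i) ->
  exists t : 'I_(2 ^ b) -> X, [/\ forall i, stab K (t i),
    forall x, stab K x -> exists i, square K ((t i)^-1 * x) &
    forall i j, square K ((t i)^-1 * t j) -> i = j].
Proof.
move=> /characteristic_iso_data [phi [phiS phiM phiI phisurj]] uS uI usurj.
have /choice [t tP] : forall i, exists x, stab K x /\ phi x = u i.
  by move=> i; have [x sx xi] := phisurj _ (uS i); exists x.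
exists t; split=> [i|x sx|i j].
- by have [] := tP i.
- have [i ui] := usurj _ (phiS x sx); exists i; have [si ti] := tP i.
  by apply/phiI => //; rewrite ti ui.
have [[si ti] [sj tj]] := (tP i, tP j).
by move=> /(phiI _ _ si sj); rewrite ti tj => /uI.
Qed.

Lemma root_chain_expr_inj n (i j : 'I_(2 ^ n.+1)) :
  (root_chain R n ^+ i = root_chain R n ^+ j)%R -> i = j.
Proof.
move=> /eqP; rewrite (eq_prim_root_expr (primitive_root_pow2 (root_chain_pow2 R n))).
by rewrite !modn_small // => /eqP/val_inj.
Qed.

Lemma root_chain_neq0 n k : (root_chain R n ^+ k <> 0)%R.
Proof.
move=> /eqP; rewrite expf_eq0 => /andP[_ /eqP h]; have := root_chain_pow2 R n.
by rewrite h expr0n expn_eq0 /= => /eqP; rewrite eq_sym oppr_eq0 oner_eq0.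
Qed.

Lemma root_chain_expr n (v : R[i]) : (v ^+ (2 ^ n.+1) = 1)%R ->
  exists i : 'I_(2 ^ n.+1), (v = root_chain R n ^+ i)%R.
Proof.
move=> vn; have [i ->] := prim_rootP (primitive_root_pow2 (root_chain_pow2 R n)) vn.
by exists i.
Qed.

Lemma root_chain_expr1 n k : (root_chain R n ^+ k ^+ (2 ^ n.+1) = 1)%R.
Proof.
rewrite -exprM mulnC exprM (prim_expr_order (primitive_root_pow2 (root_chain_pow2 R n))).
by rewrite expr1n.
Qed.

Lemma enumerate_C2 n : alg_isomorphic (characteristic_group K) (C2 R (Fin n.+1)) ->
  exists b (t : 'I_(2 ^ b) -> X), [/\ forall i, stab K (t i),
    forall x, stab K x -> exists i, square K ((t i)^-1 * x) &
    forall i j, square K ((t i)^-1 * t j) -> i = j].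
Proof.
move=> iso; exists n.+1.
apply: (enumerate_stab (u := fun i => Quat (root_chain R n ^+ i)%R 0%R) iso).
- by move=> i; exists (root_chain R n ^+ i)%R => //=; exact: root_chain_expr1.
- by move=> i j [] /root_chain_expr_inj.
- by move=> q [v /root_chain_expr[i ->] <-]; exists i.
Qed.

Lemma enumerate_Q2 n : alg_isomorphic (characteristic_group K) (Q2 R (Fin n.+3)) ->
  exists b (t : 'I_(2 ^ b) -> X), [/\ forall i, stab K (t i),
    forall x, stab K x -> exists i, square K ((t i)^-1 * x) &
    forall i j, square K ((t i)^-1 * t j) -> i = j].
Proof.
move=> iso; exists n.+3; pose z := root_chain R n.+1.
have QE := Q2nE R (isT : 2 <= n.+2)%N.
have e2 : (2 ^ n.+3 = 2 ^ n.+2 + 2 ^ n.+2)%N by rewrite expnS mul2n addnn.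
pose u (i : 'I_(2 ^ n.+3)) : quat R := match fintype.split (cast_ord e2 i) with
  | inl i => Quat (z ^+ i)%R 0%R | inr i => Quat 0%R (z ^+ i)%R end.
have z0 k : (z ^+ k <> 0)%R by exact: root_chain_neq0.
apply: (enumerate_stab (u := u) iso).
- move=> i; rewrite /= QE /u; case: fintype.split => j; [left|right];
    exists (z ^+ j)%R => //; exact: root_chain_expr1.
- move=> i j; rewrite /u => h; apply: (@cast_ord_inj _ _ e2).
  rewrite -[LHS]splitK -[RHS]splitK; move: h.
  case: fintype.split => k; case: fintype.split => l.
  + by move=> [] /root_chain_expr_inj ->.
  + by move=> [/z0].
  + by move=> [/esym/z0].
  + by move=> [] /root_chain_expr_inj ->.
- move=> q; rewrite /= QE => -[] [v /root_chain_expr[i ->] <-].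
    by exists (cast_ord (esym e2) (unsplit (inl i))); rewrite /u cast_ordKV unsplitK.
  by exists (cast_ord (esym e2) (unsplit (inr i))); rewrite /u cast_ordKV unsplitK.
Qed.

(** [p] identifies the orbit space of the stabilizer on the twin sets of [K] with the cube on [M],
    as a set. *)
Definition orbit_index M (p : set X -> M -> bool) :=
  (forall D D', twins_of K D -> twins_of K D' ->
     p D = p D' <-> exists2 x, stab K x & D' = left_shift x D) /\
  forall f, exists2 D, twins_of K D & p D = f.

Lemma orbit_structure_inj M (p : set X -> M -> bool) h D D' : orbit_structure K p h ->
  twins_of K D -> twins_of K D' -> p D = p D' -> square K ((h D)^-1 * h D') -> D = D'.
Proof.
move=> [_ _ _ _ [inv _ _]] KD KD' pp hh; apply/funext => y; apply/propext.
by have [F _ FP] := inv D y KD; apply: FP => // m _; rewrite pp.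
Qed.

(** By equivariance of [h], the shift of [D] by [h D' (h D)^-1] has the coordinates of [D']. *)
Lemma orbit_structure_index M (p : set X -> M -> bool) h :
  orbit_structure K p h -> orbit_index p.
Proof.
move=> st; have [hs hsh psh surj _] := st.
split=> [D D' KD KD'|f]; last by have [D [KD Df _]] := surj f 1 (stab1 K); exists D.
split=> [pp|[x sx ->]]; last by rewrite psh.
exists (h D' * (h D)^-1).
  by apply: stabM; [exact: hs|apply: stabV; exact: hs].
have sx : stab K (h D' * (h D)^-1) by apply: stabM; [exact: hs|apply: stabV; exact: hs].
apply: (orbit_structure_inj st) => //; first exact: twins_of_shift.
  by rewrite psh.
have := squareV cK (hsh D _ KD sx); rewrite mulgVK.
by rewrite invgM invgK.
Qed.

Section InfiniteOrbits.
Variable T : countType.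
Variables (t : T -> X) (sigma : nat -> X).
Hypothesis t_stab : forall c, stab K (t c).
Hypothesis t_rep : forall x, stab K x -> exists c, square K ((t c)^-1 * x).
Hypothesis sigma_stab : forall n, stab K (sigma n).
Hypothesis sigma_inj : forall n m, plus_minus K (sigma n * (sigma m)^-1) -> n = m.

Let Y := set_type [set x : X | coset_rep K x = x].

(** [Y] represents the cosets of [plus_minus K]. Those inside one coset of [stab K] are indexed by
    the countable [T] and include the infinitely many given by [sigma]. So the index of [y] and an
    element of [T] are stored in one number [n], and [sigma n] picks a coset in the block of [y]. *)
Lemma cosets_absorb : exists f : Y * T -> Y, injective f.
Proof.
pose rN (x : X) : X := xget 1 [set y | stab K (y * x^-1)].
have rNP x : stab K (rN x * x^-1).
  apply: (@xgetPex _ 1 [set y | stab K (y * x^-1)]).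
  by exists x; rewrite /= mulgV; exact: stab1.
have rN_eq x y : stab K (x * y^-1) -> rN x = rN y.
  move=> xy; rewrite /rN; congr xget; apply/funext => u /=; apply/propext.
  split=> h; first by have := stabM h xy; rewrite mulgA mulgVK.
  by have := stabM h (stabV xy); rewrite invgM invgK mulgA mulgVK.
have rNK x : rN (rN x) = rN x by exact: rN_eq.
have /choice [ind indP] : forall x, exists c, square K ((t c)^-1 * (x * (rN x)^-1)).
  by move=> x; apply: t_rep; have := stabV (rNP x); rewrite invgM invgK.
pose g (p : Y * T) : X := sigma (pickle (ind (\val p.1), p.2)) * rN (\val p.1).
have gY p : coset_rep K (coset_rep K (g p)) = coset_rep K (g p) by exact: coset_repK.
exists (fun p => exist _ (coset_rep K (g p)) (mem_set (gY p))).
move=> [y c] [y' c'] /(congr1 \val) /= gg.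
have pm : plus_minus K (g (y, c) * (g (y', c'))^-1).
  have h1 := coset_repP' cK (g (y, c)); have h2 := coset_repP cK (g (y', c')).
  by have := plus_minusM cK h1 h2; rewrite -gg mulgA mulgVK.
have rr : rN (\val y) = rN (\val y').
  have gr q : rN (g q) = rN (\val q.1).
    rewrite -[RHS]rNK; apply: rN_eq; rewrite /g mulgK; exact: sigma_stab.
  by rewrite -(gr (y, c)) -(gr (y', c')); apply: rN_eq; exact: plus_minus_stab.
move: pm; rewrite /g /= rr invgM mulgA mulgK => /sigma_inj/(pcan_inj pickleK) [ii cc'].
congr pair => //; apply: val_inj.
have yr := set_mem (valP y); have yr' := set_mem (valP y'); rewrite /= in yr yr'.
rewrite -[LHS]yr -[RHS]yr'; apply: coset_rep_eq => //; right.
have s1 := indP (\val y); have s2 := indP (\val y'); rewrite -ii -rr in s2.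
set a := t _ in s1 s2; set r := rN _ in s1 s2.
have -> : \val y * (\val y')^-1 =
    a * (a^-1 * (\val y * r^-1) * (a^-1 * (\val y' * r^-1))^-1) * a^-1.
  by rewrite !invgM !invgK -!mulgA mulVKg mulgV mulg1 mulKg.
apply/stab_square_conj; first exact: t_stab.
by apply: squareM => //; exact: squareV.
Qed.

(* König's diagonal argument: an orbit space whose product with a countable
   set maps onto [2^Y = (2^Y)^T] maps onto [2^Y]. *)
Lemma infinite_orbit_index : exists M (p : set X -> M -> bool), orbit_index p.
Proof.
have [j jI] := cosets_absorb.
pose orb (D : set X) : set (set X) := [set left_shift x D | x in stab K].
pose rep (D : set X) : set X := xget set0 (orb D).
have orbD D : orb D D by exists 1; [exact: stab1|exact: left_shift1].
have repP D : exists2 x, stab K x & left_shift x D = rep D.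
  by apply: (@xgetPex _ set0 (orb D)); exists D.
have orb_shift x D : stab K x -> orb (left_shift x D) = orb D.
  move=> sx; apply/seteqP; split=> _ [y sy <-].
    by exists (y * x); [exact: stabM|rewrite left_shiftM].
  exists (y * x^-1); first by apply: stabM => //; exact: stabV.
  by rewrite left_shiftM mulgVK.
have rep_shift x D : stab K x -> rep (left_shift x D) = rep D.
  by move=> sx; rewrite /rep orb_shift.
have Krep D : twins_of K D -> twins_of K (rep D).
  by move=> KD; have [x sx <-] := repP D; exact: twins_of_shift.
have repK D : rep (rep D) = rep D.
  by have [x sx xD] := repP D; rewrite -{1}xD rep_shift.
pose v (D : set X) (y : Y) : bool := `[< D (\val y) >].
have vI D D' : twins_of K D -> twins_of K D' -> v D = v D' -> D = D'.
  move=> KD KD' vv; apply/funext => x; apply/propext.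
  apply: (twins_of_eq_at cK) => //.
  have rr : coset_rep K (coset_rep K x) = coset_rep K x by exact: coset_repK.
  pose y0 : Y := exist _ (coset_rep K x) (mem_set (rr : [set x | coset_rep K x = x] _)).
  have := congr1 (fun f : Y -> bool => f y0) vv.
  by rewrite /v /= => e; split=> /asboolP; [rewrite e|rewrite -e] => /asboolP.
have vS (f : Y -> bool) : exists2 D, twins_of K D & v D = f.
  exists (twin_of_choice K (fun x => exists y, \val y = x /\ f y)).
    exact: twin_of_choiceP.
  apply/funext => y; rewrite /v; have yr := set_mem (valP y); rewrite /= in yr.
  have := twin_of_choice_rep cK (fun x => exists y, \val y = x /\ f y) (\val y).
  rewrite yr => H; apply/asboolP/idP => [/H [y' [/val_inj -> //]]|fy].
  by apply/H; exists y.
(* The translate [t c (rep D)], an element of [2^Y], is decoded along [j] into a [T]-indexed family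
   of elements of [2^Y]. *)
pose G c D : T -> Y -> bool := fun c' y => v (left_shift (t c) (rep D)) (j (y, c')).
have Gsurj (f : T -> Y -> bool) : exists c D, twins_of K D /\ G c D = f.
  pose f' (y : Y) : bool := `[< exists c y', j (y', c) = y /\ f c y' >].
  have [D KD vD] := vS f'.
  have [x sx xD] := repP D; have [c tc] := t_rep (stabV sx).
  exists c, D; split=> //; apply/funext => c'; apply/funext => y; rewrite /G.
  have -> : left_shift (t c) (rep D) = D.
    have := twins_of_square cK (Krep D KD) tc; rewrite -left_shiftM => /(congr1 (left_shift (t c))).
    by rewrite left_shiftVK -xD left_shiftK.
  rewrite vD /f'; apply/asboolP/idP => [[c2 [y2 [/jI [-> ->] //]]]|fy].
  by exists c', y.
(* If for every [c] the [c]-th component missed some [f c], the family [f] would not be of the form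
   [G c D]. *)
have [c csurj] : exists c, forall f, exists2 D, twins_of K D & G c D c = f.
  apply: contrapT => no.
  have /choice [f fP] : forall c, exists f, forall D, twins_of K D -> G c D c <> f.
    move=> c; apply: contrapT => nf; apply: no; exists c => f.
    apply: contrapT => nD; apply: nf; exists f => D KD Gf; apply: nD; by exists D.
  have [c [D [KD GD]]] := Gsurj f.
  by apply: (fP c D KD); rewrite GD.
pose W := [set D | twins_of K D /\ rep D = D].
(* [W] contains one set per orbit; it maps onto [2^Y] by that component and embeds into [2^Y] by
   [v]. *)
have WY : (W #= [set: Y -> bool])%card.
  apply: Cantor_Bernstein; last first.
    have <- : (fun D => G c D c) @` W = [set: Y -> bool].
      apply/seteqP; split=> // f _; have [D KD <-] := csurj f.
      by exists (rep D); [split; [exact: Krep|exact: repK]|rewrite /G repK].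
    exact: card_image_le.
  have vW : {in W &, injective v}.
    by move=> D D'; rewrite !inE => -[KD _] [KD' _]; exact: vI.
  by rewrite -(card_le_eql (inj_card_eq vW)); exact: card_leT.
have [p0 p0bij] := card_bijP WY.
pose p D (m : Y) : bool := if pselect (W (rep D)) is left w
  then \val (p0 (exist _ (rep D) (mem_set w))) m else false.
have Wrep D : twins_of K D -> W (rep D) by move=> KD; split; [exact: Krep|exact: repK].
have pE D (w : W (rep D)) : p D = \val (p0 (exist _ (rep D) (mem_set w))).
  rewrite /p; case: pselect => // w'.
  by apply/funext => m; congr (\val (p0 (exist _ _ _)) m); exact: bool_irrelevance.
exists Y, p; split=> [D D' KD KD'|f].
  split=> [|[x sx ->]]; last first.
    by apply/funext => m; rewrite /p rep_shift.
  rewrite (pE _ (Wrep D KD)) (pE _ (Wrep D' KD')) => /val_inj/(bij_inj p0bij)/(congr1 \val) /= rr.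
  have [x sx xD] := repP D; have [y sy yD'] := repP D'.
  exists (y^-1 * x); first by apply: stabM => //; exact: stabV.
  by rewrite -left_shiftM xD rr -yD' left_shiftK.
have [p1 p01 p10] := p0bij.
pose D := p1 (exist _ f (mem_set I)).
have [KD DD] := set_mem (valP D).
exists (\val D) => //.
have w := Wrep _ KD; rewrite (pE _ w).
have -> : exist _ (rep (\val D)) (mem_set w) = D by exact: val_inj.
by rewrite p10.
Qed.
End InfiniteOrbits.

Lemma root_chain_inj n m : root_chain R n = root_chain R m -> n = m.
Proof.
have lt i j : root_chain R i = root_chain R j -> (i < j.+1)%N.
  by move=> e; rewrite -(root_chain_eq1 R) e root_chain_eq1.
by move=> e; apply/eqP; rewrite eqn_leq; apply/andP; split; apply: lt.
Qed.

Lemma qfst_quatM00 (p : quat R) (c : R[i]) : qfst (p * Quat c 0%R) = (qfst p * c)%R.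
Proof. by change (qfst p * c - qsnd p * conjc 0 = qfst p * c)%R; rewrite rmorph0 mulr0 subr0. Qed.

Lemma infinite_type_index (S : set (quat R)) :
  alg_isomorphic (characteristic_group K) S ->
  (forall q, S q -> exists n k (b : bool), q = if b then Quat (root_chain R n ^+ k)%R 0%R
    else Quat 0%R (root_chain R n ^+ k)%R) ->
  (forall n, S (Quat (root_chain R n) 0%R)) ->
  exists M (p : set X -> M -> bool), orbit_index p.
Proof.
move=> /characteristic_iso_data [phi [phiS phiM phiI phisurj]] Sroot rootS.
pose q (c : nat * nat * bool) : quat R :=
  let r := (root_chain R c.1.1 ^+ c.1.2)%R in if c.2 then Quat r 0%R else Quat 0%R r.
have /choice [t tP] : forall c, exists x, stab K x /\ (S (q c) -> phi x = q c).
  move=> c; have [/phisurj [x sx xc]|nS] := pselect (S (q c)); first by exists x.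
  by exists 1; split=> //; exact: stab1.
(* Elements of [plus_minus K] square to 1 in the characteristic group, so only squares of roots are
   distinguished; the index [n.+1] makes them the distinct [root_chain R n]. *)
have /choice [s sP] : forall n, exists x, stab K x /\ phi x = Quat (root_chain R n.+1) 0%R.
  by move=> n; have [x sx xn] := phisurj _ (rootS n.+1); exists x.
apply: (infinite_orbit_index (t := t) (sigma := s)) => [c|x sx|n|n m].
- by have [] := tP c.
- have [n [k [b pE]]] := Sroot _ (phiS x sx); exists (n, k, b).
  have [st tE] := tP (n, k, b); apply/phiI => //; rewrite tE ?/q //= -pE //; exact: phiS.
- by have [] := sP n.
have [[sn nE] [sm mE]] := (sP n, sP m); set w := s n * (s m)^-1 => pm.
have sw : stab K w by exact: plus_minus_stab.
have ww : square K (w * w).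
  by case: pm => kw; [apply/squareP; exists w, w|exact: squareM].
have wn : phi w * phi (s m) = phi (s n) by rewrite -phiM // mulgVK.
have wm : phi w * phi (s n) = phi (s m).
  rewrite -phiM //; apply/phiI => //; first exact: stabM.
  rewrite -[s n](mulgVK (s m)) -/w mulgA invgM -mulgA.
  have := (stab_square_conj (w * w)^-1 (stabV sm)).2 (squareV cK ww).
  by rewrite invgK -mulgA.
have := congr1 (fun p => qfst p) wn; have := congr1 (fun p => qfst p) wm.
rewrite nE mE !qfst_quatM00 => h2 h1.
apply/root_chain_inj; rewrite -[LHS]root_chainS -[RHS]root_chainS !expr2.
have key (a c d : R[i]) : (a * c = d -> a * d = c -> c * c = d * d)%R.
  by move=> e1 e2; rewrite -{1}e2 mulrAC e1.
exact: key h2 h1.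
Qed.

Definition finite_type :=
  (exists2 n, (1 <= n)%N & alg_isomorphic (characteristic_group K) (C2 R (Fin n))) \/
  (exists2 n, (3 <= n)%N & alg_isomorphic (characteristic_group K) (Q2 R (Fin n))).

Lemma finite_type_orbit_structure : finite_type ->
  exists M (p : set X -> M -> bool) h, orbit_structure K p h.
Proof.
move=> fin.
have [b [t [t_stab t_rep t_inj]]] : exists b (t : 'I_(2 ^ b) -> X), [/\ forall i, stab K (t i),
    forall x, stab K x -> exists i, square K ((t i)^-1 * x) &
    forall i j, square K ((t i)^-1 * t j) -> i = j].
  case: fin => -[].
    by move=> [//|n] _ /enumerate_C2.
  by move=> [|[|[|n]]] // _ /enumerate_Q2.
exact: (finite_orbit_structure mK t_stab t_rep t_inj).
Qed.

Lemma maximal_orbit_index : exists M (p : set X -> M -> bool), orbit_index p.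
Proof.
have fin : finite_type -> exists M (p : set X -> M -> bool), orbit_index p.
  by move=> /finite_type_orbit_structure[M [p [h /orbit_structure_index]]]; exists M, p.
have rootC2 n k : @C2n R n.+1 (Quat (root_chain R n ^+ k)%R 0%R).
  by exists (root_chain R n ^+ k)%R => //; exact: root_chain_expr1.
have CE q n : @C2n R n q -> exists n' k, q = Quat (root_chain R n' ^+ k)%R 0%R.
  case: n => [|n]; last by move=> [v /root_chain_expr[i ->] <-]; exists n, i.
  move=> [v]; rewrite /= expn0 expr1 => -> <-; exists 0%N, 0%N; by rewrite expr0.
have [[[n|] k1 iso]|[[n|] k3 iso]] := characteristic_group_type mK R.
- by apply: fin; left; exists n.
- apply: (infinite_type_index iso) => [q [n _ /CE[n' [k ->]]]|n].
    by exists n', k, true.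
  by exists n.+1 => //; have := rootC2 n 1%N; rewrite expr1.
- by apply: fin; right; exists n.
apply: (infinite_type_index iso) => [q [[|[|[|n]]] //= _]|n].
  rewrite Q2nE // => -[] [v /root_chain_expr[i ->] <-].
    by exists n.+1, i, true.
  by exists n.+1, i, false.
exists n.+3 => //; rewrite Q2nE //; left; exists (root_chain R n) => //=.
have := root_chain_expr1 n 1; rewrite expr1 => e.
by rewrite expnS mulnC exprM e expr1n.
Qed.
End Enumeration.

(** * Coordinatewise continuity *)

Section CoordinatewiseContinuity.
Context {T : topologicalType}.
Implicit Types (S : set T) (s : T).

Lemma finite_nbhs {I : choiceType} (F : set I) (P : I -> set T) s : finite_set F ->
  (forall i, F i -> nbhs s (P i)) -> nbhs s [set t | forall i, F i -> P i t].
Proof.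
move=> /finite_fsetP[D ->] FP.
exact: (@filter_bigI _ _ D P (nbhs s) (nbhs_filter s) FP).
Qed.

Lemma nbhs_all (x : T) (P : set T) : (forall t, P t) -> nbhs x P.
Proof. by move=> Pt; apply: (@nearW _ _ P (nbhs_filter x)). Qed.

Definition continuous_on {U : topologicalType} S (f : T -> U) :=
  forall s, S s -> f @ within S (nbhs s) --> f s.

Lemma prod_continuous_on {I : Type} {U : I -> topologicalType} S (f : T -> prod_topology U) :
  (forall i, continuous_on S (fun s => f s i)) -> continuous_on S f.
Proof.
move=> fi s Ss; apply/cvg_sup => i A /= [B [[C oC CB] Bs] BA].
rewrite -CB in Bs BA.
have : nbhs s [set t | S t -> C (f t i)] := fi i s Ss C (open_nbhs_nbhs (conj oC Bs)).
by apply: filterS => t Ct St; exact/BA/Ct.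
Qed.

Lemma discrete_continuous_on {U : choiceType} S (f : T -> discrete_topology U) :
  (forall s, S s -> nbhs s [set t | S t -> f t = f s]) -> continuous_on S f.
Proof.
move=> fS s Ss A /= As; have := fS s Ss; apply: filterS => t ft St /=.
by rewrite /= ft //; exact: (nbhs_singleton As).
Qed.

Lemma bool_continuous_on S (f : T -> bool) :
  (forall s, S s -> nbhs s [set t | S t -> f t = f s]) -> continuous_on S f.
Proof.
move=> fS s Ss A /= As; have := fS s Ss; apply: filterS => t ft St /=.
by rewrite /= ft //; exact: (nbhs_singleton As).
Qed.

Lemma pair_continuous_on {U V : topologicalType} S (f : T -> U) (g : T -> V) :
  continuous_on S f -> continuous_on S g -> continuous_on S (fun s => (f s, g s)).
Proof. by move=> fc gc s Ss; apply: cvg_pair; [exact: fc|exact: gc]. Qed.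

Lemma within_continuous_on {U : topologicalType} S (f : T -> U) :
  continuous_on S f <-> {within S, continuous f}.
Proof. by split=> h; apply/subspace_continuousP. Qed.

End CoordinatewiseContinuity.

Lemma comp_continuous_on {T U V : topologicalType} (S : set T) (U' : set U) (f : T -> U) (g : U -> V) :
  (forall s, S s -> U' (f s)) -> continuous_on S f -> continuous_on U' g ->
  continuous_on S (g \o f).
Proof.
move=> fS fc gc s Ss A /(gc _ (fS _ Ss)) gA.
have : nbhs s [set t | S t -> U' (f t) -> A (g (f t))] := fc s Ss _ gA.
by apply: filterS => t h St; apply: h => //; exact: fS.
Qed.

Lemma prod_coordinate_nbhs {I : Type} {U : I -> topologicalType} (f : prod_topology U) i
  (A : set (U i)) : nbhs (f i) A -> nbhs f [set g | A (g i)].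
Proof.
rewrite nbhsE => -[B [oB Bf] BA].
have /cvg_sup/(_ i) : nbhs f --> f by exact: cvg_id.
apply; exists ((fun g => g i) @^-1` B); split=> //; first by exists B.
by move=> g Bg; exact: BA.
Qed.

Lemma top_isomorphic_trans {T U V : preTopologicalSemigroupType}
  (S1 : set T) (S2 : set U) (S3 : set V) :
  top_isomorphic S1 S2 -> top_isomorphic S2 S3 -> top_isomorphic S1 S3.
Proof.
move=> [f [f' [[[fS fI fs] fM] fK /within_continuous_on fc /within_continuous_on f'c]]].
move=> [g [g' [[[gS gI gs] gM] gK /within_continuous_on gc /within_continuous_on g'c]]].
have g'S s : S3 s -> S2 (g' s).
  by move=> /gs [u Su <-]; rewrite gK ?inE.
exists (g \o f), (f' \o g'); split.
- split; [split|].
  + by move=> s Ss; apply: gS; exact: fS.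
  + move=> s t; rewrite !inE => Ss St /= /gI gg; apply: fI; rewrite ?inE //.
    by apply: gg; rewrite inE; exact: fS.
  + by move=> u /gs [v /fs [w Sw <-] <-]; exists w.
  + by move=> s t; rewrite !inE => Ss St /=; rewrite fM ?inE // gM ?inE //; exact: fS.
- by move=> s; rewrite inE => Ss /=; rewrite gK ?inE ?fK ?inE //; exact: fS.
- by apply/within_continuous_on; apply: comp_continuous_on fc gc.
- by apply/within_continuous_on; apply: comp_continuous_on g'c f'c.
Qed.

Section DoublePowerTopology.
Context {X : groupType}.
Implicit Types (S : set (double_power X)) (A : set X).

Lemma double_power_nbhs (s : double_power X) A : nbhs s [set t : double_power X | t A <-> s A].
Proof.
have : nbhs (s A : discrete_topology Prop) [set s A] by exact: discrete_set1.
move=> /(@prod_coordinate_nbhs (set X) (fun=> discrete_topology Prop) s A).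
apply: (@filterS _ (nbhs s)) => t e.
by have {}e : t A = s A := e; rewrite /= e.
Qed.

Lemma double_power_continuous_on {T : topologicalType} (S : set T) (f : T -> double_power X) :
  (forall s A, S s -> nbhs s [set t | S t -> (f t A <-> f s A)]) -> continuous_on S f.
Proof.
move=> fS; apply: (@prod_continuous_on _ (set X) (fun=> discrete_topology Prop)) => A.
apply: discrete_continuous_on => s Ss; have := fS s A Ss.
by apply: filterS => t ft St; apply/propext; exact: ft.
Qed.

Lemma right_mul_continuous_on S (a : double_power X) : continuous_on S (fun s => s * a).
Proof.
apply: double_power_continuous_on => s A Ss.
apply: filterS (double_power_nbhs s [set x | a (left_shift x^-1 A)]) => t sa _.
exact: sa.
Qed.

(** The last hypothesis makes membership of each [A] locally constant on the image, which is
    continuity of the inverse for the product topology. *)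
Lemma top_isomorphic_double_power {U : preTopologicalSemigroupType} S (S' : set U)
  (f : double_power X -> U) : isomorphism S S' f -> continuous_on S f ->
  (forall s A, S s -> nbhs (f s) [set t | forall s', S s' -> f s' = t -> (s' A <-> s A)]) ->
  top_isomorphic S S'.
Proof.
move=> iso fc fo; have [[fS fI fs] fM] := iso.
pose g t : double_power X := xget set0 [set s | S s /\ f s = t].
have gP t : S' t -> S (g t) /\ f (g t) = t.
  move=> /fs [s Ss st]; apply: (@xgetPex _ set0 [set s | S s /\ f s = t]).
  by exists s.
exists f, g; split=> //; last 2 first.
- by apply/within_continuous_on.
- apply/within_continuous_on; apply: double_power_continuous_on => t A St.
  have [Sg fg] := gP t St; have := fo (g t) A Sg; rewrite fg.
  by apply: filterS => u h Su; have [Sgu fgu] := gP u Su; exact: h.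
move=> s; rewrite inE => Ss; have [Sg fg] := gP _ (fS _ Ss).
by apply: fI; rewrite ?inE.
Qed.

(* The two idempotents generate the same right ideal. *)
Lemma corner_right_isomorphic (S : set (double_power X)) c e :
  (forall s t, S s -> S t -> S (s * t)) -> S c -> S e -> e * e = e -> c * c = c ->
  c * e = e -> e * c = c -> top_isomorphic (corner S c) (corner S e).
Proof.
move=> SM Sc Se ee cc ce ec.
exists (fun s => s * e), (fun s => s * c); split.
- split; [split|].
  + move=> s [Ss cs sc]; split; [exact: SM| |by rewrite -mulgA ee].
    by rewrite -{1}cs !mulgA ec cs.
  + move=> s t; rewrite !inE => -[_ _ sc] [_ _ tc] /(congr1 (fun s => s * c)).
    by rewrite -!mulgA ec sc tc.
  + move=> s [Ss es se]; exists (s * c); last by rewrite -mulgA ce.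
    split; [exact: SM| |by rewrite -mulgA cc].
    by rewrite -{1}es !mulgA ce es.
  + move=> s t; rewrite !inE => -[_ _ sc] [_ ct _].
    by rewrite -[in RHS]mulgA [in RHS](mulgA e) -{2}ct [in RHS](mulgA e) ec ct !mulgA.
- by move=> s; rewrite inE => -[_ _ sc]; rewrite -mulgA ec.
- by apply/within_continuous_on; exact: right_mul_continuous_on.
- by apply/within_continuous_on; exact: right_mul_continuous_on.
Qed.
End DoublePowerTopology.

(** * Coordinates on minimal left ideals *)

Section OrbitRepresentatives.
Variable X : groupType.
Implicit Types K : set X.

Lemma cogroup_orbit_conjugate x K : cogroup_orbit (conjugate x K) = cogroup_orbit K.
Proof.
apply/seteqP; split=> _ [y _ <-].
  by exists (y * x) => //; rewrite conjugateM.
by exists (y * x^-1) => //; rewrite -conjugateM conjugateK.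
Qed.

Definition maximal_orbits : set (set (set X)) :=
  [set cogroup_orbit K | K in maximal_2cogroups X].

Definition orbit_rep (j : maximal_orbits) : set X := xget set0 (\val j).

Lemma orbit_repP j : maximal_2cogroups X (orbit_rep j) /\ cogroup_orbit (orbit_rep j) = \val j.
Proof.
have [K mK KE] := set_mem (valP j).
have Kj : \val j (orbit_rep j).
  apply: (@xgetPex _ set0 (\val j)); rewrite -KE; exists K; exists 1 => //; exact: conjugate1.
move: Kj; rewrite -KE => -[x _ <-].
by split; [exact: conjugate_maximal|exact: cogroup_orbit_conjugate].
Qed.

Lemma orbit_rep_maximal j : maximal_2cogroups X (orbit_rep j).
Proof. exact: (orbit_repP j).1. Qed.

Lemma orbit_rep_surj K : maximal_2cogroups X K -> exists j x, K = conjugate x (orbit_rep j).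
Proof.
move=> mK; have oK : maximal_orbits (cogroup_orbit K) by exists K.
pose j : maximal_orbits := exist _ (cogroup_orbit K) (mem_set oK).
have [_ jE] := orbit_repP j.
have : cogroup_orbit (orbit_rep j) K by rewrite jE; exists 1 => //; exact: conjugate1.
by move=> [x _ xK]; exists j, x.
Qed.

Lemma orbit_rep_inj i j x : orbit_rep i = conjugate x (orbit_rep j) -> i = j.
Proof.
move=> e; apply: val_inj; rewrite -(orbit_repP i).2 -(orbit_repP j).2 e.
exact: cogroup_orbit_conjugate.
Qed.

Lemma characteristic_groupM K : is_2cogroup K -> forall S S',
  characteristic_group K S -> characteristic_group K S' -> characteristic_group K (S * S').
Proof. by move=> /subgroup_characteristic[]. Qed.

Lemma q_orbits_maximal {T : semigroupType} (G : set T) : q_orbits X G `<=` maximal_orbits.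
Proof. by move=> _ [K [mK _] <-]; exists K. Qed.

Definition q_index {T : semigroupType} {G : set T} (o : q_orbits X G) : maximal_orbits :=
  exist _ (\val o) (mem_set (q_orbits_maximal (set_mem (valP o)))).

Lemma q_orbitsP {T : semigroupType} (G : set T) j :
  q_orbits X G (\val j) <-> alg_isomorphic (characteristic_group (orbit_rep j)) G.
Proof.
have [mj jE] := orbit_repP j.
split=> [[K [mK isoG]]|isoG]; last by exists (orbit_rep j).
rewrite -jE => e; have : cogroup_orbit K (orbit_rep j).
  by rewrite e; exists 1 => //; exact: conjugate1.
move=> [x _ <-]; apply: alg_isomorphic_trans isoG.
have := @characteristic_conjugate _ x^-1 _ (conjugate_cogroup x mK.1).
by rewrite conjugateK.
Qed.
End OrbitRepresentatives.

Arguments maximal_orbits X : clear implicits.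

(** * Types of orbits and the product of model groups *)

Section Types.
Variables (X : groupType) (R : realType).
Local Notation J := (maximal_orbits X).
Local Notation K := (@orbit_rep X).

Definition type_group (t : bool * exponent) : set (quat R) :=
  if t.1 then C2 R t.2 else Q2 R t.2.

Definition type_range (I1 I3 : set exponent) (t : bool * exponent) : Prop :=
  if t.1 then I1 t.2 else I3 t.2.

Definition has_type (j : J) t :=
  type_range (range_inf 1) (range_inf 3) t /\
  alg_isomorphic (characteristic_group (K j)) (type_group t).

Lemma has_type_ex j : exists t, has_type j t.
Proof.
have [[k k1 iso]|[k k3 iso]] := characteristic_group_type (orbit_rep_maximal j) R.
  by exists (true, k).
by exists (false, k).
Qed.

Lemma has_type_unique j t t' : has_type j t -> has_type j t' -> t = t'.
Proof.
have SM := characteristic_groupM (orbit_rep_maximal j).1.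
move: t t' => [[] k] [[] l] [k0 iso] [l0 iso'].
- by congr pair; exact: C2_type_inj SM _ _ iso iso'.
- by case: (C2_Q2_disjoint SM l0 iso iso').
- by case: (C2_Q2_disjoint SM k0 iso' iso).
- by congr pair; exact: Q2_type_inj SM _ _ iso iso'.
Qed.

Section Pack.
Variables I1 I3 : set exponent.
Hypothesis I1_inf : I1 `<=` range_inf 1.
Hypothesis I3_inf : I3 `<=` range_inf 3.
Hypothesis I_type : forall j, exists2 t, has_type j t & type_range I1 I3 t.

Local Notation PC := (power_product_ambient X I1 (C2 R)).
Local Notation PQ := (power_product_ambient X I3 (Q2 R)).
Local Notation PP := (power_product X I1 (C2 R) `*` power_product X I3 (Q2 R)).

(** Regroups one coordinate per orbit into two products indexed by type. The ranges [I1] and [I3]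
    are parameters so that the cases with and without infinite types share the proofs. *)
Definition pack (a : J -> quat R) : PC * PQ :=
  (fun k o => a (q_index o), fun k o => a (q_index o)).

Lemma q_index_type_C (k : I1) (o : q_orbits X (C2 R (\val k))) :
  has_type (q_index o) (true, \val k).
Proof.
split; first by apply: I1_inf; exact: (set_mem (valP k)).
by apply/q_orbitsP; exact: (set_mem (valP o)).
Qed.

Lemma q_index_type_Q (k : I3) (o : q_orbits X (Q2 R (\val k))) :
  has_type (q_index o) (false, \val k).
Proof.
split; first by apply: I3_inf; exact: (set_mem (valP k)).
by apply/q_orbitsP; exact: (set_mem (valP o)).
Qed.

Lemma q_index_ex j : (exists (k : I1) (o : q_orbits X (C2 R (\val k))), q_index o = j) \/
  (exists (k : I3) (o : q_orbits X (Q2 R (\val k))), q_index o = j).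
Proof.
have [[[] k] [_ iso] kI] := I_type j; [left|right].
  have oj : q_orbits X (C2 R k) (\val j) by apply/q_orbitsP.
  exists (exist _ k (mem_set kI)), (exist _ (\val j) (mem_set oj)); exact: val_inj.
have oj : q_orbits X (Q2 R k) (\val j) by apply/q_orbitsP.
exists (exist _ k (mem_set kI)), (exist _ (\val j) (mem_set oj)); exact: val_inj.
Qed.

Lemma packP a : (forall j t, has_type j t -> type_group t (a j)) -> PP (pack a).
Proof.
move=> aG; split=> k o /=; [exact: (aG _ _ (q_index_type_C o))|].
exact: (aG _ _ (q_index_type_Q o)).
Qed.

Lemma pack_inj a b : pack a = pack b -> a = b.
Proof.
move=> [abC abQ]; apply/funext => j.
case: (q_index_ex j) => -[k [u <-]].
  exact: (congr1 (fun f : PC => f k u) abC).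
exact: (congr1 (fun f : PQ => f k u) abQ).
Qed.

(** By uniqueness of types each orbit occurs exactly once among the factors, so its value is
    assigned unambiguously. *)
Lemma pack_surj t : PP t -> exists2 a, (forall j t, has_type j t -> type_group t (a j)) & pack a = t.
Proof.
case: t => f g [/= fS gS].
have /choice [a aP] : forall j, exists q : quat R,
    [/\ forall (k : I1) (o : q_orbits X (C2 R (\val k))), q_index o = j -> q = f k o,
        forall (k : I3) (o : q_orbits X (Q2 R (\val k))), q_index o = j -> q = g k o &
        forall t, has_type j t -> type_group t q].
  move=> j; case: (q_index_ex j) => -[k [] o oj].
    have tj := q_index_type_C o; rewrite oj in tj; exists (f k o); split.
    - move=> k' o' o'j; have := q_index_type_C o'; rewrite o'j => /(has_type_unique tj) [].
      move=> /val_inj kk; move: o' o'j; rewrite -kk => o' o'j; congr (f k _).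
      by apply: val_inj; have := congr1 \val oj; rewrite -o'j.
    - by move=> k' o' o'j; have := q_index_type_Q o'; rewrite o'j => /(has_type_unique tj).
    - by move=> t /(has_type_unique tj) <-; exact: fS.
  have tj := q_index_type_Q o; rewrite oj in tj; exists (g k o); split.
  - by move=> k' o' o'j; have := q_index_type_C o'; rewrite o'j => /(has_type_unique tj).
  - move=> k' o' o'j; have := q_index_type_Q o'; rewrite o'j => /(has_type_unique tj) [].
    move=> /val_inj kk; move: o' o'j; rewrite -kk => o' o'j; congr (g k _).
    by apply: val_inj; have := congr1 \val oj; rewrite -o'j.
  - by move=> t /(has_type_unique tj) <-; exact: gS.
exists a; first by move=> j; have [] := aP j.
congr pair; apply: functional_extensionality_dep => k; apply: functional_extensionality_dep => o.
  by have [h _ _] := aP (q_index o); exact: h.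
by have [_ h _] := aP (q_index o); exact: h.
Qed.

Lemma pack_continuous_on {T : topologicalType} (S : set T) (a : T -> J -> quat R) :
  (forall j s, S s -> nbhs s [set s' | S s' -> a s' j = a s j]) ->
  continuous_on S (fun s => pack (a s)).
Proof.
move=> ac; apply: pair_continuous_on.
  apply: (@prod_continuous_on _ _ (fun k : I1 => prod_topology
    (fun _ : q_orbits X (C2 R (\val k)) => discrete_topology (quat R)))) => k.
  apply: prod_continuous_on => o; apply: discrete_continuous_on => s Ss; exact: ac.
apply: (@prod_continuous_on _ _ (fun k : I3 => prod_topology
  (fun _ : q_orbits X (Q2 R (\val k)) => discrete_topology (quat R)))) => k.
apply: prod_continuous_on => o; apply: discrete_continuous_on => s Ss; exact: ac.
Qed.

Lemma pack_nbhs a j : nbhs (pack a) [set t | forall b, pack b = t -> b j = a j].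
Proof.
case: (q_index_ex j) => -[k [] u uj].
  have : nbhs (pack a) [set t : PC * PQ | [set a j : discrete_topology (quat R)] (t.1 k u)].
    apply: (@cvg_fst _ _ (nbhs (pack a).1) (nbhs (pack a).2) _
      [set f : PC | [set a j : discrete_topology (quat R)] (f k u)]).
    apply: (@prod_coordinate_nbhs _ (fun k : I1 => prod_topology
      (fun _ : q_orbits X (C2 R (\val k)) => discrete_topology (quat R))) (pack a).1 k
      [set f | [set a j : discrete_topology (quat R)] (f u)]).
    apply: (@prod_coordinate_nbhs _ (fun _ => discrete_topology (quat R)) ((pack a).1 k)).
    by rewrite /= uj; exact: discrete_set1.
  by apply: filterS => t tj b bt; rewrite -tj -bt /= uj.
have : nbhs (pack a) [set t : PC * PQ | [set a j : discrete_topology (quat R)] (t.2 k u)].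
  apply: (@cvg_snd _ _ (nbhs (pack a).1) (nbhs (pack a).2) _
    [set f : PQ | [set a j : discrete_topology (quat R)] (f k u)]).
  apply: (@prod_coordinate_nbhs _ (fun k : I3 => prod_topology
    (fun _ : q_orbits X (Q2 R (\val k)) => discrete_topology (quat R))) (pack a).2 k
    [set f | [set a j : discrete_topology (quat R)] (f u)]).
  apply: (@prod_coordinate_nbhs _ (fun _ => discrete_topology (quat R)) ((pack a).2 k)).
  by rewrite /= uj; exact: discrete_set1.
by apply: filterS => t tj b bt; rewrite -tj -bt /= uj.
Qed.
End Pack.
End Types.

(** * Orbit and group coordinates of a system *)

Section Coordinates.
Variables (X : groupType) (R : realType).
Variable I : set (set X).
Hypothesis It : is_twinic_ideal I.
Local Notation J := (maximal_orbits X).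
Local Notation K := (@orbit_rep X).

(** Multiplying systems multiplies their codes in the opposite order; inserting an inverse makes
    [th] reverse products, so that the group coordinate becomes multiplicative. *)
Lemma coordinate_group j : exists th : X -> quat R,
  [/\ forall x, stab (K j) x -> forall t, has_type R j t -> type_group t (th x),
      forall x y, stab (K j) x -> stab (K j) y -> th (x * y) = th y * th x,
      forall x y, stab (K j) x -> stab (K j) y -> th x = th y <-> square (K j) (x^-1 * y) &
      forall q, (forall t, has_type R j t -> type_group t q) ->
        exists2 x, stab (K j) x & th x = q].
Proof.
have mK := orbit_rep_maximal j; have [t tj] := has_type_ex R j.
have [phi [phiS phiM phiI phisurj]] := characteristic_iso_data mK tj.2.
exists (fun x => phi x^-1); split=> [x sx t'|x y sx sy|x y sx sy|q /(_ t tj) /phisurj[x sx <-]].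
- by move=> /(has_type_unique tj) <-; apply: phiS; exact: stabV.
- by rewrite invgM phiM //; exact: stabV.
- rewrite phiI ?invgK; [|exact: stabV..].
  rewrite -(stab_square_conj _ (stabV sx)) invgK mulgA mulVg mul1g.
  split=> h; first by have := squareV mK.1 h; rewrite invgM invgK.
  by have := squareV mK.1 h; rewrite invgM invgK.
- by exists x^-1; [exact: stabV|rewrite invgK].
Qed.

(** The same indexing must serve the algebraic and the topological statement; for a finite type it
    is taken from an [orbit_structure], which also makes it continuous. *)
Lemma index_data j : exists u : {M : Type & set X -> M -> bool},
  orbit_index (K j) (projT2 u) /\
  (finite_type (K j) R -> exists h, orbit_structure (K j) (projT2 u) h).
Proof.
have mK := orbit_rep_maximal j.
have [fin|nfin] := pselect (finite_type (K j) R); last first.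
  by have [M [p Mp]] := maximal_orbit_index R mK; exists (existT _ M p).
have [M [p [h ph]]] := finite_type_orbit_structure mK fin.
exists (existT _ M p); split=> [|_]; last by exists h.
exact: orbit_structure_index ph.
Qed.

Variable u : J -> {M : Type & set X -> M -> bool}.
Hypothesis u_index : forall j, orbit_index (K j) (projT2 (u j)).
Variable th : J -> X -> quat R.
Hypothesis thS : forall j x, stab (K j) x -> forall t, has_type R j t -> type_group t (th j x).
Hypothesis thM : forall j x y, stab (K j) x -> stab (K j) y ->
  th j (x * y) = th j y * th j x.
Hypothesis thI : forall j x y, stab (K j) x -> stab (K j) y ->
  th j x = th j y <-> square (K j) (x^-1 * y).
Hypothesis th_surj : forall j q, (forall t, has_type R j t -> type_group t q) ->
  exists2 x, stab (K j) x & th j x = q.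

Variable F : set (set X).
Hypothesis Flinked : linked_mod I F.
Hypothesis Ftri : forall A, [\/ F A, F (~` A) | twin I A].
Hypothesis Fexcl : forall A, F A -> ~ F (~` A).
Hypothesis Ftwin : forall A, F A -> ~ twin I A.
Hypothesis Fup : forall A B, F A -> A `<=` B -> F B.

Variable Rc : set (J * set X).
Hypothesis Rcode : is_code I K Rc.
Hypothesis Rtot : forall A, twin I A ->
  exists j B x, Rc (j, B) /\ eq_mod I (left_shift x B) A.

Variable E : J -> set X.
Hypothesis Efam : family K E.
Hypothesis ER : forall j, Rc (j, E j).

Local Notation sys := (system I F Rc).
Local Notation code := (code_of I K Rc).
Local Notation fam := (family K).
Local Notation maxK := (@orbit_rep_maximal X).
Local Notation injK := (@orbit_rep_inj X).

Let cK j : is_2cogroup (K j). Proof. exact: (maxK j).1. Qed.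

Let codeS j D : twins_of (K j) D -> stab (K j) (code j D).
Proof. by move=> KD; apply: (code_of_stab It maxK injK Rcode Rtot). Qed.

Let code_shift j D x : stab (K j) x -> twins_of (K j) D ->
  th j (code j (left_shift x D)) = th j (x * code j D).
Proof.
move=> sx KD; apply/thI.
- by apply: codeS; exact: twins_of_shift.
- by apply: stabM => //; exact: codeS.
exact: (code_of_shift It maxK injK Rcode Rtot).
Qed.

(** The cardinal [m] of the theorem. *)
Definition cube_index := {j : J & projT1 (u j)}.

Definition cube_coord (C : J -> set X) : left_zero_cube cube_index :=
  fun m => projT2 (u (tag m)) (C (tag m)) (tagged m).

Definition group_coord (C : J -> set X) (j : J) : quat R := th j (code j (C j)).

Lemma family_shift C x : fam C -> (forall j, stab (K j) (x j)) ->
  fam (fun j => left_shift (x j) (C j)).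
Proof. by move=> fC sx j; exact: twins_of_shift. Qed.

Lemma cube_coord_shift C x : fam C -> (forall j, stab (K j) (x j)) ->
  cube_coord (fun j => left_shift (x j) (C j)) = cube_coord C.
Proof.
move=> fC sx; apply/funext => -[j m]; rewrite /cube_coord /=; congr (_ m).
by apply/esym/(u_index j).1 => //; [exact: twins_of_shift|exists (x j)].
Qed.

Lemma group_coord_shift C x j : fam C -> (forall j, stab (K j) (x j)) ->
  group_coord (fun j => left_shift (x j) (C j)) j = group_coord C j * th j (x j).
Proof.
by move=> fC sx; rewrite /group_coord code_shift // thM //; exact: codeS.
Qed.

Lemma cube_coord_at C D j : cube_coord C = cube_coord D ->
  projT2 (u j) (C j) = projT2 (u j) (D j).
Proof.
move=> CD; apply/funext => m.
exact: (congr1 (fun f : left_zero_cube cube_index => f (existT _ j m)) CD).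
Qed.

Lemma cube_coord_eq C D : fam C -> fam D -> cube_coord C = cube_coord D ->
  exists2 x : J -> X, (forall j, stab (K j) (x j)) & D = (fun j => left_shift (x j) (C j)).
Proof.
move=> fC fD CD.
have /choice [x xP] : forall j, exists x, stab (K j) x /\ D j = left_shift x (C j).
  move=> j; have /(u_index j).1 [//||x sx ->] := cube_coord_at j CD; last by exists x.
  exact: fD.
exists x; first by move=> j; have [] := xP j.
by apply/funext => j; have [] := xP j.
Qed.

(** Equal orbit invariants make [D j] a shift of [C j]; equal codes put the shift, conjugated by the
    code, into the square of [K j], which fixes [C j]. *)
Lemma coord_inj_at j C D : fam C -> fam D -> projT2 (u j) (C j) = projT2 (u j) (D j) ->
  group_coord C j = group_coord D j -> C j = D j.
Proof.
move=> fC fD /(u_index j).1 [//|//|x sx DE].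
have sc := codeS (fC j).
rewrite /group_coord DE code_shift // => /(thI sc (stabM sx sc)) h.
rewrite (twins_of_square (cK j)) //.
have := (stab_square_conj ((code j (C j))^-1 * (x * code j (C j))) sc).2 h.
by rewrite !mulgA mulgV mul1g mulgK.
Qed.

Lemma coord_inj C D : fam C -> fam D -> cube_coord C = cube_coord D ->
  group_coord C = group_coord D -> C = D.
Proof.
move=> fC fD cc gg; apply/funext => j; apply: coord_inj_at => //.
  exact: cube_coord_at.
by rewrite gg.
Qed.

(** Within its orbit, [C j] is moved back by its own code and then by an element with coordinate
    [a j]. *)
Lemma coord_surj C a : fam C -> (forall j t, has_type R j t -> type_group t (a j)) ->
  exists x : J -> X, [/\ forall j, stab (K j) (x j),
    cube_coord (fun j => left_shift (x j) (C j)) = cube_coord C &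
    group_coord (fun j => left_shift (x j) (C j)) = a].
Proof.
move=> fC aG.
have /choice [y yP] : forall j, exists y, stab (K j) y /\ th j y = a j.
  by move=> j; have [y sy ya] := th_surj (aG j); exists y.
have sx j : stab (K j) (y j * (code j (C j))^-1).
  by have [sy _] := yP j; apply: stabM => //; apply: stabV; exact: codeS.
exists (fun j => y j * (code j (C j))^-1); split=> //; first exact: cube_coord_shift.
apply/funext => j; rewrite group_coord_shift //.
have [sy ya] := yP j; rewrite -thM //; last exact: codeS.
by rewrite mulgVK.
Qed.

Lemma coord_full f a : (forall j t, has_type R j t -> type_group t (a j)) ->
  exists C, [/\ fam C, cube_coord C = f & group_coord C = a].
Proof.
move=> aG.
have /choice [C CP] : forall j, exists D, twins_of (K j) D /\
    projT2 (u j) D = (fun m => f (existT _ j m)).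
  by move=> j; have [D KD Df] := (u_index j).2 (fun m => f (existT _ j m)); exists D.
have fC : fam C by move=> j; have [] := CP j.
have [x [sx xc xa]] := coord_surj fC aG.
exists (fun j => left_shift (x j) (C j)); split=> //; first exact: family_shift.
rewrite xc; apply/funext => -[j m]; rewrite /cube_coord /=.
by have [_ ->] := CP j.
Qed.

Lemma group_coord_type C : fam C -> forall j t, has_type R j t -> type_group t (group_coord C j).
Proof. by move=> fC j; apply: thS; exact: codeS. Qed.

Lemma system_coord_mul C D : fam C -> fam D -> exists CD, [/\ fam CD, sys C * sys D = sys CD,
  cube_coord CD = cube_coord C & forall j, group_coord CD j = group_coord C j * group_coord D j].
Proof.
move=> fC fD; have sD j : stab (K j) (code j (D j)) by exact: codeS.
exists (fun j => left_shift (code j (D j)) (C j)); split.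
- exact: family_shift.
- exact: (system_mul It maxK injK Flinked Ftri Fexcl Ftwin Fup Rcode Rtot).
- exact: cube_coord_shift.
- by move=> j; rewrite group_coord_shift.
Qed.

(** Recovers [C] from [system C], as the codes of [E] are trivial; each point of the result reads
    [s] at a single shift of [E j], which gives continuity. *)
Definition coord_family (s : double_power X) j := hull s (E j).

Lemma hull_coord j C : fam C -> hull (sys C) (E j) = C j.
Proof. exact: (hull_system_ref It maxK injK Ftwin Rcode Rtot Efam ER). Qed.

Lemma coord_familyE C : fam C -> coord_family (sys C) = C.
Proof. by move=> fC; apply/funext => j; exact: hull_coord. Qed.

Section Isomorphisms.
Variables I1 I3 : set exponent.
Hypothesis I1_inf : I1 `<=` range_inf 1.
Hypothesis I3_inf : I3 `<=` range_inf 3.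
Hypothesis I_type : forall j : J, exists2 t, has_type R j t & type_range I1 I3 t.

Local Notation PC := (power_product_ambient X I1 (C2 R)).
Local Notation PQ := (power_product_ambient X I3 (Q2 R)).
Local Notation SC := (power_product X I1 (C2 R)).
Local Notation SQ := (power_product X I3 (Q2 R)).
Local Notation pk := (@pack X R I1 I3).

Definition group_map (s : double_power X) : PC * PQ := pk (group_coord (coord_family s)).

Definition coord_map (s : double_power X) : left_zero_cube cube_index * PC * PQ :=
  prodAr (cube_coord (coord_family s), group_map s).

Lemma left_orbit_coord :
  isomorphism (left_orbit (superextension X) (sys E))
    ([set: left_zero_cube cube_index] `*` SC `*` SQ) coord_map.
Proof.
rewrite (left_orbit_ref It maxK injK Flinked Ftri Fexcl Ftwin Fup Rcode Rtot Efam ER).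
split; first split.
- move=> _ [C fC <-]; rewrite /coord_map /group_map coord_familyE //.
  by have [? ?] := packP I1_inf I3_inf (group_coord_type fC).
- move=> s t; rewrite !inE => -[C fC <-] [D fD <-].
  rewrite /coord_map /group_map !coord_familyE // => -[cc h1 h2].
  congr (sys _); apply: coord_inj => //.
  by apply: (pack_inj I_type); rewrite /pack; congr pair.
- move=> [[f g1] g2] [[_ /= s1] s2].
  have [a aG ag] := @pack_surj X R I1 I3 I1_inf I3_inf I_type (g1, g2) (conj s1 s2).
  have [C [fC Cf Ca]] := coord_full f aG.
  exists (sys C); first by exists C.
  by rewrite /coord_map /group_map coord_familyE // Cf Ca ag.
- move=> s t; rewrite !inE => -[C fC <-] [D fD <-].
  have [CD [fCD -> cc gg]] := system_coord_mul fC fD.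
  rewrite /coord_map /group_map !coord_familyE // cc.
  by rewrite (_ : group_coord CD = fun j => group_coord C j * group_coord D j) //; exact/funext.
Qed.

Section Corner.
Variable C : J -> set X.
Hypothesis fC : fam C.
Hypothesis CC : sys C * sys C = sys C.

Lemma corner_family s : corner (superextension X) (sys C) s <->
  exists D, [/\ fam D, s = sys D & cube_coord D = cube_coord C].
Proof.
rewrite (corner_systemP It maxK injK Flinked Ftri Fexcl Ftwin Fup Rcode Rtot Efam ER) //.
split=> [[x sx ->]|[D [fD -> DC]]].
  exists (fun j => left_shift (x j) (C j)); split=> //; first exact: family_shift.
  exact: cube_coord_shift.
by have [x sx ->] := cube_coord_eq fC fD (esym DC); exists x.
Qed.

Lemma corner_coord :
  isomorphism (corner (superextension X) (sys C)) (SC `*` SQ) group_map.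
Proof.
split; first split.
- move=> s /corner_family [D [fD -> _]]; rewrite /group_map coord_familyE //.
  exact: (packP I1_inf I3_inf (group_coord_type fD)).
- move=> s t; rewrite !inE => /corner_family [D [fD -> DC]] /corner_family [D' [fD' -> DC']].
  rewrite /group_map !coord_familyE // => /(pack_inj I_type) gg.
  by congr (sys _); apply: coord_inj; rewrite // DC.
- move=> g sg; have [a aG ag] := pack_surj I1_inf I3_inf I_type sg.
  have [x [sx xc xa]] := coord_surj fC aG.
  have fx := family_shift fC sx.
  exists (sys (fun j => left_shift (x j) (C j))).
    by apply/corner_family; exists (fun j => left_shift (x j) (C j)).
  by rewrite /group_map coord_familyE // xa.
- move=> s t; rewrite !inE => /corner_family [D [fD -> DC]] /corner_family [D' [fD' -> DC']].
  have [CD [fCD -> _ gg]] := system_coord_mul fD fD'.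
  rewrite /group_map !coord_familyE //.
  by rewrite (_ : group_coord CD = fun j => group_coord D j * group_coord D' j) //; exact/funext.
Qed.
(** A single set tests one point of one coordinate; as the orbits are fixed in the corner, the
    discrete group coordinate at [j] determines that coordinate. *)
Lemma corner_coord_open s A : corner (superextension X) (sys C) s ->
  nbhs (group_map s) [set t | forall s', corner (superextension X) (sys C) s' ->
    group_map s' = t -> (s' A <-> s A)].
Proof.
move=> /corner_family [D [fD -> DC]].
have [[j [y Ajy]]|[P AP]] :=
    system_coordinate It maxK Ftwin Rcode Rtot A; last first.
  by apply: nbhs_all => t s' /corner_family [D' [fD' -> DC']] _; rewrite !AP.
rewrite /group_map coord_familyE //.
apply: filterS (pack_nbhs I_type (group_coord D) j) => t tj s' /corner_family [D' [fD' -> DC']].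
rewrite coord_familyE // => /tj gg; rewrite !Ajy //.
rewrite (coord_inj_at (j := j) fD fD') //.
by apply: cube_coord_at; rewrite DC.
Qed.
End Corner.

Let SM := @superextensionM X.

Let primE : primitive_idempotent (superextension X) (sys E).
Proof.
exact: (system_primitive It maxK injK Flinked Ftri Fexcl Ftwin Fup Rcode Rtot Efam ER).
Qed.

Lemma minimal_left_ideal_coord L : minimal_left_ideal (superextension X) L ->
  alg_isomorphic L ([set: left_zero_cube cube_index] `*` SC `*` SQ).
Proof.
move=> /(minimal_left_ideal_idempotent SM primE) [e [pe -> Ee eE]].
apply: alg_isomorphic_trans (ex_intro _ _ left_orbit_coord).
exact: left_orbit_isomorphic.
Qed.

(** Right multiplication carries [G] onto the corner of an idempotent of the left ideal of
    [system E] generating the same right ideal; right shifts are continuous in both directions. *)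
Lemma maximal_subgroup_system G : maximal_subgroup (superextension X) G ->
  exists C, [/\ fam C, sys C * sys C = sys C &
    top_isomorphic G (corner (superextension X) (sys C))].
Proof.
move=> /(maximal_subgroup_corner SM primE) [c [e [[Sc cc] -> [Ee [Se ee _]] ce ec]]].
move: Ee; rewrite (left_orbit_ref It maxK injK Flinked Ftri Fexcl Ftwin Fup Rcode Rtot Efam ER).
move=> [C fC CE]; exists C; rewrite CE; split=> //.
exact: corner_right_isomorphic.
Qed.

Lemma maximal_subgroup_coord G : maximal_subgroup (superextension X) G ->
  alg_isomorphic G (SC `*` SQ).
Proof.
move=> /maximal_subgroup_system [C [fC CC [f [_ [iso _ _ _]]]]].
exact: alg_isomorphic_trans (ex_intro _ f iso) (ex_intro _ _ (corner_coord fC CC)).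
Qed.

Variable h : J -> set X -> X.
Hypothesis h_struct : forall j, orbit_structure (K j) (projT2 (u j)) (h j).

Lemma hull_nbhs (s : double_power X) D (Fi : set X) : finite_set Fi ->
  nbhs s [set s' | forall y, Fi y -> (hull s D y <-> hull s' D y)].
Proof.
move=> finF; apply: finite_nbhs => // y _.
by apply: filterS (double_power_nbhs s (left_shift y^-1 D)) => s' [e1 e2]; split; [exact: e2|exact: e1].
Qed.

(** Finitely many points of [D j] determine its [h]; with the orbit fixed in the corner, this
    determines [D j] and with it the code. *)
Lemma corner_coord_continuous C : fam C -> sys C * sys C = sys C ->
  continuous_on (corner (superextension X) (sys C)) group_map.
Proof.
move=> fC CC; apply: pack_continuous_on => j s /(corner_family fC CC) [D [fD sE DC]].
have [_ _ _ _ [_ hF _]] := h_struct j; have [Fi finF FP] := hF (D j) (fD j).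
apply: filterS (hull_nbhs s (E j) finF) => s' /= s's.
move=> /(corner_family fC CC) [D' [fD' s'E DC']]; move: s's.
rewrite s'E sE !hull_coord // !coord_familyE // => s's; rewrite /group_coord.
rewrite -(orbit_structure_inj (h_struct j) (fD j) (fD' j)) //.
  by apply: cube_coord_at; rewrite DC.
exact: FP.
Qed.

Lemma maximal_subgroup_top_coord G : maximal_subgroup (superextension X) G ->
  top_isomorphic G (SC `*` SQ).
Proof.
move=> /maximal_subgroup_system [C [fC CC iso]]; apply: top_isomorphic_trans iso _.
apply: top_isomorphic_double_power (corner_coord fC CC) _ _.
  exact: corner_coord_continuous.
exact: corner_coord_open.
Qed.

Hypothesis code_h : forall j D, twins_of (K j) D ->
  square (K j) ((code j D)^-1 * h j D).

Lemma code_h_eq j D D' : twins_of (K j) D -> twins_of (K j) D' ->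
  square (K j) ((h j D)^-1 * h j D') <-> th j (code j D) = th j (code j D').
Proof.
move=> KD KD'; rewrite thI; [|exact: codeS..].
rewrite -!square_coset_eq //.
have /(square_coset_eq _ _ (cK j)) -> := code_h KD.
by have /(square_coset_eq _ _ (cK j)) -> := code_h KD'.
Qed.

(** Across different orbits the code itself must depend continuously on [D j]; [code_h] identifies
    it with [h], which finitely many points determine. *)
Lemma coord_map_continuous :
  continuous_on (left_orbit (superextension X) (sys E)) coord_map.
Proof.
rewrite (left_orbit_ref It maxK injK Flinked Ftri Fexcl Ftwin Fup Rcode Rtot Efam ER).
apply: (@comp_continuous_on _ _ _ _ setT _ (@prodAr _ _ _)) => //; last first.
  by move=> p _; apply: cvg_within_filter; exact: prodAr_continuous.
apply: pair_continuous_on.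
  apply: prod_continuous_on => -[j m]; apply: bool_continuous_on => _ [D fD <-].
  have [_ _ _ _ [_ _ pF]] := h_struct j; have [Fi finF FP] := pF (D j) m (fD j).
  apply: filterS (hull_nbhs (sys D) (E j) finF) => s' /= s's [D' fD' s'E]; move: s's.
  rewrite -s'E !hull_coord // !coord_familyE // => s's.
  by rewrite /cube_coord /= (FP (D' j)).
apply: pack_continuous_on => j _ [D fD <-].
have [_ _ _ _ [_ hF _]] := h_struct j; have [Fi finF FP] := hF (D j) (fD j).
apply: filterS (hull_nbhs (sys D) (E j) finF) => s' /= s's [D' fD' s'E]; move: s's.
rewrite -s'E !hull_coord // !coord_familyE // => s's.
by apply/esym/code_h_eq => //; exact: FP.
Qed.

(** A point of [D j] is determined by finitely many orbit bits and the class of [h], the latter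
    being the group coordinate by [code_h]. *)
Lemma coord_map_open s A : left_orbit (superextension X) (sys E) s ->
  nbhs (coord_map s) [set t | forall s', left_orbit (superextension X) (sys E) s' ->
    coord_map s' = t -> (s' A <-> s A)].
Proof.
rewrite (left_orbit_ref It maxK injK Flinked Ftri Fexcl Ftwin Fup Rcode Rtot Efam ER).
move=> [D fD <-].
have [[j [y Ajy]]|[P AP]] :=
    system_coordinate It maxK Ftwin Rcode Rtot A; last first.
  by apply: nbhs_all => t s' [D' fD' <-] _; rewrite !AP.
have [_ _ _ _ [inv _ _]] := h_struct j; have [Fm finF FP] := inv (D j) y (fD j).
pose Q1 : set (left_zero_cube cube_index) :=
  [set c | forall m, Fm m -> c (existT _ j m) = cube_coord D (existT _ j m)].
pose Q2 : set (PC * PQ) := [set t | forall b, pk b = t -> b j = group_coord D j].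
have Q1N : nbhs (cube_coord D) Q1.
  apply: (@finite_nbhs _ {classic projT1 (u j)}) => // m _.
  by apply: (@prod_coordinate_nbhs _ (fun _ : cube_index => bool) (cube_coord D) (existT _ j m)
    [set cube_coord D (existT _ j m)]).
have Q2N : nbhs (pk (group_coord D)) Q2 by exact: pack_nbhs.
have QN : nbhs (prodA (coord_map (sys D))) (Q1 `*` Q2).
  by rewrite /coord_map /group_map prodArK coord_familyE //; exists (Q1, Q2).
have QN' : nbhs (coord_map (sys D)) (prodA @^-1` (Q1 `*` Q2)) := prodA_continuous QN.
apply: filterS QN' => t [tc tg] s' [D' fD' <-] tE.
move: tc tg; rewrite -tE /coord_map prodArK /group_map coord_familyE //= => tc tg.
rewrite !Ajy //; apply: iff_sym; apply: FP => //.
  by apply/code_h_eq => //; exact: esym (tg (group_coord D') erefl).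
by move=> m Fm'; apply/esym; exact: tc.
Qed.

Lemma minimal_left_ideal_top_coord : exists2 L, minimal_left_ideal (superextension X) L &
  top_isomorphic L ([set: left_zero_cube cube_index] `*` SC `*` SQ).
Proof.
exists (left_orbit (superextension X) (sys E)); first exact: primitive_minimal_left.
apply: top_isomorphic_double_power left_orbit_coord _ _.
  exact: coord_map_continuous.
exact: coord_map_open.
Qed.
End Isomorphisms.
End Coordinates.

(** * Choice of the codes *)

Section ReferenceCodes.
Variables (X : groupType) (I : set (set X)).
Hypothesis It : is_twinic_ideal I.
Local Notation J := (maximal_orbits X).
Local Notation K := (@orbit_rep X).

Lemma twins_of_eq_mod_index i j D D' x : twins_of (K i) D -> twins_of (K j) D' ->
  eq_mod I (left_shift x D) D' -> i = j /\ conjugate x (K i) = K j.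
Proof.
move=> KD KD' xD.
have [_ DE] := twins_of_cogroup It (orbit_rep_maximal i) KD.
have [_ DE'] := twins_of_cogroup It (orbit_rep_maximal j) KD'.
have e : conjugate x (K i) = K j.
  by rewrite -DE -DE' -twin_cogroup_shift // (twin_cogroup_eq_mod It xD).
by split=> //; apply/esym/(orbit_rep_inj (x := x)).
Qed.

(** The stabilizer of [E j] modulo [I] is the square of its 2-cogroup, which is [K j] by
    maximality. *)
Lemma single_code E : family K E -> is_code I K [set p | p.2 = E p.1].
Proof.
move=> fE; split=> [j B /= ->|j B i C x /= -> -> xE].
  by have [tE ->] := twins_of_cogroup It (orbit_rep_maximal j) (fE j); split=> // x.
have [ji _] := twins_of_eq_mod_index (fE j) (fE i) xE; split=> //.
move: xE; rewrite -ji => xE.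
have [tE EK] := twins_of_cogroup It (orbit_rep_maximal j) (fE j).
by rewrite -EK; apply/eq_mod_fix_square.
Qed.

(* If [y] lies in [A] but not in [B], then [Ky] is contained in [B \ A], so that
   its left shift [y^-1 K y] is a maximal 2-cogroup in [I]. *)
Lemma twins_of_eq_mod L A B : I `&` maximal_2cogroups X = set0 -> maximal_2cogroups X L ->
  twins_of L A -> twins_of L B -> eq_mod I A B -> A = B.
Proof.
move=> IK mL; have [[_ _ IS _] Iinv _] := It.
have sub A' B' : twins_of L A' -> twins_of L B' -> subset_mod I A' B' -> B' `<=` A'.
  move=> LA LB AB y By; apply: contrapT => nAy.
  have : (I `&` maximal_2cogroups X) (conjugate y^-1 L); last by rewrite IK.
  split; last exact: conjugate_maximal.
  have <- : left_shift y^-1 (right_shift L y) = conjugate y^-1 L.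
    apply/seteqP; split=> z.
      by move=> [_ [a La <-] <-]; exists a; rewrite // invgK mulgA.
    by move=> [a La <-]; exists (a * y); [exists a|rewrite invgK mulgA].
  apply: Iinv; apply: IS AB _ => _ [a La <-]; split.
    apply: contrapT => nA; have : left_shift a A' (a * y).
      by rewrite LA.
    by rewrite left_shiftE mulKg.
  have : left_shift a B' (a * y) by rewrite left_shiftE mulKg.
  by rewrite LB.
by move=> LA LB [AB BA]; apply/seteqP; split; exact: sub.
Qed.

(** All sets with trivial [h] become references, so that codes agree with [h]. Two of them that are
    shifts of each other modulo [I] are so exactly, by [twins_of_eq_mod], and equivariance of [h]
    puts the shift into the square. *)
Lemma structure_code (M : J -> Type) (p : forall j, set X -> M j -> bool) (h : J -> set X -> X) :
  I `&` maximal_2cogroups X = set0 -> (forall j, orbit_structure (K j) (p j) (h j)) ->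
  is_code I K [set q | twins_of (K q.1) q.2 /\ square (K q.1) (h q.1 q.2)].
Proof.
move=> IK hst; split=> [j B /= [KB _]|j B i C x /= [KB hB] [KC hC] xB].
  by have [tB ->] := twins_of_cogroup It (orbit_rep_maximal j) KB; split=> // x.
have [ji sx] := twins_of_eq_mod_index KB KC xB; split=> //.
move: KC hC sx; rewrite -ji => KC hC sx.
have cK := (orbit_rep_maximal j).1.
have [_ hsh _ _ _] := hst j.
have xBC : left_shift x B = C.
  by apply: (twins_of_eq_mod IK (orbit_rep_maximal j)) => //; exact: twins_of_shift.
have := hsh B x KB sx; rewrite xBC mulgA => /(squareMsr cK _ hB).
by move=> /(squareM cK hC); rewrite mulVKg.
Qed.
End ReferenceCodes.

Lemma finite_types (R : realType) (X : groupType) :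
  q_orbits X (C2 R Infty) = set0 -> q_orbits X (Q2 R Infty) = set0 ->
  forall j : maximal_orbits X, finite_type (orbit_rep j) R /\
    exists2 t, has_type R j t & type_range (range_fin 1) (range_fin 3) t.
Proof.
move=> qC qQ j; have [t tj] := has_type_ex R j; have [tr iso] := tj.
move: t tj tr iso => [[] [n|]] tj /= tr iso.
- by split; [left; exists n|exists (true, Fin n)].
- by have /q_orbitsP : alg_isomorphic (characteristic_group (orbit_rep j)) (C2 R Infty) by []; rewrite qC.
- by split; [right; exists n|exists (false, Fin n)].
- by have /q_orbitsP : alg_isomorphic (characteristic_group (orbit_rep j)) (Q2 R Infty) by []; rewrite qQ.
Qed.

Theorem theorem18p11 (R : realType) (X : groupType) (hX : is_twinic X) :
  exists M : Type,
    [/\ forall L, minimal_left_ideal (superextension X) L ->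
          alg_isomorphic L
            ([set: left_zero_cube M] `*`
             power_product X (range_inf 1) (C2 R) `*`
             power_product X (range_inf 3) (Q2 R)),
        q_orbits X (C2 R Infty) = set0 -> q_orbits X (Q2 R Infty) = set0 ->
        twinic_ideal X `&` maximal_2cogroups X = set0 ->
        exists2 L, minimal_left_ideal (superextension X) L &
          top_isomorphic L
            ([set: left_zero_cube M] `*`
             power_product X (range_fin 1) (C2 R) `*`
             power_product X (range_fin 3) (Q2 R)),
        forall G, maximal_subgroup (superextension X) G ->
          alg_isomorphic G
            (power_product X (range_inf 1) (C2 R) `*`
             power_product X (range_inf 3) (Q2 R)) &
        q_orbits X (C2 R Infty) = set0 -> q_orbits X (Q2 R Infty) = set0 ->
        forall G, maximal_subgroup (superextension X) G ->
          top_isomorphic G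
            (power_product X (range_fin 1) (C2 R) `*`
             power_product X (range_fin 3) (Q2 R))].
Proof.
have It := twinic_ideal_twinic hX.
have [F [Fl Ftri Fex [Ftw Fup]]] := maximal_linked_mod It.
have maxK := @orbit_rep_maximal X; have injK := @orbit_rep_inj X.
have repK := @orbit_rep_surj X.
have [u uP] := choice (@index_data X R).
have u_index j : orbit_index (orbit_rep j) (projT2 (u j)) by have [] := uP j.
have [th thP] := choice (@coordinate_group X R).
have thS j : forall x, stab (orbit_rep j) x -> forall t, has_type R j t -> type_group t (th j x).
  by have [] := thP j.
have thM j : forall x y, stab (orbit_rep j) x -> stab (orbit_rep j) y ->
  th j (x * y)%g = (th j y * th j x)%g by have [] := thP j.
have thI j : forall x y, stab (orbit_rep j) x -> stab (orbit_rep j) y ->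
  th j x = th j y <-> square (orbit_rep j) (x^-1 * y)%g by have [] := thP j.
have th_surj j : forall q, (forall t, has_type R j t -> type_group t q) ->
  exists2 x, stab (orbit_rep j) x & th j x = q by have [] := thP j.
(* For (1), (3) and (4) the references are arbitrary elements of the sets of twins. *)
have [E0 fE0] : exists E0, family (@orbit_rep X) E0.
  have ex (j : maximal_orbits X) : exists D, twins_of (orbit_rep j) D.
    by have [D KD _] := (u_index j).2 (fun _ => false); exists D.
  by have [E0] := choice ex; exists E0.
have [Rc [RR Rcode Rtot]] := code_extension It repK (single_code It fE0).
have ER j : Rc (j, E0 j) by exact: RR.
have inf_type (j : maximal_orbits X) :
    exists2 t, has_type R j t & type_range (range_inf 1) (range_inf 3) t.
  by have [t tj] := has_type_ex R j; exists t => //; exact: tj.1.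
have fin1 : range_fin 1 `<=` range_inf 1 by case.
have fin3 : range_fin 3 `<=` range_inf 3 by case.
have h_ex : q_orbits X (C2 R Infty) = set0 -> q_orbits X (Q2 R Infty) = set0 ->
    exists h, forall j, orbit_structure (orbit_rep j) (projT2 (u j)) (h j).
  move=> qC qQ.
  have ex (j : maximal_orbits X) : exists h, orbit_structure (orbit_rep j) (projT2 (u j)) h.
    by have [_] := uP j; apply; have [] := finite_types qC qQ j.
  by have [h] := choice ex; exists h.
exists (cube_index u); split.
- by apply: (minimal_left_ideal_coord It u_index thS thM thI th_surj Fl Ftri Fex Ftw Fup
    Rcode Rtot fE0 ER).
- move=> qC qQ IK; have [h hst] := h_ex qC qQ.
  (* For (2) the codes are chosen again, from all sets with trivial [h]; the orbit coordinates [u]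
     stay the same, and with them [M]. *)
  have [Rd [RRd Rdcode Rdtot]] := code_extension It repK (structure_code It IK hst).
  have /choice [E EP] : forall j, exists D, twins_of (orbit_rep j) D /\ square (orbit_rep j) (h j D).
    move=> j; have cK := (maxK j).1; have [_ _ _ surj _] := hst j.
    have [D [KD _ hD]] := surj (fun _ => false) 1%g (stab1 _); exists D; split=> //.
    by have := squareV cK hD; rewrite invgM invgK invg1 mul1g.
  have fE : family (@orbit_rep X) E by move=> j; have [] := EP j.
  have ERd j : Rd (j, E j) by apply: RRd; exact: EP.
  have code_h j D : twins_of (orbit_rep j) D ->
      square (orbit_rep j) ((code_of (twinic_ideal X) (@orbit_rep X) Rd j D)^-1 * h j D)%g.
    move=> KD; have cK := (maxK j).1; have [hs hsh _ _ _] := hst j.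
    have sV := stabV (hs D KD).
    have KB := twins_of_shift sV KD.
    (* [D] moved back by [(h D)^-1] has trivial [h], so it is a reference and [h D] is a code of
       [D]. *)
    apply: (code_of_unique It maxK injK Rdcode Rdtot (B := left_shift (h j D)^-1%g D)) => //.
      apply: RRd; split=> //=.
      have := squareV cK (hsh D _ KD sV).
      by rewrite mulVg mulg1 invgK.
    by rewrite left_shiftVK; exact: eq_mod_refl.
  apply: (minimal_left_ideal_top_coord It u_index thS thM thI th_surj Fl Ftri Fex Ftw Fup
    Rdcode Rdtot fE ERd fin1 fin3 _ hst code_h).
  by move=> j; have [] := finite_types qC qQ j.
- by apply: (maximal_subgroup_coord It u_index thS thM thI th_surj Fl Ftri Fex Ftw Fup
    Rcode Rtot fE0 ER).
move=> qC qQ G mG; have [h hst] := h_ex qC qQ.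
apply: (maximal_subgroup_top_coord It u_index thS thM thI th_surj Fl Ftri Fex Ftw Fup
  Rcode Rtot fE0 ER fin1 fin3 _ hst mG).
by move=> j; have [] := finite_types qC qQ j.
Qed.
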